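(* Let $N\ge 2$, $M>0$, and let $(p,q)\in\mathbb R^2$ satisfy $p\le 0$ and $q\ge\frac{N+1}{N-1}$. There exists a constant $C=C(N,M,q)>0$ such that, for every domain $\Omega\subset\mathbb R^N$ and every positive solution $u$ of $$-\Delta u=u^p+M|\nabla u|^q\quad\text{in }\Omega,$$ one has $$|\nabla u(x)|\le C\,\mathrm{dist}^{-\frac{1}{q-1}}(x,\partial\Omega),\qquad x\in\Omega.$$ Consequently, the equation $-\Delta u=u^p+M|\nabla u|^q$ possesses no positive solution in $\mathbb R^N$.
   Context: A solution of $-\Delta u=u^p+M|\nabla u|^q$ in $\Omega$ means a weak solution: a function $u\in C^1(\Omega)$ with $|\nabla u|^q\in L^1_{\rm loc}(\Omega)$ and $\int_\Omega\langle\nabla u,\nabla\psi\rangle=\int_\Omega u^p\psi+M\int_\Omega|\nabla u|^q\psi$ for all $\psi\in C_0^\infty(\Omega)$. Positive means $u>0$ in $\Omega$. $\mathrm{dist}^{-s}(x,\partial\Omega)$ denotes $(\mathrm{dist}(x,\partial\Omega))^{-s}$; if $\Omega=\mathbb R^N$ the distance is $+\infty$ and its negative powers are $0$. *)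

(* Defs.v *)
From HB Require Import structures.
From mathcomp Require Import all_boot all_order all_algebra.
From mathcomp Require Import all_classical all_reals all_analysis.

Set Implicit Arguments.
Unset Strict Implicit.
Unset Printing Implicit Defensive.

Import Order.TTheory GRing.Theory Num.Theory.
Import numFieldNormedType.Exports.

Local Open Scope classical_set_scope.
Local Open Scope ring_scope.

(* The library norm on 'rV[R]_n is the sup norm: it is used only through the
   topology and the derivatives it induces.  Lengths are Euclidean. *)
Definition dotrV (R : realType) n (x y : 'rV[R]_n) : R :=
  \sum_(i < n) x 0 i * y 0 i.

Definition enorm (R : realType) n (x : 'rV[R]_n) : R := Num.sqrt (dotrV x x).

Definition dist_rV (R : realType) n (x : 'rV[R]_n) (A : set 'rV[R]_n)
  : \bar R := ereal_inf [set (enorm (x - y))%:E | y in A].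

Definition frontier (T : topologicalType) (A : set T) : set T :=
  closure A `\` interior A.

Definition domain (R : realType) n (Omega : set 'rV[R]_n) : Prop :=
  [/\ open Omega, connected Omega & Omega !=set0].

Definition partial (R : realType) n (i : 'I_n) (f : 'rV[R]_n -> R)
  : 'rV[R]_n -> R := fun x => 'D_(delta_mx 0 i) f x.

Definition grad (R : realType) n (f : 'rV[R]_n -> R) (x : 'rV[R]_n)
  : 'rV[R]_n := \row_(i < n) partial i f x.

(* C^k on an open set D: all partial derivatives of order at most k exist and
   are continuous at the points of D. *)
Fixpoint Ck (R : realType) n (k : nat) (D : set 'rV[R]_n)
    (f : 'rV[R]_n -> R) : Prop :=
  (forall x, D x -> {for x, continuous f}) /\
  if k is k'.+1 then
    forall i : 'I_n, (forall x, D x -> derivable f x (delta_mx 0 i)) /\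
                     Ck k' D (partial i f)
  else True.

Definition Cc_infty (R : realType) n (D : set 'rV[R]_n)
    (psi : 'rV[R]_n -> R) : Prop :=
  let supp := closure [set x | psi x != 0] in
  [/\ forall k, Ck k setT psi, compact supp & supp `<=` D].

(* The product sigma-algebra on R^n, as the library does for tuples; since R is
   second countable, it is the Borel sigma-algebra. *)
Section measurable_rV.
Context {R : realType}.
Variable n : nat.

Let coors : 'I_n -> 'rV[R]_n -> measurableTypeR R := fun i x => x 0 i.

Let rV_set0 : g_sigma_preimage coors set0.
Proof. exact: sigma_algebra0. Qed.

Let rV_setC A : g_sigma_preimage coors A -> g_sigma_preimage coors (~` A).
Proof. exact: sigma_algebraC. Qed.

Let rV_bigcup (F : (set 'rV[R]_n)^nat) :
  (forall i, g_sigma_preimage coors (F i)) ->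
  g_sigma_preimage coors (\bigcup_i (F i)).
Proof. exact: sigma_algebra_bigcup. Qed.

HB.instance Definition _ :=
  @isMeasurable.Build default_measure_display
  'rV[R]_n (g_sigma_preimage coors) rV_set0 rV_setC rV_bigcup.

Lemma measurable_coor (i : 'I_n) : measurable_fun setT (coors i).
Proof.
move=> _ B mB; rewrite setTI; apply: sub_sigma_algebra => /=.
rewrite -bigcup_seq /=; exists i => /=; first by rewrite mem_index_enum.
by exists B => //; rewrite setTI.
Qed.

Lemma measurable_fun_rV d (T : measurableType d) (f : T -> 'rV[R]_n) :
  (forall i, measurable_fun setT (coors i \o f)) -> measurable_fun setT f.
Proof.
move=> mf _ A mA; rewrite setTI; move: A mA.
have sf : sigma_algebra setT [set A : set 'rV[R]_n | measurable (f @^-1` A)].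
  split=> /= [|A mA|F mF]; first by rewrite preimage_set0.
  - by rewrite setTD preimage_setC; exact: measurableC.
  - by rewrite preimage_bigcup; exact: bigcupT_measurable.
apply: smallest_sub => // A; rewrite -bigcup_seq => -[i _ [B mB <-]] /=.
by have := mf i measurableT B mB; rewrite !setTI.
Qed.

End measurable_rV.

Definition snoc_rV (R : realType) n (z : 'rV[R]_n * measurableTypeR R)
  : 'rV[R]_n.+1 :=
  \row_(i < n.+1) if unlift ord_max i is Some j then z.1 0 j else z.2.

Lemma measurable_snoc_rV (R : realType) n :
  measurable_fun setT (@snoc_rV R n).
Proof.
apply: measurable_fun_rV => i; case: (unliftP ord_max i) => [j|] ij.
- rewrite (_ : _ \o _ = (fun x : 'rV[R]_n => x 0 j : measurableTypeR R) \o fst).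
    exact: measurableT_comp (measurable_coor j) measurable_fst.
  by apply/funext => z; rewrite /= /snoc_rV mxE ij liftK.
- rewrite (_ : _ \o _ = snd) //.
  by apply/funext => z; rewrite /= /snoc_rV mxE ij unlift_none.
Qed.

Section product_with_R.
Context {R : realType} (n : nat) (m : {measure set 'rV[R]_n -> \bar R}).

Definition prod_lebesgue : set 'rV[R]_n.+1 -> \bar R :=
  pushforward (m \x lebesgue_measure)%E (@snoc_rV R n).

Let msnoc := @measurable_snoc_rV R n.

Let prod_lebesgue0 : prod_lebesgue set0 = 0%E.
Proof. exact: measure0. Qed.

Let prod_lebesgue_ge0 A : (0 <= prod_lebesgue A)%E.
Proof. exact: measure_ge0. Qed.

Let prod_lebesgue_sigma_additive : semi_sigma_additive prod_lebesgue.
Proof. exact: measure_semi_sigma_additive. Qed.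

HB.instance Definition _ := isMeasure.Build _ _ _ prod_lebesgue
  prod_lebesgue0 prod_lebesgue_ge0 prod_lebesgue_sigma_additive.

End product_with_R.

(* Lebesgue measure on R^n: the n-fold product of the one on R. *)
Fixpoint lebesgue_rV (R : realType) (n : nat)
  : {measure set 'rV[R]_n -> \bar R} :=
  if n is n'.+1 then prod_lebesgue (lebesgue_rV R n')
  else dirac (0 : 'rV[R]_0).

Section weak_solutions.
Context {R : realType} {n : nat}.
Implicit Types (p M q : R) (Omega : set 'rV[R]_n) (f u : 'rV[R]_n -> R).
Local Open Scope ereal_scope.

Notation mu := (lebesgue_rV R n).

Definition L1loc Omega f : Prop :=
  forall K, K `<=` Omega -> compact K -> mu.-integrable K (EFin \o f).

(* For u > 0 on Omega and q > 0 (the only case used), [u x `^ p] is the usual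
   power and every integrand is continuous with compact support in Omega, so
   the three integrals are finite. *)
Definition weak_solution p M q Omega u : Prop :=
  [/\ Ck 1 Omega u,
      L1loc Omega (fun x => enorm (grad u x) `^ q)%R &
      forall psi, Cc_infty Omega psi ->
        \int[mu]_(x in Omega) (dotrV (grad u x) (grad psi x))%:E =
        \int[mu]_(x in Omega) (u x `^ p * psi x)%R%:E +
        M%:E * \int[mu]_(x in Omega) (enorm (grad u x) `^ q * psi x)%R%:E].

Definition positive_solution p M q Omega u : Prop :=
  (forall x, Omega x -> (0 < u x)%R) /\ weak_solution p M q Omega u.

End weak_solutions.

(* d^(-s) for s > 0, with (+oo)^(-s) = 0; the library sets +oo `^ (- s) = +oo,
   hence the inverse. *)
Definition negpow (R : realType) (d : \bar R) (s : R) : \bar R :=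
  ((d `^ s)^-1)%E.

(* Main.v *)
(* A nonlocal Bernstein argument, which only uses that u is C^1.  Let K be a smooth
   radial bump on the unit ball and k >= 0 the radial weight with grad K (y) = - k(y) y.
   Testing the equation with K((z - x)/r) gives
     int k(y) (grad u (x + r y) . y) dy = - r int K(y) f(x + r y) dy,
   where f = u^p + M |grad u|^q, and integrating in r gives a mean value expansion
     int k(y) (u(x + r y) - u(x)) dy = - (r^2 / 2) (int K) f(x) + o(r^2).
   The squared gradient is replaced by Z(x) = int k(h) (u(x + eps h) - u(x))^2 dh.  Averaging
   Z with k and using Fubini, the expansion yields a Bochner-type inequality for Z
   with |D^2 u|^2 replaced by W(x) = int k(h) |grad u (x + eps h) - grad u (x)|^2 dh, and
   Cauchy-Schwarz with the first identity bounds W below by eps^2 f^2 / n.  Since p <= 0,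
   the contribution of u^p has a favourable sign.  At a maximum of Z eta^m, with eta a
   paraboloid vanishing on the boundary of a ball of radius rho and m (q - 1) >= 2, these
   facts bound |grad u|^(q - 1) eta rho, and eps -> 0 gives
   |grad u| <= C rho^(-1/(q-1)) at the centre of the ball. *)

Require Import Defs.
From HB Require Import structures.
From mathcomp Require Import all_boot all_order all_algebra.
From mathcomp Require Import all_classical all_reals all_analysis.
From mathcomp Require Import measurable_realfun ring lra.

Set Implicit Arguments.
Unset Strict Implicit.
Unset Printing Implicit Defensive.

Import Order.TTheory GRing.Theory Num.Theory.
Import numFieldNormedType.Exports.

Local Open Scope classical_set_scope.
Local Open Scope ring_scope.

(** * Euclidean space *)

(** They can because integration by parts makes k isotropic: int k y_i = 0 and int k y_i y_j =
    delta_ij int K, so first and second order quantities appear with one common factor c1 = int K.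
    No limit in eps is taken. The bound is proved by contradiction: if it fails at the centre by
    some margin, the gradient at any maximum of Z eta^m is bounded below by a number fixed
    beforehand, and the tolerances tau (linearisation of |a|^q), s (modulus of continuity) and eps
    (scale) are chosen in this order, before the maximum point exists. The solution influences only
    these tolerances; the constant is assembled from N, M, q and the masses of K and k, hence is
    uniform in p, Omega and u. On the whole space the radius is unbounded, which forces the gradient
    to vanish, and a constant is excluded because u^p > 0. *)

Section euclidean.
Context {R : realType} {n : nat}.
Implicit Types (x y z : 'rV[R]_n) (a : R).

Lemma dotrVC x y : dotrV x y = dotrV y x.
Proof. by apply: eq_bigr => i _; rewrite mulrC. Qed.

Lemma dotrVDl x y z : dotrV (x + y) z = dotrV x z + dotrV y z.
Proof. by rewrite -big_split/=; apply: eq_bigr => i _; rewrite mxE mulrDl. Qed.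

Lemma dotrVZl a x z : dotrV (a *: x) z = a * dotrV x z.
Proof. by rewrite big_distrr/=; apply: eq_bigr => i _; rewrite mxE mulrA. Qed.

Lemma dotrVDr x y z : dotrV x (y + z) = dotrV x y + dotrV x z.
Proof. by rewrite !(dotrVC x) dotrVDl. Qed.

Lemma dotrVZr a x z : dotrV x (a *: z) = a * dotrV x z.
Proof. by rewrite !(dotrVC x) dotrVZl. Qed.

Lemma dotrVNl x z : dotrV (- x) z = - dotrV x z.
Proof. by rewrite -scaleN1r dotrVZl mulN1r. Qed.

Lemma dotrVNr x z : dotrV x (- z) = - dotrV x z.
Proof. by rewrite !(dotrVC x) dotrVNl. Qed.

Lemma dotrVBl x y z : dotrV (x - y) z = dotrV x z - dotrV y z.
Proof. by rewrite dotrVDl dotrVNl. Qed.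

Lemma dotrVBr x y z : dotrV x (y - z) = dotrV x y - dotrV x z.
Proof. by rewrite dotrVDr dotrVNr. Qed.

Lemma dotrV0l z : dotrV 0 z = 0.
Proof. by rewrite -(scale0r z) dotrVZl mul0r. Qed.

Lemma dotrV0r z : dotrV z 0 = 0.
Proof. by rewrite dotrVC dotrV0l. Qed.

Lemma dotrV_delta x (i : 'I_n) : dotrV x (delta_mx 0 i) = x 0 i.
Proof.
rewrite /dotrV (bigD1 i)//= mxE !eqxx mulr1 big1 ?addr0// => j ji.
by rewrite mxE eqxx (negbTE ji) mulr0.
Qed.

Lemma dotrV_ge0 x : 0 <= dotrV x x.
Proof. by apply: sumr_ge0 => i _; rewrite -expr2 sqr_ge0. Qed.

Lemma dotrV_sqrD x y :
  dotrV (x + y) (x + y) = dotrV x x + 2 * dotrV x y + dotrV y y.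
Proof. by rewrite dotrVDl !dotrVDr (dotrVC y x); ring. Qed.

Lemma enorm_ge0 x : 0 <= enorm x.
Proof. exact: sqrtr_ge0. Qed.

Lemma sqr_enorm x : enorm x ^+ 2 = dotrV x x.
Proof. by rewrite sqr_sqrtr// dotrV_ge0. Qed.

Lemma enorm_leP x a : 0 <= a -> (enorm x <= a) = (dotrV x x <= a ^+ 2).
Proof. by move=> a0; rewrite -sqr_enorm ler_pXn2r// nnegrE ?enorm_ge0. Qed.

Lemma enormZ a x : enorm (a *: x) = `|a| * enorm x.
Proof.
by rewrite /enorm dotrVZl dotrVZr mulrA -expr2 sqrtrM ?sqr_ge0// sqrtr_sqr.
Qed.

Lemma enorm0 : enorm (0 : 'rV[R]_n) = 0.
Proof. by rewrite /enorm dotrV0l sqrtr0. Qed.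

Lemma enormN x : enorm (- x) = enorm x.
Proof. by rewrite -scaleN1r enormZ normrN1 mul1r. Qed.

Lemma enormB x y : enorm (x - y) = enorm (y - x).
Proof. by rewrite -enormN opprB. Qed.

Lemma coord_le_enorm x i : `|x 0 i| <= enorm x.
Proof.
rewrite -sqrtr_sqr ler_sqrt ?dotrV_ge0// /dotrV (bigD1 i)//= -expr2 lerDl.
by apply: sumr_ge0 => j _; rewrite -expr2 sqr_ge0.
Qed.

Lemma enorm_eq0 x : enorm x = 0 -> x = 0.
Proof.
move=> x0; apply/rowP => i; rewrite mxE; apply/eqP.
by rewrite -normr_le0 -x0 coord_le_enorm.
Qed.

(** Cauchy-Schwarz: the vector [dotrV y y *: x - dotrV x y *: y] has squared length [dotrV y y]
    times the defect of the squared inequality. *)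
Lemma ler_dotrV x y : `|dotrV x y| <= enorm x * enorm y.
Proof.
rewrite -(@ler_pXn2r _ 2)// ?nnegrE ?mulr_ge0 ?enorm_ge0//.
rewrite real_normK ?num_real// exprMn !sqr_enorm.
have [->|y0] := eqVneq y 0; first by rewrite !dotrV0r expr0n/= mulr0.
have yy : 0 < dotrV y y.
  rewrite lt_neqAle dotrV_ge0 andbT; apply: contraNneq y0 => /esym yy0.
  by apply/eqP/enorm_eq0; rewrite /enorm yy0 sqrtr0.
have := dotrV_ge0 (dotrV y y *: x - dotrV x y *: y).
rewrite !dotrVBl !dotrVBr !dotrVZl !dotrVZr (dotrVC y x).
rewrite [leRHS](_ : _ = dotrV y y * (dotrV x x * dotrV y y - dotrV x y ^+ 2)).
  by rewrite pmulr_rge0// subr_ge0.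
ring.
Qed.

Lemma dotrV_le x y : dotrV x y <= enorm x * enorm y.
Proof. exact: le_trans (ler_norm _) (ler_dotrV _ _). Qed.

Lemma ler_enormD x y : enorm (x + y) <= enorm x + enorm y.
Proof.
rewrite enorm_leP ?addr_ge0 ?enorm_ge0// dotrVDl !dotrVDr sqrrD !sqr_enorm.
have := dotrV_le x y; rewrite (dotrVC y x); lra.
Qed.

Lemma ler_enormB x y : enorm (x - y) <= enorm x + enorm y.
Proof. by rewrite -(enormN y) ler_enormD. Qed.

Lemma ler_enorm_dist x y z : enorm (x - z) <= enorm (x - y) + enorm (y - z).
Proof. by rewrite -[x - z](subrKA y) ler_enormD. Qed.

Lemma ler_dist_enorm x y : `|enorm x - enorm y| <= enorm (x - y).
Proof.
rewrite ler_norml; apply/andP; split.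
  by have := ler_enormD x (y - x); rewrite subrKC enormB; lra.
by have := ler_enormD y (x - y); rewrite subrKC; lra.
Qed.

Lemma mx_norm_leP x a : 0 <= a -> (forall i, `|x 0 i| <= a) -> `|x| <= a.
Proof.
move=> a0 xa; rewrite [`|x|]mx_normrE; apply/bigmax_leP; split=> //= -[i j] _ /=.
by rewrite (ord1 i).
Qed.

Lemma coord_le_mx_norm x i : `|x 0 i| <= `|x|.
Proof.
by rewrite [leRHS]mx_normrE; exact: (le_bigmax _ (fun ij => `|x ij.1 ij.2|) (0, i)).
Qed.

Lemma mx_norm_le_enorm x : `|x| <= enorm x.
Proof. by apply: mx_norm_leP; [exact: enorm_ge0 | exact: coord_le_enorm]. Qed.

Lemma enorm_le_mx_norm x : enorm x <= n%:R * `|x|.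
Proof.
rewrite enorm_leP ?mulr_ge0//.
apply: (@le_trans _ _ (n%:R * `|x| ^+ 2)).
  rewrite /dotrV (le_trans (_ : _ <= \sum_(i < n) `|x| ^+ 2))//.
    apply: ler_sum => i _; rewrite -expr2 -[leLHS]real_normK ?num_real//.
    by rewrite ler_pXn2r ?nnegrE// coord_le_mx_norm.
  by rewrite sumr_const card_ord mulr_natl.
rewrite exprMn ler_wpM2r ?sqr_ge0// -natrX ler_nat.
by case: (n) => // k; rewrite -[leqLHS]muln1 leq_mul.
Qed.

End euclidean.

(** * The sup-norm topology read through Euclidean lengths *)

Section euclidean_topology.
Context {R : realType}.

Lemma nbhs_enormP n (x : 'rV[R]_n) (P : set 'rV[R]_n) :
  nbhs x P <-> exists2 e, 0 < e & forall y, enorm (y - x) < e -> P y.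
Proof.
split=> [/nbhs_ballP[e /= e0 eP]|[e e0 eP]].
  exists e => // y ye; apply: eP; rewrite -ball_normE/= distrC.
  exact: le_lt_trans (mx_norm_le_enorm _) ye.
(* Dividing by [n.+1] instead of [n] keeps the radius meaningful in dimension zero. *)
apply/nbhs_ballP; exists (e / (n.+1)%:R) => /=; first exact: divr_gt0.
move=> y; rewrite -ball_normE/= distrC ltr_pdivlMr// => ye; apply: eP.
apply: le_lt_trans ye; rewrite mulrC (le_trans (enorm_le_mx_norm _))//.
by rewrite ler_wpM2r// ler_nat.
Qed.

Lemma continuous_enormP n (f : 'rV[R]_n -> R) x :
  {for x, continuous f} <->
  forall e, 0 < e -> exists2 d, 0 < d &
    forall y, enorm (y - x) < d -> `|f y - f x| < e.
Proof.
split=> [cf e e0|cf].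
  move/cvgrPdist_lt : cf => /(_ _ e0)/nbhs_enormP[d d0 df].
  by exists d => // y /df; rewrite distrC.
apply/(@cvgrPdist_lt _ _ _ _ (nbhs_filter x)) => e /cf[d d0 df].
by apply/nbhs_enormP; exists d => // y /df; rewrite distrC.
Qed.

Lemma enormB_continuous n (a : 'rV[R]_n) :
  continuous (fun x : 'rV[R]_n => enorm (x - a)).
Proof.
move=> x; apply/continuous_enormP => e e0; exists e => // y ye.
apply: le_lt_trans (ler_dist_enorm _ _) _.
by rewrite opprB addrA subrK.
Qed.

Lemma dotrV_continuous (T : topologicalType) n (f g : T -> 'rV[R]_n) x :
  {for x, continuous f} -> {for x, continuous g} ->
  {for x, continuous (fun y => dotrV (f y) (g y))}.
Proof.
move=> cf cg; rewrite /dotrV.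
apply: cvg_big; first exact: add_continuous.
move=> i _; apply: cvgM.
  exact: (continuous_comp cf (@coord_continuous _ _ _ 0 i _)).
exact: (continuous_comp cg (@coord_continuous _ _ _ 0 i _)).
Qed.

Definition ecball n (x : 'rV[R]_n) (r : R) : set 'rV[R]_n :=
  [set y | enorm (y - x) <= r].

Lemma ecball_compact n (x : 'rV[R]_n) r : compact (ecball x r).
Proof.
apply: bounded_closed_compact.
  exists (`|x| + r); split; first exact: num_real.
  move=> a ra y /= yx; rewrite (le_trans _ (ltW ra))//.
  rewrite -(subrK x y) (le_trans (ler_normD _ _))// addrC lerD2l.
  exact: le_trans (mx_norm_le_enorm _) yx.
have -> : ecball x r = (fun y : 'rV[R]_n => enorm (y - x)) @^-1` [set a | a <= r] by [].
apply: closed_comp; last exact: closed_le.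
move=> y _; exact: enormB_continuous.
Qed.

End euclidean_topology.

Lemma affine_continuous (R : realType) n (x : 'rV[R]_n) r :
  continuous (fun y : 'rV[R]_n => x + r *: y).
Proof.
move=> y; apply: (@continuousD _ _ _ (fun=> x) (fun z : 'rV[R]_n => r *: z)).
  exact: cst_continuous.
exact: scaler_continuous.
Qed.

Lemma shift_continuous (R : realType) n (x : 'rV[R]_n) :
  continuous (fun y : 'rV[R]_n => y + x).
Proof.
rewrite (_ : (fun y => _) = (fun y : 'rV[R]_n => x + 1 *: y)).
  exact: affine_continuous.
by apply/funext => y; rewrite scale1r addrC.
Qed.

Section pointwise_continuity.
Context {T : topologicalType} {R : realType}.
Implicit Types (f g : T -> R) (x : T).

Lemma contD f g x : {for x, continuous f} -> {for x, continuous g} ->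
  {for x, continuous (fun y => f y + g y)}.
Proof. by move=> cf cg; exact: (cvgD cf cg). Qed.

Lemma contB f g x : {for x, continuous f} -> {for x, continuous g} ->
  {for x, continuous (fun y => f y - g y)}.
Proof. by move=> cf cg; exact: (cvgB cf cg). Qed.

Lemma contM f g x : {for x, continuous f} -> {for x, continuous g} ->
  {for x, continuous (fun y => f y * g y)}.
Proof. by move=> cf cg; exact: (cvgM cf cg). Qed.

Lemma contcst (c : R) x : {for x, continuous (fun _ : T => c)}.
Proof. exact: cst_continuous. Qed.

Lemma contX f k x : {for x, continuous f} ->
  {for x, continuous (fun y => f y ^+ k)}.
Proof.
move=> cf; elim: k => [|k IH]; first exact: contcst.
rewrite (_ : (fun y => f y ^+ k.+1) = (fun y => f y * f y ^+ k)).
  exact: contM.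
by apply/funext => y; rewrite exprS.
Qed.

Lemma cont_norm f x : {for x, continuous f} ->
  {for x, continuous (fun y => `|f y|)}.
Proof. by move=> cf; exact: (cvg_norm cf). Qed.

End pointwise_continuity.

Lemma measurable_fun_countType d (T : measurableType d) (R : realType)
    (I : countType) (c : T -> I) (g : I -> R) :
  (forall i, measurable [set t | c t = i]) ->
  measurable_fun [set: T] (fun t => g (c t)).
Proof.
move=> mc _ B mB; rewrite setTI.
have -> : (fun t => g (c t)) @^-1` B =
    \bigcup_(i in [set i | B (g i)]) [set t | c t = i].
  by apply/seteqP; split=> [t Bt|t [i Bi /= ->]//]; exists (c t).
rewrite bigcup_mkcond; apply: countable_bigcupT_measurable => [|i].
  exact: countableP.
by case: ifP.
Qed.

(** * Measurability of continuous functions by sampling on grids *)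

Section grid.
Context {R : realType} {n : nat}.
Implicit Types x : 'rV[R]_n.

Definition grid_index (m : nat) x : {ffun 'I_n -> int} :=
  [ffun j => Num.floor (x 0 j * m.+1%:R)].

Definition grid_point (m : nat) (c : {ffun 'I_n -> int}) : 'rV[R]_n :=
  \row_j ((c j)%:~R / m.+1%:R).

Lemma measurable_grid_index m c : measurable [set x | grid_index m x = c].
Proof.
have -> : [set x | grid_index m x = c] =
    \bigcap_(j in [set: 'I_n]) ((fun x => x 0 j : measurableTypeR R) @^-1`
      `[(c j)%:~R / m.+1%:R, ((c j) + 1)%:~R / m.+1%:R[%classic).
  have m0 : 0 < m.+1%:R :> R by [].
  apply/seteqP; split=> x /= xc.
    move=> j _ /=; rewrite in_itv/= ler_pdivrMr// ltr_pdivlMr//.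
    by rewrite -xc ffunE floor_itv.
  apply/ffunP => j; rewrite ffunE.
  have := xc j I; rewrite /= in_itv/= ler_pdivrMr// ltr_pdivlMr// => xcj.
  exact/floor_def.
apply: fin_bigcap_measurable => // j _.
by rewrite -[X in measurable X]setTI; exact: measurable_coor.
Qed.

Lemma grid_point_cvg x : grid_point m (grid_index m x) @[m --> \oo] --> x.
Proof.
apply/cvgrPdist_le => e e0; near=> m.
have m0 : 0 < m.+1%:R :> R by [].
have em : m.+1%:R^-1 < e.
  by near: m; exact: (near_infty_natSinv_lt (PosNum e0)).
apply: mx_norm_leP => [|j]; first exact: ltW.
rewrite !mxE ffunE; apply: le_trans (ltW em).
have /andP[h1 h2] := floor_itv (x 0 j * m.+1%:R).
rewrite -[x 0 j](mulfK (lt0r_neq0 m0)) -mulrBl normrM normfV (gtr0_norm m0).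
rewrite ler_piMl ?invr_ge0 ?(ltW m0)//.
rewrite mulfK ?lt0r_neq0// ger0_norm ?subr_ge0// lerBlDl.
by rewrite (le_trans (ltW h2))// rmorphD.
Unshelve. all: by end_near. Qed.

End grid.

(** The sigma-algebra is generated by the coordinates, not by the open sets. Sampling [f] at the
    corner of the grid cell containing [x] gives functions that are constant on countably many
    measurable cells; they converge to [f] as the mesh [1/(m+1)] shrinks. *)
Lemma continuous_measurable_rV {R : realType} {n : nat} (f : 'rV[R]_n -> R) :
  continuous f -> measurable_fun [set: 'rV[R]_n] f.
Proof.
move=> cf.
apply: (@measurable_fun_cvg _ _ _ _
  (fun m x => f (grid_point m (grid_index m x)))) => [m|x _].
  apply: (@measurable_fun_countType _ _ _ _ (grid_index m) (f \o grid_point m)).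
  exact: measurable_grid_index.
apply: continuous_cvg; [exact: cf|exact: grid_point_cvg].
Qed.

(** The same sampling in both factors, for the product sigma-algebra on which Tonelli's theorem is
    applied. *)
Lemma continuous_measurable_rV2 {R : realType} {n : nat}
    (f : ('rV[R]_n * 'rV[R]_n)%type -> R) :
  continuous f -> measurable_fun [set: 'rV[R]_n * 'rV[R]_n] f.
Proof.
move=> cf; pose g m (z : 'rV[R]_n * 'rV[R]_n) := (grid_index m z.1, grid_index m z.2).
pose h m (c : {ffun 'I_n -> int} * {ffun 'I_n -> int}) :=
  (grid_point m c.1 : 'rV[R]_n, grid_point m c.2 : 'rV[R]_n).
apply: (@measurable_fun_cvg _ _ _ _ (fun m z => f (h m (g m z)))) => [m|x _].
  apply: (@measurable_fun_countType _ _ _ _ (g m) (f \o h m)) => -[c d].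
  rewrite (_ : [set _ | _] =
    [set x | grid_index m x = c] `*` [set x | grid_index m x = d]).
    by apply: measurableX; exact: measurable_grid_index.
  by apply/seteqP; split=> z /=; rewrite /g => -[-> ->].
case: x => a b.
have hgx : (grid_point m (grid_index m a) : 'rV[R]_n,
    grid_point m (grid_index m b) : 'rV[R]_n) @[m --> \oo] --> (a, b).
  exact: (cvg_pair (@grid_point_cvg R n a) (@grid_point_cvg R n b)).
exact: (cvg_comp _ _ hgx (cf (a, b))).
Qed.

(** * Lebesgue measure under affine maps *)

Section affine_measure.
Context {R : realType}.
Local Open Scope ereal_scope.

Lemma measurable_affine1 (b r : R) :
  measurable_fun setT (fun t : R => (b + r * t)%R : measurableTypeR R).
Proof. by apply: measurable_funD => //; exact: measurable_funM. Qed.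

(** The right side is itself a measure, a scaled pushforward, and agrees with Lebesgue measure on
    half-open intervals; uniqueness does the rest. *)
Lemma lebesgue_measure_affine (b r : R) (A : set (measurableTypeR R)) :
  (0 < r)%R -> measurable A ->
  lebesgue_measure A = r%:E * lebesgue_measure [set t : R | A (b + r * t)%R].
Proof.
move=> r0 mA.
pose m := measure_function_mscale__canonical__measure_function_Measure
  (NngNum (ltW r0))
  (measure_function_pushforward__canonical__measure_function_Measure
    lebesgue_measure (measurable_affine1 b r)).
rewrite (@lebesgue_measure_unique _ m)// => _ [[a c]] _ <-.
rewrite /m/= /mscale/= /pushforward.
rewrite (_ : _ @^-1` _ = `]((a - b) / r)%R, ((c - b) / r)%R]%classic); last first.
  apply/seteqP; split=> t/=; rewrite !in_itv/= ltr_pdivrMr// ler_pdivlMr//;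
    by rewrite ltrBlDl lerBrDl (mulrC t).
rewrite !lebesgue_measure_itv/= !lte_fin ltr_pM2r ?invr_gt0// ltrD2r.
case: ifPn => _; last by rewrite mule0.
by rewrite -!EFinB -EFinM; congr EFin; field; rewrite gt_eqF.
Qed.

Lemma ge0_integral_change_of_measure d (T : measurableType d)
    (m : {measure set T -> \bar R}) (phi : T -> T) (c : R)
    (f : T -> \bar R) :
  measurable_fun setT phi -> (0 <= c)%R ->
  (forall A, measurable A -> m A = c%:E * m (phi @^-1` A)) ->
  measurable_fun setT f -> (forall x, 0 <= f x) ->
  \int[m]_x f x = c%:E * \int[m]_x f (phi x).
Proof.
move=> mphi c0 mphiE mf f0.
pose mpush := measure_function_pushforward__canonical__measure_function_Measure
  m mphi.
rewrite (@eq_measure_integral _ _ _ _ (mscale (NngNum c0) mpush)); last first.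
  by move=> A mA _; rewrite mphiE.
rewrite ge0_integral_mscale//=.
by rewrite ge0_integral_pushforward.
Qed.

Lemma measurable_affine n (x : 'rV[R]_n) (r : R) :
  measurable_fun setT (fun y : 'rV[R]_n => (x + r *: y)%R).
Proof.
apply: measurable_fun_rV => i.
rewrite (_ : _ \o _ = (fun t : measurableTypeR R => (x 0 i + r * t)%R : measurableTypeR R) \o
   (fun y : 'rV[R]_n => y 0 i : measurableTypeR R))%R; last first.
  by apply/funext => y; rewrite /= !mxE.
exact: (measurableT_comp (@measurable_affine1 (x 0 i)%R r) (measurable_coor i)).
Qed.

(** Induction on the dimension: after slicing along the last coordinate, the one-dimensional case
    scales each slice by [r] and the induction hypothesis scales the integral over the other
    coordinates by [r ^+ n]. *)
Lemma lebesgue_rV_affine n (x : 'rV[R]_n) (r : R) (A : set 'rV[R]_n) :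
  (0 < r)%R -> measurable A ->
  lebesgue_rV R n A =
  (r ^+ n)%:E * lebesgue_rV R n [set y | A (x + r *: y)%R].
Proof.
move=> r0; elim: n x A => [x A mA|n IH x A mA].
  rewrite expr0 mul1e; congr (lebesgue_rV R 0 _).
  by apply/seteqP; split=> y/=; rewrite (thinmx0 (x + r *: y)%R) (thinmx0 y).
pose S : set ('rV[R]_n * measurableTypeR R) := @snoc_rV R n @^-1` A.
have mS : measurable S.
  by rewrite -[S]setTI; exact: measurable_snoc_rV.
pose x' : 'rV[R]_n := (\row_j x 0 (lift ord_max j))%R.
pose h (z : 'rV[R]_n) := lebesgue_measure (xsection S z).
have mh : measurable_fun setT h by exact: measurable_fun_xsection.
have := @ge0_integral_change_of_measure _ _ (lebesgue_rV R n)
  (fun z => x' + r *: z)%R (r ^+ n)%R h (measurable_affine x' r)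
  (exprn_ge0 _ (ltW r0)) (fun B mB => IH x' B mB) mh (fun z => measure_ge0 _ _).
rewrite [LHS](_ : _ = lebesgue_rV R n.+1 A)// => ->.
pose A' := [set y | A (x + r *: y)%R].
pose S' : set ('rV[R]_n * measurableTypeR R) := @snoc_rV R n @^-1` A'.
have mS' : measurable S'.
  rewrite -[S']setTI; apply: measurable_snoc_rV => //.
  by rewrite -[A']setTI; exact: measurable_affine.
pose h' (z : 'rV[R]_n) := lebesgue_measure (xsection S' z).
have mh' : measurable_fun setT h' by exact: measurable_fun_xsection.
have hE z : h (x' + r *: z)%R = r%:E * h' z.
  rewrite /h (@lebesgue_measure_affine (x 0 ord_max)%R r)//; last first.
    exact: measurable_xsection.
  rewrite /h'; congr (_ * lebesgue_measure _).
  rewrite /xsection; apply/funext => t /=; rewrite !inE /S /S' /A' /=.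
  congr A; apply/rowP => i; rewrite /snoc_rV !mxE.
  by case: unliftP => [j ->|->] //=; rewrite !mxE.
under eq_integral do rewrite hE.
rewrite ge0_integralZl//; last by rewrite lee_fin ltW.
by rewrite muleA -EFinM -exprSr.
Qed.

Lemma ge0_integral_affine n (x : 'rV[R]_n) (r : R) (f : 'rV[R]_n -> \bar R) :
  (0 < r)%R -> measurable_fun setT f -> (forall y, 0 <= f y) ->
  \int[lebesgue_rV R n]_y f y =
  (r ^+ n)%:E * \int[lebesgue_rV R n]_y f (x + r *: y)%R.
Proof.
move=> r0 mf f0; apply: (ge0_integral_change_of_measure _ _ _ mf) => //.
- exact: measurable_affine.
- by rewrite exprn_ge0// ltW.
- by move=> A mA; exact: lebesgue_rV_affine.
Qed.

(** Cubes rather than Euclidean balls: their measure follows from the product structure, and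
    integrability only asks for a set of finite measure containing the support. *)
Definition box n (a : R) : set 'rV[R]_n := [set x | forall i, `|x 0 i| <= a]%R.
Arguments box : clear implicits.

Lemma measurable_box n a : measurable (box n a).
Proof.
have -> : box n a = \bigcap_(j in [set: 'I_n])
    ((fun x : 'rV[R]_n => x 0 j : measurableTypeR R) @^-1` `[- a, a]%classic)%R.
  apply/seteqP; split=> x /= xa.
    by move=> j _ /=; rewrite in_itv/= -ler_norml.
  by move=> j; have := xa j I; rewrite /= in_itv/= -ler_norml.
apply: fin_bigcap_measurable => // j _.
by rewrite -[X in measurable X]setTI; exact: measurable_coor.
Qed.

Lemma lebesgue_rV_box n (a : R) : (0 < a)%R ->
  lebesgue_rV R n (box n a) = ((2 * a) ^+ n)%:E.
Proof.
move=> a0; elim: n => [|n IH].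
  rewrite expr0 /= diracE mem_set//= => i; by case: i.
rewrite [LHS](_ : _ = (lebesgue_rV R n \x lebesgue_measure)
    (box n a `*` `[- a, a]%classic)%R); last first.
  rewrite [LHS]/= /prod_lebesgue /pushforward; congr (_ _).
  apply/seteqP; split=> -[z t] /=; rewrite in_itv/= -ler_norml => zt.
    split=> [i|].
      by have := zt (lift ord_max i); rewrite mxE liftK.
    by have := zt ord_max; rewrite mxE unlift_none.
  by move=> i; rewrite mxE; case: unliftP => [j _|_]/=; [exact: zt.1|exact: zt.2].
rewrite product_measure1E//; [|exact: measurable_box].
rewrite IH [X in _ * X](_ : _ = (2 * a)%:E); last first.
  transitivity (@lebesgue_measure R `[- a, a]%classic)%R => //.
  rewrite lebesgue_measure_itv/= lte_fin gtrN// -EFinB.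
  by congr _%:E%R; ring.
by rewrite -EFinM exprSr.
Qed.

End affine_measure.
Arguments box {R}.

Lemma lebesgue_rV_sigma_finite (R : realType) n :
  sigma_finite setT (lebesgue_rV R n).
Proof.
exists (fun k => box n k.+1%:R).
  apply/seteqP; split=> // x _.
  exists (Num.truncn `|x|) => // i.
  rewrite (le_trans (coord_le_mx_norm _ _))//.
  by rewrite ltW// truncnS_gt.
move=> k; split; first exact: measurable_box.
by rewrite lebesgue_rV_box ?ltry.
Qed.

Lemma fubini_tonelli_measure d1 d2 (T1 : measurableType d1)
    (T2 : measurableType d2) (R : realType)
    (m1 : {measure set T1 -> \bar R}) (m2 : {measure set T2 -> \bar R})
    (f : T1 * T2 -> \bar R) :
  sigma_finite setT m1 -> sigma_finite setT m2 ->
  measurable_fun setT f -> (forall z, 0 <= f z)%E ->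
  (\int[m1]_x \int[m2]_y f (x, y) = \int[m2]_y \int[m1]_x f (x, y))%E.
Proof.
case: m1 m2 => [m1 c1] [m2 c2] sf1 sf2 mf f0.
pose n1 : {sigma_finite_measure set T1 -> \bar R} :=
  HB.pack m1 (Measure.Pack c1) (@Measure_isSigmaFinite.Build _ _ _ (Measure.Pack c1) sf1).
pose n2 : {sigma_finite_measure set T2 -> \bar R} :=
  HB.pack m2 (Measure.Pack c2) (@Measure_isSigmaFinite.Build _ _ _ (Measure.Pack c2) sf2).
exact: (@fubini_tonelli _ _ _ _ _ n1 n2 f).
Qed.

(** * Integrals of continuous functions with bounded support *)

Section compactly_supported.
Context {R : realType} {n : nat}.
Notation mu := (lebesgue_rV R n).
Implicit Types (f g : 'rV[R]_n -> R) (a : R).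

Definition vanishes_beyond a f := forall y, a < enorm y -> f y = 0.

Lemma vanishes_beyondS a b f :
  a <= b -> vanishes_beyond a f -> vanishes_beyond b f.
Proof. by move=> ab fa y /(le_lt_trans ab)/fa. Qed.

Lemma continuous_ecball_bounded f a : continuous f ->
  exists2 B, 0 <= B & forall y, enorm y <= a -> `|f y| <= B.
Proof.
move=> cf; have cK := @ecball_compact R n 0 a.
have [B [_ HB]] := compact_bounded (continuous_compact (continuous_subspaceT cf) cK).
exists (`|B| + 1) => [|y ya]; first exact: addr_ge0.
apply: HB; last by exists y => //; rewrite /ecball /= subr0.
by rewrite (le_lt_trans (ler_norm _))// ltrDl.
Qed.

Lemma integrable_compact_support a f :
  continuous f -> vanishes_beyond a f -> mu.-integrable setT (EFin \o f).
Proof.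
move=> cf fa; have [B B0 fB] := continuous_ecball_bounded a cf.
have a1 : 0 < `|a| + 1 by rewrite ltr_wpDl.
have outside y : ~ box n (`|a| + 1) y -> f y = 0.
  move=> yb; apply: fa; rewrite ltNge; apply/negP => ya; apply: yb => i.
  rewrite (le_trans (coord_le_enorm _ _))// (le_trans ya)//.
  by rewrite (le_trans (ler_norm _))// lerDl.
rewrite (_ : EFin \o f = ((EFin \o f) \_ (box n (`|a| + 1)))); last first.
  apply/funext => y; rewrite patchE; case: ifPn => //.
  by rewrite notin_setE => /outside /= ->.
apply/(integrable_mkcond _ _).1; first exact: measurable_box.
apply: measurable_bounded_integrable.
- exact: measurable_box.
- by rewrite lebesgue_rV_box ?ltry.
- exact: measurable_funTS (continuous_measurable_rV cf).
- exists B; split; first exact: num_real.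
  move=> b Bb y _; apply: le_trans (ltW Bb).
  by have [/fB//|/fa ->] := leP (enorm y) a; rewrite normr0.
Qed.

Lemma Rintegral_affine a f (x : 'rV[R]_n) r : 0 < r ->
  continuous f -> vanishes_beyond a f ->
  \int[mu]_y f y = r ^+ n * \int[mu]_y f (x + r *: y).
Proof.
move=> r0 cf fa.
have cshift := @affine_continuous R n x r.
(* If [x + r *: y] has norm at most [a], then [y] has norm at most [(a + enorm x) / r]: this bounds
   the pulled-back support. *)
pose b := r^-1 * (a + enorm x).
have vshift g : vanishes_beyond a g -> vanishes_beyond b (fun y => g (x + r *: y)).
  move=> ga y; rewrite /b mulrC ltr_pdivrMr// => ay; apply: ga.
  have := ler_enormB (x + r *: y) x.
  by rewrite addrC addKr enormZ gtr0_norm//; lra.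
have pos g : continuous g -> vanishes_beyond a g -> (forall y, 0 <= g y) ->
    \int[mu]_y g y = r ^+ n * \int[mu]_y g (x + r *: y).
  move=> cg ga g0; rewrite /Rintegral (@ge0_integral_affine _ _ x r)//; last first.
    by apply/measurable_EFinP; exact: continuous_measurable_rV.
  rewrite fineM//; apply: integrable_fin_num => //.
  apply: (@integrable_compact_support b) => //; last exact: vshift.
  by move=> y; apply: (continuous_comp (cshift y)); exact: cg.
(* [ge0_integral_affine] handles nonnegative functions, hence the split into positive and negative
   parts. *)
pose fp y := Num.max (f y) 0; pose fn y := Num.max (- f y) 0.
have fE y : f y = fp y - fn y by rewrite /fp /fn; case: (leP (f y) 0); case: (leP (- f y) 0); lra.
have cfp : continuous fp.
  by move=> y; apply: continuous_max; [exact: cf|exact: cst_continuous].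
have cfn : continuous fn.
  move=> y; apply: (@continuous_max _ _ (fun y => - f y) (fun=> 0)).
    exact: (cvgN (cf y)).
  exact: cst_continuous.
have fpa : vanishes_beyond a fp by move=> y /fa; rewrite /fp => ->; rewrite maxxx.
have fna : vanishes_beyond a fn.
  by move=> y /fa; rewrite /fn => ->; rewrite oppr0 maxxx.
under eq_Rintegral do rewrite fE.
under [in RHS]eq_Rintegral do rewrite fE.
rewrite !RintegralB//.
- rewrite (pos fp)// ?(pos fn)// ?mulrBr//.
  + by move=> y; rewrite /fn le_max lexx orbT.
  + by move=> y; rewrite /fp le_max lexx orbT.
- apply: (@integrable_compact_support b); last exact: vshift.
  by move=> y; apply: (continuous_comp (cshift y)); exact: cfp.
- apply: (@integrable_compact_support b); last exact: vshift.
  by move=> y; apply: (continuous_comp (cshift y)); exact: cfn.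
- exact: (@integrable_compact_support a).
- exact: (@integrable_compact_support a).
Qed.

(** By translation invariance the increment [f (y + t *: v) - f y] has integral zero, so [t] times
    the integral of [g] is minus that of the first-order remainder. The remainder is at most [s * t]
    on a fixed cube, and [s] is arbitrary. *)
Lemma Rintegral_partial0 f g (v : 'rV[R]_n) :
  continuous f -> continuous g ->
  vanishes_beyond 1 f -> vanishes_beyond 1 g ->
  (forall s, 0 < s -> exists2 d, 0 < d &
    forall t y, 0 < t < d -> `|f (y + t *: v) - f y - t * g y| <= s * t) ->
  \int[mu]_y g y = 0.
Proof.
move=> cf cg f1 g1 fg; apply/eqP; rewrite -normr_le0.
apply/ler_addgt0Pl => e e0; rewrite addr0.
(* [4 ^+ n] is the measure of [box n 2], which contains the supports of [f], of [g] and of the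
   translate of [f]. *)
have s0 : 0 < e / 4 ^+ n by rewrite divr_gt0// exprn_gt0.
have [d d0 fgd] := fg _ s0.
(* Below [d] for the expansion, and so short that [t *: v] has norm at most 1 and the translated
   support stays within radius 2. *)
pose t := Num.min (d / 2) (1 + enorm v)^-1.
have v1 : 0 < 1 + enorm v by rewrite ltr_pwDl ?enorm_ge0.
have t0 : 0 < t by rewrite lt_min divr_gt0// invr_gt0.
have td : t < d.
  by rewrite (le_lt_trans (_ : _ <= d / 2)) ?ge_min ?lexx// ltr_pdivrMr//; lra.
have tv : enorm (t *: v) <= 1.
  rewrite enormZ gtr0_norm// (le_trans (_ : _ <= (1 + enorm v)^-1 * enorm v))//.
    by rewrite ler_wpM2r ?enorm_ge0// ge_min lexx orbT.
  by rewrite mulrC ler_pdivrMr// mul1r lerDr.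
have cft : continuous (fun y : 'rV[R]_n => f (y + t *: v)).
  by move=> y; exact: (continuous_comp (@shift_continuous _ _ (t *: v) y) (cf _)).
have ft2 : vanishes_beyond 2 (fun y => f (y + t *: v)).
  move=> y y2; apply: f1; have := ler_enormB (y + t *: v) (t *: v).
  by rewrite addrK; lra.
have f2 := vanishes_beyondS (ler1n _ 2) f1.
have g2 := vanishes_beyondS (ler1n _ 2) g1.
have ift := integrable_compact_support cft ft2.
have if_ := integrable_compact_support cf f2.
have ig := integrable_compact_support cg g2.
have shift : \int[mu]_y f (y + t *: v) = \int[mu]_y f y.
  rewrite [RHS](@Rintegral_affine 2 _ (t *: v) 1)// expr1n mul1r.
  by apply: eq_Rintegral => y _; rewrite scale1r addrC.
have itg : mu.-integrable setT (EFin \o (fun y => t * g y)).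
  apply: (@integrable_compact_support 2) => [y|y /g2 ->]; last by rewrite mulr0.
  exact: (contM (@contcst _ _ t y) (cg y)).
have cdiff : continuous (fun y : 'rV[R]_n => f (y + t *: v) - f y - t * g y).
  by move=> y; exact: (contB (contB (cft y) (cf y)) (contM (@contcst _ _ t y) (cg y))).
have diff2 : vanishes_beyond 2 (fun y => f (y + t *: v) - f y - t * g y).
  by move=> y y2; rewrite ft2// f2// g2// mulr0 !subr0.
have -> : \int[mu]_y g y =
    - t^-1 * \int[mu]_y (f (y + t *: v) - f y - t * g y).
  rewrite RintegralB//; last first.
    apply: (@integrable_compact_support 2) => [y|y y2].
      exact: (contB (cft y) (cf y)).
    by rewrite ft2// f2// subr0.
  rewrite RintegralB// shift subrr sub0r RintegralZl// mulrNN mulKf//.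
  by rewrite gt_eqF.
rewrite normrM normrN normfV (gtr0_norm t0) mulrC ler_pdivrMr//.
apply: (le_trans (le_normr_Rintegral _ _)) => //.
  exact: integrable_compact_support diff2.
have m2 : measurable (box n 2 : set 'rV[R]_n) by exact: measurable_box.
have mu2 : mu (box n 2) = (4 ^+ n)%:E.
  by rewrite lebesgue_rV_box//; congr (_ ^+ _)%:E; ring.
rewrite (_ : e * t = \int[mu]_(y in box n 2) (e / 4 ^+ n * t)); last first.
  by rewrite Rintegral_cst// mu2/= mulrAC divfK.
rewrite [leRHS]Rintegral_mkcond; apply: le_Rintegral => //.
- apply: (@integrable_compact_support 2) => [y|y /diff2 ->]; last by rewrite normr0.
  exact: (cont_norm (cdiff y)).
- rewrite -restrict_EFin; apply/(integrable_mkcond _ m2).1.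
  apply: (@measurable_bounded_integrable _ _ _ mu (fun=> e / 4 ^+ n * t)) => //;
    first by rewrite mu2 ltry.
  exact: bounded_cst.
move=> y _; rewrite patchE; case: ifPn => [_|].
  by apply: fgd; rewrite t0.
rewrite notin_setE => yb; rewrite diff2 ?normr0// ltNge; apply/negP => y2.
by apply: yb => i; rewrite (le_trans (coord_le_enorm _ _)).
Qed.

End compactly_supported.

(** * Averages over the unit ball *)

Section weighted_integral.
Context {R : realType} {n : nat}.
Notation mu := (lebesgue_rV R n).
Implicit Types (f g w : 'rV[R]_n -> R) (a c : R).

Definition unit_weight w :=
  [/\ continuous w, forall y, 0 <= w y & vanishes_beyond 1 w].

(** Continuity on the whole space at each point of the closed ball, not continuity of the
    restriction. A weight vanishing outside the ball then makes [g y * w y] continuous everywhere,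
    although nothing is known about [g] beyond the ball. *)
Definition continuous_on_ball g :=
  forall y, enorm y <= 1 -> {for y, continuous g}.

Definition wint w g := \int[mu]_y (g y * w y).

Definition mass w := \int[mu]_y w y.

Lemma cballD f g : continuous_on_ball f -> continuous_on_ball g ->
  continuous_on_ball (fun y => f y + g y).
Proof. by move=> cf cg y y1; exact: (contD (cf y y1) (cg y y1)). Qed.

Lemma cballB f g : continuous_on_ball f -> continuous_on_ball g ->
  continuous_on_ball (fun y => f y - g y).
Proof. by move=> cf cg y y1; exact: (contB (cf y y1) (cg y y1)). Qed.

Lemma cballM f g : continuous_on_ball f -> continuous_on_ball g ->
  continuous_on_ball (fun y => f y * g y).
Proof. by move=> cf cg y y1; exact: (contM (cf y y1) (cg y y1)). Qed.

Lemma cball_cst c : continuous_on_ball (fun=> c).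
Proof. by move=> y _; exact: contcst. Qed.

Lemma cballX f k : continuous_on_ball f ->
  continuous_on_ball (fun y => f y ^+ k).
Proof. by move=> cf y y1; exact: (@contX _ _ f k y (cf y y1)). Qed.

Lemma cball_sum (I : Type) (s : seq I) (F : I -> 'rV[R]_n -> R) :
  (forall i, continuous_on_ball (F i)) ->
  continuous_on_ball (fun y => \sum_(i <- s) F i y).
Proof.
move=> cF; elim: s => [|i s IH].
  have -> : (fun y => \sum_(i <- [::]) F i y) = (fun=> 0).
    by apply/funext => y; rewrite big_nil.
  exact: cball_cst.
have -> : (fun y => \sum_(j <- i :: s) F j y) =
    (fun y => F i y + \sum_(j <- s) F j y).
  by apply/funext => y; rewrite big_cons.
exact: cballD.
Qed.

Lemma near_vanishes a f y : vanishes_beyond a f -> a < enorm y ->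
  \forall z \near y, f z = 0.
Proof.
move=> fa ay; apply/nbhs_enormP; exists (enorm y - a); first by rewrite subr_gt0.
move=> z zy; apply: fa; have := ler_enorm_dist y z 0.
by rewrite !subr0 enormB; lra.
Qed.

Lemma continuous_mul_weight w g : unit_weight w -> continuous_on_ball g ->
  continuous (fun y => g y * w y).
Proof.
move=> [cw _ w1] cg y; have [y1|y1] := leP (enorm y) 1.
  exact: (contM (cg y y1) (cw y)).
apply/continuous_enormP => e e0.
have /nbhs_enormP[d d0 wd] := near_vanishes w1 y1.
by exists d => // z /wd /= ->; rewrite w1// !mulr0 subrr normr0.
Qed.

Lemma mul_weight_vanishes w g : unit_weight w ->
  vanishes_beyond 1 (fun y => g y * w y).
Proof. by move=> [_ _ w1] y /w1 ->; rewrite mulr0. Qed.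

Section fixed_weight.
Variable w : 'rV[R]_n -> R.
Hypothesis ww : unit_weight w.

Lemma wint_integrable g : continuous_on_ball g ->
  mu.-integrable setT (EFin \o (fun y => g y * w y)).
Proof.
move=> cg; apply: (@integrable_compact_support _ _ 1).
  exact: continuous_mul_weight.
exact: mul_weight_vanishes.
Qed.

Lemma eq_wint f g : (forall y, enorm y <= 1 -> f y = g y) -> wint w f = wint w g.
Proof.
case: ww => _ _ w1 fg; apply: eq_Rintegral => y _.
by have [/fg ->//|/w1 ->] := leP (enorm y) 1; rewrite !mulr0.
Qed.

Lemma wintD f g : continuous_on_ball f -> continuous_on_ball g ->
  wint w (fun y => f y + g y) = wint w f + wint w g.
Proof.
move=> cf cg; rewrite /wint -RintegralD//; [|exact: wint_integrable..].
by apply: eq_Rintegral => y _; rewrite mulrDl.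
Qed.

Lemma wintZ c f : continuous_on_ball f ->
  wint w (fun y => c * f y) = c * wint w f.
Proof.
move=> cf; rewrite /wint -RintegralZl//; last exact: wint_integrable.
by apply: eq_Rintegral => y _; rewrite mulrA.
Qed.

Lemma wintB f g : continuous_on_ball f -> continuous_on_ball g ->
  wint w (fun y => f y - g y) = wint w f - wint w g.
Proof.
move=> cf cg; rewrite /wint -RintegralB//; [|exact: wint_integrable..].
by apply: eq_Rintegral => y _; rewrite mulrBl.
Qed.

Lemma wint_cst c : wint w (fun=> c) = c * mass w.
Proof.
have -> : mass w = wint w (fun=> 1).
  by apply: eq_Rintegral => y _; rewrite mul1r.
rewrite -wintZ; last exact: cball_cst.
by apply: eq_wint => y _; rewrite mulr1.
Qed.

Lemma mass_ge0 : 0 <= mass w.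
Proof. by case: ww => _ w0 _; exact: Rintegral_ge0. Qed.

Lemma le_wint f g : continuous_on_ball f -> continuous_on_ball g ->
  (forall y, enorm y <= 1 -> f y <= g y) -> wint w f <= wint w g.
Proof.
move=> cf cg fg; case: (ww) => _ w0 w1.
apply: le_Rintegral => //; [exact: wint_integrable..|move=> y _].
have [/fg fgy|/w1 ->] := leP (enorm y) 1; last by rewrite !mulr0.
by rewrite ler_wpM2r.
Qed.

Lemma ler_norm_wint f c : continuous_on_ball f ->
  (forall y, enorm y <= 1 -> `|f y| <= c) -> `|wint w f| <= c * mass w.
Proof.
move=> cf fc; rewrite ler_norml -mulNr -!wint_cst; apply/andP; split.
  apply: le_wint => // [|y /fc]; first exact: cball_cst.
  by rewrite ler_norml => /andP[].
apply: le_wint => // [|y /fc]; first exact: cball_cst.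
by rewrite ler_norml => /andP[].
Qed.

Lemma wint_sum (I : finType) (F : I -> 'rV[R]_n -> R) :
  (forall i, continuous_on_ball (F i)) ->
  wint w (fun y => \sum_i F i y) = \sum_i wint w (F i).
Proof.
move=> cF.
elim: (index_enum I) => [|i s IH].
  rewrite big_nil -[RHS](mul0r (mass w)) -wint_cst.
  by apply: eq_wint => y _; rewrite big_nil.
rewrite big_cons -IH -wintD//; last exact: cball_sum.
by apply: eq_wint => y _; rewrite big_cons.
Qed.

(** [F] is controlled only on the product of the two balls. Multiplied by both weights it becomes
    continuous on the whole product space, where Tonelli's theorem applies. *)
Lemma wint_fubini (F : 'rV[R]_n -> 'rV[R]_n -> R) :
  (forall x y, enorm x <= 1 -> enorm y <= 1 ->
    {for (x, y), continuous (fun z : 'rV[R]_n * 'rV[R]_n => F z.1 z.2)}) ->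
  (forall x y, 0 <= F x y) ->
  wint w (fun y => wint w (fun x => F x y)) =
  wint w (fun x => wint w (fun y => F x y)).
Proof.
move=> cF F0; case: (ww) => cw w0 w1.
pose H (z : 'rV[R]_n * 'rV[R]_n) := F z.1 z.2 * (w z.1 * w z.2).
have cH : continuous H.
  move=> [x y]; have cfst : {for (x, y), continuous (fun z : 'rV[R]_n * 'rV[R]_n => w z.1)}.
    exact: (@continuous_comp _ _ _ fst w (x, y) cvg_fst (cw x)).
  have csnd : {for (x, y), continuous (fun z : 'rV[R]_n * 'rV[R]_n => w z.2)}.
    exact: (@continuous_comp _ _ _ snd w (x, y) cvg_snd (cw y)).
  have [x1|x1] := leP (enorm x) 1; last first.
    apply: (@near_cst_continuous _ _ 0 H).
    have : \forall z \near (x, y), w z.1 = 0.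
      exact: cvg_fst (near_vanishes w1 x1).
    apply: filterS => z /= wz.
    by rewrite /H wz mul0r mulr0.
  have [y1|y1] := leP (enorm y) 1; last first.
    apply: (@near_cst_continuous _ _ 0 H).
    have : \forall z \near (x, y), w z.2 = 0.
      exact: cvg_snd (near_vanishes w1 y1).
    apply: filterS => z /= wz.
    by rewrite /H wz !mulr0.
  exact: (contM (cF _ _ x1 y1) (contM cfst csnd)).
have H0 z : 0 <= H z by rewrite /H !mulr_ge0.
have cF1 y : enorm y <= 1 -> continuous_on_ball (fun x => F x y).
  move=> y1 x x1.
  apply: (@continuous_comp _ _ _ (fun x => (x, y)) (fun z => F z.1 z.2)).
    exact: (cvg_pair (@cvg_id _ (nbhs x)) (@cst_continuous _ _ y x)).
  exact: cF.
have cF2 x : enorm x <= 1 -> continuous_on_ball (fun y => F x y).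
  move=> x1 y y1.
  apply: (@continuous_comp _ _ _ (fun y => (x, y)) (fun z => F z.1 z.2)).
    exact: (cvg_pair (@cst_continuous _ _ x y) (@cvg_id _ (nbhs y))).
  exact: cF.
have ix y : (\int[mu]_x (H (x, y))%:E)%E = (wint w (fun x => F x y) * w y)%:E.
  have [y1|y1] := leP (enorm y) 1; last first.
    rewrite (w1 y)// mulr0; under eq_integral do rewrite /H/= (w1 y)// !mulr0.
    exact: integral0.
  have := wint_integrable (cF1 y y1) => iF.
  rewrite /wint -RintegralZr// /Rintegral fineK.
    by apply: eq_integral => x _; rewrite /H/= mulrA.
  apply: integrable_fin_num => //.
  exact: (integrableZr measurableT (w y) iF).
have iy x : (\int[mu]_y (H (x, y))%:E)%E = (wint w (fun y => F x y) * w x)%:E.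
  have [x1|x1] := leP (enorm x) 1; last first.
    rewrite (w1 x)// mulr0; under eq_integral do rewrite /H/= (w1 x)// mul0r mulr0.
    exact: integral0.
  have := wint_integrable (cF2 x x1) => iF.
  rewrite /wint -RintegralZr// /Rintegral fineK.
    by apply: eq_integral => y _; rewrite /H/= (mulrC (w x)) mulrA.
  apply: integrable_fin_num => //.
  exact: (integrableZr measurableT (w x) iF).
have mH : measurable_fun setT (EFin \o H).
  by apply/measurable_EFinP; exact: continuous_measurable_rV2.
have := fubini_tonelli_measure (@lebesgue_rV_sigma_finite R n)
  (@lebesgue_rV_sigma_finite R n) mH (fun z => H0 z).
under eq_integral do rewrite /= iy.
under [in X in _ = X -> _]eq_integral do rewrite /= ix.
by move=> E; rewrite /wint /Rintegral E.
Qed.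

End fixed_weight.
End weighted_integral.

(** * Mean value estimates *)

Section calculus.
Context {R : realType} {n : nat}.
Implicit Types (u : 'rV[R]_n -> R) (a b x y h v : 'rV[R]_n).

(** A Heine-Cantor argument for an arbitrary relation [Q], used below for membership in [Omega] and
    for oscillation bounds. The second point may leave [K]. *)
Lemma compact_uniform (K : set 'rV[R]_n) (Q : 'rV[R]_n -> 'rV[R]_n -> Prop) :
  compact K ->
  (forall a, K a -> exists2 d, 0 < d &
    forall x y, enorm (x - a) < d -> enorm (y - a) < d -> Q x y) ->
  exists2 d, 0 < d & forall x y, K x -> enorm (y - x) < d -> Q x y.
Proof.
move=> /compact_near_coveringP cK locQ.
pose P (i : R) x := forall y, enorm (y - x) < `|i| -> Q x y.
have /(cK _ _ P) : forall a, K a -> \forall x \near a & i \near (0 : R), P i x.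
  move=> a /locQ[d d0 dQ].
  (* Half of the local radius locates [x], the other half bounds the distance from [x] to [y]. *)
  exists ([set x | enorm (x - a) < d / 2], [set i : R | `|i| < d / 2]).
    split=> /=.
      by apply/nbhs_enormP; exists (d / 2) => //; exact: divr_gt0.
    apply/nbhs_ballP; exists (d / 2) => /=; first exact: divr_gt0.
    by move=> i; rewrite -ball_normE/= sub0r normrN.
  move=> [x i] /= [xa id] y yx; apply: dQ; first by lra.
  by have := ler_enorm_dist y x a; lra.
move=> /nbhs_ballP[e /= e0 eP]; exists (e / 2); first exact: divr_gt0.
move=> x y Kx yx; apply: (eP (e / 2)) => //.
  by rewrite -ball_normE/= sub0r normrN gtr0_norm ?divr_gt0//; lra.
by rewrite gtr0_norm ?divr_gt0.
Qed.

Lemma is_derive_line u x v (t d : R) : is_derive (x + t *: v) v u d ->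
  is_derive t 1 (fun s : R => u (x + s *: v)) d.
Proof.
move=> [du <-].
have E : (fun h : R => h^-1 *: (((fun s : R => u (x + s *: v)) \o shift t) (h *: 1)
     - u (x + t *: v))) =
    (fun h : R => h^-1 *: ((u \o shift (x + t *: v)) (h *: v) - u (x + t *: v))).
  apply/funext => h; rewrite /= /shift; congr (_ *: (u _ - _)).
  by rewrite [h *: 1]mulr1 scalerDl addrCA.
split; first by rewrite /derivable E.
by rewrite /derive E.
Qed.

Lemma line_mean_value u x v (c : R) (df : 'rV[R]_n -> R) :
  (forall t : R, `|t| <= `|c| -> is_derive (x + t *: v) v u (df (x + t *: v))) ->
  exists2 t, `|t| <= `|c| & u (x + c *: v) - u x = df (x + t *: v) * c.
Proof.
move=> du; pose g (s : R) := u (x + s *: v).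
have dg (t : R) : `|t| <= `|c| -> is_derive t 1 g (df (x + t *: v)).
  by move=> /du; exact: is_derive_line.
have cg (a b : R) : `|a| <= `|c| -> `|b| <= `|c| ->
    {within `[a, b], continuous g}.
  move=> ac bc; apply: derivable_within_continuous => t.
  rewrite in_itv/= => /andP[at_ tb].
  apply: (@ex_derive _ _ _ _ _ _ _ (dg _ _)).
  by move: ac bc at_ tb; rewrite !ler_norml; move: `|c| => C; lra.
have gE : g 0 = u x by rewrite /g scale0r addr0.
have [c0|c0] := leP 0 c.
  have dgc t : t \in `]0, c[%R -> is_derive t 1 g (df (x + t *: v)).
    by rewrite in_itv/= => /andP[t0 tc]; apply: dg; rewrite !ger0_norm// ltW.
  have c0c : {within `[0, c], continuous g} by apply: cg; rewrite ?normr0.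
  have [t] := MVT_segment c0 dgc c0c.
  rewrite in_itv/= => /andP[t0 tc] E; exists t; first by rewrite !ger0_norm.
  by rewrite -/(g c) -gE E subr0.
have dgc t : t \in `]c, 0[%R -> is_derive t 1 g (df (x + t *: v)).
  rewrite in_itv/= => /andP[t0 tc]; apply: dg.
  by rewrite !ltr0_norm// lerN2 ltW.
have c0c : {within `[c, 0], continuous g} by apply: cg; rewrite ?normr0.
have [t] := MVT_segment (ltW c0) dgc c0c.
rewrite in_itv/= => /andP[t0 tc] E; exists t.
  by rewrite ler0_norm// ltr0_norm// lerN2.
by rewrite -/(g c) -gE -opprB E sub0r mulrN opprK.
Qed.

Definition truncate_rV (k : nat) h : 'rV[R]_n :=
  \row_j (if (j < k)%N then h 0 j else 0).

Lemma enorm_le_coord x y : (forall j, `|x 0 j| <= `|y 0 j|) ->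
  enorm x <= enorm y.
Proof.
move=> xy; rewrite ler_sqrt ?dotrV_ge0//; apply: ler_sum => j _.
by rewrite -!expr2 -[leLHS]real_normK ?num_real// -[leRHS]real_normK ?num_real//
  ler_pXn2r ?nnegrE.
Qed.

Lemma truncate_rVS (k : 'I_n) h :
  truncate_rV k.+1 h = truncate_rV k h + h 0 k *: delta_mx 0 k.
Proof.
apply/rowP => j; rewrite !mxE eqxx/= ltnS leq_eqVlt.
case: (ltngtP j k) => [jk|jk|/val_inj ->]; rewrite ?eqxx/=.
- by rewrite -val_eqE/= (ltn_eqF jk) mulr0 addr0.
- by rewrite -val_eqE/= (gtn_eqF jk) mulr0 addr0.
- by rewrite mulr1 add0r.
Qed.

Lemma dotrV_grad u x h : dotrV (grad u x) h = \sum_i partial i u x * h 0 i.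
Proof. by apply: eq_bigr => i _; rewrite mxE. Qed.

(** Only partial derivatives are given, so the path from [a] to [a + h] changes one coordinate at a
    time. The truncations of [h] stay within distance [enorm h] of [a], and each leg is a
    one-dimensional mean value theorem. *)
Lemma mean_value_estimate u a h (s : R) :
  (forall i y, enorm (y - a) <= enorm h -> derivable u y (delta_mx 0 i) /\
     `|partial i u y - partial i u a| <= s) ->
  `|u (a + h) - u a - dotrV (grad u a) h| <= s * n%:R * enorm h.
Proof.
move=> H; pose p k := a + truncate_rV k h.
have p0 : p 0%N = a.
  by rewrite /p (_ : truncate_rV 0 h = 0) ?addr0//; apply/rowP => j; rewrite !mxE.
have pn : p n = a + h.
  by rewrite /p; congr (_ + _); apply/rowP => j; rewrite !mxE ltn_ord.
have -> : u (a + h) - u a = \sum_(0 <= k < n) (u (p k.+1) - u (p k)).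
  by have := telescope_sumr (fun k => u (p k)) (leq0n n); rewrite p0 pn => ->.
rewrite big_mkord dotrV_grad -sumrB.
rewrite (le_trans (ler_norm_sum _ _ _))//.
rewrite (_ : s * n%:R * enorm h = \sum_(i < n) s * enorm h); last first.
  by rewrite sumr_const card_ord -[RHS]mulr_natr; ring.
apply: ler_sum => k _.
have inball (t : R) : `|t| <= `|h 0 k| ->
    enorm (p k + t *: delta_mx 0 k - a) <= enorm h.
  move=> th; rewrite /p -(addrA a) [a + _]addrC addrK; apply: enorm_le_coord => j.
  rewrite !mxE eqxx/=; have [->|jk] := eqVneq j k.
    by rewrite ltnn mulr1 add0r.
  by rewrite mulr0 addr0; case: ifP => // _; rewrite normr0.
have [t th E] := @line_mean_value u (p k) (delta_mx 0 k) (h 0 k) (partial k u)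
  (fun (t : R) th => DeriveDef (H k _ (inball t th)).1 erefl).
rewrite /p truncate_rVS addrA -/(p k) E -mulrBl normrM.
have [_ dk] := H k _ (inball t th).
by rewrite ler_pM ?coord_le_enorm.
Qed.

(** Continuity of the partial derivatives, made uniform near [K], yields a uniform first-order
    expansion. That [b] lies in [Omega] is part of the conclusion, since [b] is only close to
    [K]. *)
Lemma C1_uniform (Omega : set 'rV[R]_n) (K : set 'rV[R]_n) u :
  open Omega -> Ck 1 Omega u -> compact K -> K `<=` Omega ->
  forall s, 0 < s -> exists2 d, 0 < d & forall a b, K a -> enorm (b - a) < d ->
    [/\ Omega b, `|u b - u a - dotrV (grad u a) (b - a)| <= s * enorm (b - a) &
        enorm (grad u b - grad u a) <= s].
Proof.
(* The mean value estimate and the passage from the sup norm to [enorm] each cost a factor [n],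
   absorbed by [s']. *)
move=> oO [_ cu] cK KO s s0; pose s' := s / n.+1%:R.
have s'0 : 0 < s' by exact: divr_gt0.
have sn : s' * n%:R <= s.
  by rewrite /s' mulrAC ler_pdivrMr// ler_wpM2l ?ler_nat// ltW.
have loc a : K a -> exists2 d, 0 < d & forall x y,
    enorm (x - a) < d -> enorm (y - a) < d ->
    Omega y /\ forall i, `|partial i u y - partial i u x| <= s'.
  move=> /KO Oa.
  have : \forall x \near a, Omega x /\
      forall i, `|partial i u x - partial i u a| < s' / 2.
    near=> x; split.
      by near: x; exact: open_nbhs_nbhs.
    near: x; apply: filter_forall => i.
    have [_ [/(_ _ Oa) + _]] := cu i.
    move=> /continuous_enormP /(_ _ (divr_gt0 s'0 (ltr0Sn _ 1))) [d d0 dP].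
    by apply/nbhs_enormP; exists d.
  move=> /nbhs_enormP[d d0 dP]; exists d => // x y /dP[_ xa] /dP[Oy ya].
  split=> // i; have := ler_normB (partial i u y - partial i u a) (partial i u x - partial i u a).
  by rewrite opprB addrA subrK; have := xa i; have := ya i; lra.
have [d d0 dQ] := compact_uniform cK loc.
exists d => // a b Ka bad; have [Ob bas] := dQ a b Ka bad; split=> //.
  have := @mean_value_estimate u a (b - a) s'; rewrite subrKC => H.
  apply: (le_trans (H _)); last by rewrite ler_wpM2r ?enorm_ge0.
  move=> i y yab; have [Oy ys] := dQ a y Ka (le_lt_trans yab bad).
  by split=> //; exact: (cu i).1.
apply: (le_trans (enorm_le_mx_norm _)); rewrite mulrC.
apply: (le_trans _ sn); rewrite ler_wpM2r//.
apply: mx_norm_leP => [|i]; first exact: ltW.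
by rewrite !mxE.
Unshelve. all: by end_near. Qed.

Lemma grad_continuous u a : (forall i, {for a, continuous (partial i u)}) ->
  {for a, continuous (grad u)}.
Proof.
move=> cu; apply/(@cvgrPdist_le _ _ _ _ (nbhs_filter a)) => e e0.
have : \forall x \near a, forall i, `|partial i u a - partial i u x| <= e.
  apply: (@filter_forall _ _ _ _ (nbhs_filter a)) => i.
  by have /(@cvgrPdist_le _ _ _ _ (nbhs_filter a))/(_ _ e0) := cu i.
apply: (@filterS _ _ (nbhs_filter a)) => x xe; apply: mx_norm_leP => [|i]; first exact: ltW.
by rewrite !mxE.
Qed.

End calculus.

(** * Smooth bumps *)

Section flat_functions.
Context {R : realType}.
Implicit Types (P : {poly R}) (s t : R).

Lemma is_derive1_comp (f g : R -> R) (x df dg : R) :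
  is_derive x 1 f df -> is_derive (f x) 1 g dg ->
  is_derive x 1 (g \o f) (dg * df).
Proof.
move=> [df1 <-] [dg1 <-]; apply: DeriveDef.
  by apply/diff_derivable/differentiable_comp; exact/derivable1_diffP.
by rewrite -!derive1E; exact: derive1_comp.
Qed.

(** Induction on the polynomial, with [k] left free so that it can absorb the factor [s]. The
    constant term uses [s ^+ k <= k! * expR s], from a single term of the exponential series. *)
Lemma horner_expRN_bounded P k :
  exists2 C, 0 <= C & forall s, 0 < s -> `|P.[s]| * s ^+ k * expR (- s) <= C.
Proof.
elim/poly_ind: P k => [|P c IH] k.
  by exists 0 => // s _; rewrite horner0 normr0 !mul0r.
have [C C0 PC] := IH k.+1.
exists (C + `|c| * k`!%:R); first by rewrite addr_ge0// mulr_ge0.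
move=> s s0; rewrite hornerMXaddC.
apply: (@le_trans _ _ ((`|P.[s]| * s + `|c|) * s ^+ k * expR (- s))).
  rewrite !ler_wpM2r ?expR_ge0 ?exprn_ge0 ?(ltW s0)//.
  by rewrite (le_trans (ler_normD _ _))// normrM (gtr0_norm s0).
rewrite !mulrDl; apply: lerD; first by rewrite -(mulrA `|_|) -exprS PC.
rewrite -mulrA ler_wpM2l// expRN ler_pdivrMr ?expR_gt0//.
case: k {IH PC} => [|k].
  by rewrite expr0 fact0 mul1r -expR0 ler_expR ltW.
have h := @expR_ge1Dxn R s k (ltW s0).
have {h} : s ^+ k.+1 / k.+1`!%:R <= expR s by lra.
by rewrite ler_pdivrMr ?ltr0n ?fact_gt0// mulrC.
Qed.

(** [P(1/t) exp(-1/t)] extended by zero: a family closed under differentiation, so smoothness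
    reduces to one differentiability statement for all its members. *)
Definition flat P t := if 0 < t then P.[t^-1] * expR (- t^-1) else 0.

(** The quadratic bound makes the difference quotient at the origin tend to zero. *)
Lemma flat_quadratic P :
  exists2 C, 0 <= C & forall t, `|flat P t| <= C * t ^+ 2.
Proof.
have [C C0 PC] := horner_expRN_bounded P 2; exists C => // t.
rewrite /flat; case: ifPn => t0; last by rewrite normr0 mulr_ge0// sqr_ge0.
have := PC t^-1; rewrite invr_gt0 => /(_ t0).
rewrite normrM (gtr0_norm (expR_gt0 _)) -ler_pdivrMr ?exprn_gt0//.
by rewrite -exprVn mulrAC.
Qed.

(** With [s = 1/t] one has [ds/dt = - s^2], so the derivative of [P(s) exp(-s)] in [t] is
    [s^2 (P(s) - P'(s)) exp(-s)]. *)
Definition flat_deriv P : {poly R} := 'X^2 * (P - P^`()).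

Lemma flat_is_derive P t : is_derive t 1 (flat P) (flat (flat_deriv P) t).
Proof.
have [t0|t0|<-] := ltgtP 0 t.
- apply: (@near_eq_is_derive _ _ _ (fun t => P.[t^-1] * expR (- t^-1))).
    near=> x; rewrite /flat ifT//; near: x; exact: lt_nbhsr.
  have dV : is_derive t 1 (fun t : R => t^-1) (- t ^- 2).
    have := @is_deriveV _ id t 1 1 (lt0r_neq0 t0) (is_derive_id _ _).
    by rewrite [_ *: 1]mulr1.
  have dP := is_derive1_comp dV (is_derive_poly P t^-1).
  have dN : is_derive t 1 (fun t : R => - t^-1) (t ^- 2).
    by rewrite -[t ^- 2]opprK; exact: is_deriveN.
  have dE := is_derive1_comp dN (is_derive_expR _).
  apply: is_derive_eq (is_deriveM dP dE) _.
  rewrite /flat t0 /flat_deriv !hornerE/= /GRing.scale/=.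
  rewrite exprVn; ring.
- apply: (@near_eq_is_derive _ _ _ (fun=> 0)).
    near=> x; rewrite /flat ifF//; apply/negbTE; rewrite -leNgt ltW//.
    near: x; exact: lt_nbhsl.
  by rewrite /flat ifF; [exact: is_derive_cst|apply/negbTE; rewrite -leNgt ltW].
- have [C C0 PC] := flat_quadratic P.
  have F0 Q : flat Q 0 = 0 by rewrite /flat ltxx.
  have lim0 : h^-1 *: ((flat P \o shift 0) (h *: 1) - flat P 0) @[h --> 0^'] --> (0 : R).
    apply/cvgrPdist_le => e e0; near=> h.
    have h0 : h != 0 by near: h; exact: nbhs_dnbhs_neq.
    rewrite sub0r normrN /= addr0 [h *: 1]mulr1 F0 subr0 normrM normfV.
    rewrite mulrC ler_pdivrMr ?normr_gt0//; apply: (le_trans (PC h)).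
    rewrite -real_normK ?num_real// expr2 mulrA ler_wpM2r//.
    apply: (@le_trans _ _ ((C + 1) * `|h|)); first by rewrite ler_wpM2r// lerDl.
    rewrite mulrC -ler_pdivlMr ?ltr_wpDl//; near: h.
    apply: dnbhs0_le; exact/divr_gt0/ltr_wpDl.
  rewrite F0; split; first by apply/cvg_ex; exists 0.
  exact: cvg_lim lim0.
Unshelve. all: by end_near. Qed.

Lemma continuous_flat P : continuous (flat P).
Proof.
move=> t; apply: differentiable_continuous; apply/derivable1_diffP.
exact: (@ex_derive _ _ _ _ _ _ _ (flat_is_derive P t)).
Qed.

End flat_functions.

Section smooth_functions.
Context {R : realType} {n : nat}.
Implicit Types (f g : 'rV[R]_n -> R) (x v z : 'rV[R]_n).

Lemma is_derive_line0 f x v (d : R) :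
  is_derive (0 : R) 1 (fun t : R => f (x + t *: v)) d -> is_derive x v f d.
Proof.
move=> [df <-].
have E : (fun h : R => h^-1 *: (((fun t : R => f (x + t *: v)) \o shift 0) (h *: 1)
     - f (x + 0 *: v))) =
    (fun h : R => h^-1 *: ((f \o shift x) (h *: v) - f x)).
  apply/funext => h; rewrite /= /shift; congr (_ *: (f _ - f _)).
    by rewrite [h *: 1]mulr1 addr0 addrC.
  by rewrite scale0r addr0.
split; first by rewrite /derivable -E.
by rewrite /derive -E.
Qed.

Lemma is_derive_comp_rV f (g : R -> R) x v (df dg : R) :
  is_derive x v f df -> is_derive (f x) 1 g dg ->
  is_derive x v (g \o f) (dg * df).
Proof.
move=> fx gfx; apply: is_derive_line0.
apply: (@is_derive1_comp _ (fun t : R => f (x + t *: v)) g).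
  by apply: is_derive_line; rewrite scale0r addr0.
by rewrite scale0r addr0.
Qed.

Lemma CkS k f : Ck k.+1 setT f -> Ck k setT f.
Proof.
elim: k f => [|k IH] f [cf df]; first by split.
by split=> // i; have [d1 d2] := df i; split=> //; exact: IH.
Qed.

Lemma Ck_step k f (df : 'I_n -> 'rV[R]_n -> R) :
  continuous f ->
  (forall x i, is_derive x (delta_mx 0 i) f (df i x)) ->
  (forall i, Ck k setT (df i)) -> Ck k.+1 setT f.
Proof.
move=> cf df1 Cdf; split=> [x _|i]; first exact: cf.
have -> : partial i f = df i.
  by apply/funext => x; exact: (@derive_val _ _ _ _ _ _ _ (df1 x i)).
by split=> // x _; exact: (@ex_derive _ _ _ _ _ _ _ (df1 x i)).
Qed.

Lemma Ck_cst k (c : R) : Ck k setT (fun _ : 'rV[R]_n => c).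
Proof.
elim: k c => [c|k IH c]; first by split=> // x _; exact: contcst.
by apply: (@Ck_step _ _ (fun _ _ => 0)) => // x; exact: contcst.
Qed.

Lemma Ck_is_derive k f x i : Ck k.+1 setT f ->
  is_derive x (delta_mx 0 i) f (partial i f x).
Proof. by move=> [_ /(_ i)[df _]]; apply: DeriveDef => //; exact: df. Qed.

Lemma Ck_continuous k f : Ck k setT f -> continuous f.
Proof. by case: k => [|k] [cf _] x; exact: cf. Qed.

Lemma CkD k f g : Ck k setT f -> Ck k setT g -> Ck k setT (fun x => f x + g x).
Proof.
elim: k f g => [|k IH] f g Cf Cg.
  by split=> // x _; exact: (contD (@Ck_continuous _ _ Cf x) (@Ck_continuous _ _ Cg x)).
apply: (@Ck_step _ _ (fun i x => partial i f x + partial i g x)) => [x|x i|i].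
- exact: (contD (@Ck_continuous _ _ Cf x) (@Ck_continuous _ _ Cg x)).
- exact: (is_deriveD (Ck_is_derive x i Cf) (Ck_is_derive x i Cg)).
- exact: (IH _ _ (Cf.2 i).2 (Cg.2 i).2).
Qed.

Lemma CkM k f g : Ck k setT f -> Ck k setT g -> Ck k setT (fun x => f x * g x).
Proof.
elim: k f g => [|k IH] f g Cf Cg.
  by split=> // x _; exact: (contM (@Ck_continuous _ _ Cf x) (@Ck_continuous _ _ Cg x)).
apply: (@Ck_step _ _
  (fun i x => f x * partial i g x + g x * partial i f x)) => [x|x i|i].
- exact: (contM (@Ck_continuous _ _ Cf x) (@Ck_continuous _ _ Cg x)).
- exact: (is_deriveM (Ck_is_derive x i Cf) (Ck_is_derive x i Cg)).
- by apply: CkD; apply: IH; [exact: CkS|exact: (Cg.2 i).2|exact: CkS|exact: (Cf.2 i).2].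
Qed.

(** It has two uses: composed with [flat] it gives the test functions, and on its own it is the
    cutoff eta of the maximum argument. *)
Definition paraboloid x (r : R) z : R := 1 - r^-1 ^+ 2 * dotrV (z - x) (z - x).

Lemma paraboloid_is_derive x r z i :
  is_derive z (delta_mx 0 i) (paraboloid x r) (- 2 * r^-1 ^+ 2 * (z - x) 0 i).
Proof.
apply: is_derive_line0; rewrite /paraboloid.
move: (r^-1 ^+ 2) => b; set y := z - x.
have -> : (fun t : R => 1 - b * dotrV (z + t *: delta_mx 0 i - x)
      (z + t *: delta_mx 0 i - x)) =
    horner ((1 - b * dotrV y y)%:P - (2 * b * y 0 i) *: 'X - b *: 'X^2).
  apply/funext => t; rewrite !hornerE addrAC -/y; move: y => y.
  rewrite dotrVDl !dotrVDr !dotrVZl !dotrVZr (dotrVC (delta_mx _ _)).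
  rewrite !dotrV_delta [delta_mx 0 i 0 i]mxE !eqxx/=; ring.
by apply: is_derive_eq; rewrite !poly.derivE !hornerE/=; ring.
Qed.

Lemma continuous_paraboloid x r : continuous (paraboloid x r).
Proof.
move=> z; have cx := @shift_continuous R n (- x) z.
exact: (contB (@contcst _ _ 1 z)
  (contM (@contcst _ _ (r^-1 ^+ 2) z) (dotrV_continuous cx cx))).
Qed.

Lemma coordinate_is_derive (a c : R) z i j :
  is_derive z (delta_mx 0 j) (fun z => a * (z 0 i - c)) (a * (i == j)%:R).
Proof.
apply: is_derive_line0.
have -> : (fun t : R => a * ((z + t *: delta_mx 0 j) 0 i - c)) =
    horner ((a * (z 0 i - c))%:P + (a * (i == j)%:R) *: 'X).
  by apply/funext => t; rewrite !hornerE !mxE eqxx/=; ring.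
by apply: is_derive_eq; rewrite !poly.derivE !hornerE.
Qed.

Lemma Ck_coordinate k (a c : R) i : Ck k setT (fun z => a * (z 0 i - c)).
Proof.
have ci : continuous (fun z : 'rV[R]_n => a * (z 0 i - c)).
  move=> z; exact: (contM (@contcst _ _ a z)
    (contB (@coord_continuous R 1 n 0 i z) (@contcst _ _ c z))).
case: k => [|k]; first by split=> // z _; exact: ci.
apply: (@Ck_step _ _ (fun j _ => a * (i == j)%:R)) => [z|z j|j].
- exact: ci.
- exact: coordinate_is_derive.
- exact: Ck_cst.
Qed.

(** Induction on [k] for all [P] at once: a partial derivative is another member of the family times
    an affine coordinate. *)
Lemma Ck_flat_paraboloid k P x r : Ck k setT (fun z => flat P (paraboloid x r z)).
Proof.
have cf Q : continuous (fun z => flat Q (paraboloid x r z)).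
  by move=> z; apply: (continuous_comp (@continuous_paraboloid x r z)); exact: continuous_flat.
elim: k P => [|k IH] P; first by split=> // z _; exact: cf.
apply: (@Ck_step _ _ (fun i z => flat (flat_deriv P) (paraboloid x r z) *
  (- 2 * r^-1 ^+ 2 * (z 0 i - x 0 i)))) => [|z i|i]; first exact: cf.
  have := is_derive_comp_rV (paraboloid_is_derive x r z i)
    (flat_is_derive P (paraboloid x r z)).
  by rewrite !mxE.
by apply: CkM; [exact: IH|exact: Ck_coordinate].
Qed.

End smooth_functions.

(** * The bump K, its slope weight k and the moments of k *)

Section kernel.
Context {R : realType} {n : nat}.
Notation mu := (lebesgue_rV R n).
Implicit Types (x y z : 'rV[R]_n) (r : R).

Definition ball_bump y : R := flat 1 (paraboloid 0 1 y).

(* [grad ball_bump y = - bump_slope y *: y] *)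
Definition bump_slope y : R := 2 * flat 'X^2 (paraboloid 0 1 y).

Lemma paraboloid01 y : paraboloid 0 1 y = 1 - dotrV y y.
Proof. by rewrite /paraboloid invr1 expr1n mul1r subr0. Qed.

Lemma paraboloid_affine x r z :
  paraboloid x r z = paraboloid 0 1 (r^-1 *: (z - x)).
Proof. by rewrite paraboloid01 dotrVZl dotrVZr mulrA -expr2. Qed.

Lemma flat_ge0 P (t : R) : (forall s, 0 < s -> 0 <= P.[s]) -> 0 <= flat P t.
Proof.
move=> P0; rewrite /flat; case: ifP => // t0.
by rewrite mulr_ge0 ?expR_ge0// P0// invr_gt0.
Qed.

Lemma flat_paraboloid_vanishes P : vanishes_beyond 1 (fun y => flat P (paraboloid 0 1 y)).
Proof.
move=> y y1; rewrite /flat ifF// paraboloid01 -sqr_enorm; apply/negbTE.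
by rewrite -leNgt subr_le0 -[leLHS](expr1n _ 2) ler_pXn2r ?nnegrE ?enorm_ge0// ltW.
Qed.

Lemma continuous_flat_paraboloid P x r :
  continuous (fun z => flat P (paraboloid x r z)).
Proof. exact: Ck_continuous (Ck_flat_paraboloid 0 P x r). Qed.

Lemma bump_weight : unit_weight ball_bump.
Proof.
split; [exact: continuous_flat_paraboloid| |exact: flat_paraboloid_vanishes].
by move=> y; apply: flat_ge0 => s _; rewrite hornerC.
Qed.

Lemma bump_slope_weight : unit_weight bump_slope.
Proof.
split=> [y|y|y /flat_paraboloid_vanishes].
- exact: (contM (@contcst _ _ 2 y) (@continuous_flat_paraboloid 'X^2 0 1 y)).
- by rewrite mulr_ge0// flat_ge0// => s s0; rewrite hornerXn exprn_ge0// ltW.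
- by rewrite /bump_slope => ->; rewrite mulr0.
Qed.

Lemma mass_bump_gt0 : 0 < mass ball_bump.
Proof.
case: bump_weight => cb b0 b1.
have B0 : 0 < ball_bump 0.
  rewrite /ball_bump paraboloid01 dotrV0l subr0 /flat ltr01 hornerC mul1r.
  exact: expR_gt0.
have /continuous_enormP/(_ _ (divr_gt0 B0 (ltr0Sn _ 1)))[d d0 bd] := cb 0.
(* With this half-side the cube lies in the Euclidean ball of radius [d], where the bump exceeds
   half of its value at the origin. *)
pose a := d / n.+1%:R / 2; have a0 : 0 < a by rewrite !divr_gt0.
have ma : measurable (box n a : set 'rV[R]_n) by exact: measurable_box.
apply: (@lt_le_trans _ _ (\int[mu]_(y in box n a) (ball_bump 0 / 2))).
  rewrite Rintegral_cst// [X in fine X](_ : _ = ((2 * a) ^+ n)%:E)/=; last first.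
    exact: lebesgue_rV_box.
  by rewrite mulr_gt0 ?divr_gt0// exprn_gt0// mulr_gt0.
rewrite Rintegral_mkcond; apply: le_Rintegral => //.
- rewrite -restrict_EFin; apply/(integrable_mkcond _ ma).1.
  apply: (@measurable_bounded_integrable _ _ _ mu (fun=> ball_bump 0 / 2)) => //.
    by rewrite lebesgue_rV_box// ltry.
  exact: bounded_cst.
- exact: (integrable_compact_support cb b1).
move=> y _; rewrite patchE; case: ifPn => [/set_mem ya|_]; last exact: b0.
have /bd : enorm (y - 0) < d.
  rewrite subr0 (le_lt_trans (enorm_le_mx_norm _))//.
  apply: (@le_lt_trans _ _ (n.+1%:R * a)).
    by rewrite ler_pM// ?ler_nat// mx_norm_leP// ltW.
  by rewrite /a mulrA mulrCA divff// mulr1 ltr_pdivrMr//; lra.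
rewrite ltr_norml => /andP[+ _]; lra.
Qed.

Lemma partial_flat1 x r z i : partial i (fun z => flat 1 (paraboloid x r z)) z =
  - r^-1 * bump_slope (r^-1 *: (z - x)) * (r^-1 *: (z - x)) 0 i.
Proof.
have /(@derive_val _ _ _ _ _ _ _) := is_derive_comp_rV (paraboloid_is_derive x r z i)
    (flat_is_derive 1 (paraboloid x r z)).
rewrite /partial /comp => ->.
rewrite /flat_deriv derivC subr0 mulr1 /bump_slope -paraboloid_affine !mxE; ring.
Qed.

Lemma Rintegral_partial (f : 'rV[R]_n -> R) i : Ck 1 setT f ->
  vanishes_beyond 1 f -> vanishes_beyond 1 (partial i f) ->
  \int[mu]_y partial i f y = 0.
Proof.
move=> Cf f1 df1.
apply: (@Rintegral_partial0 _ _ f (partial i f) (delta_mx 0 i)) => //.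
- exact: Ck_continuous Cf.
- by move=> y; exact: ((Cf.2 i).2.1 y).
move=> s s0.
have [d d0 dC] := C1_uniform openT Cf (@ecball_compact _ _ 0 2) (@subsetT _ _) s0.
have norm1 : enorm (delta_mx 0 i : 'rV[R]_n) = 1.
  by rewrite /enorm dotrV_delta mxE !eqxx sqrtr1.
exists (Num.min d 1); first by rewrite lt_min d0 ltr01.
move=> t y /andP[t0]; rewrite lt_min => /andP[td t1].
have normt : enorm (t *: delta_mx 0 i : 'rV[R]_n) = t.
  by rewrite enormZ norm1 mulr1 gtr0_norm.
have [y2|y2] := leP (enorm y) 2.
  have yB : ecball 0 2 y by rewrite /ecball/= subr0.
  have E : y + t *: delta_mx 0 i - y = t *: delta_mx 0 i.
    by rewrite [y + _]addrC addrK.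
  have yd : enorm (y + t *: delta_mx 0 i - y) < d by rewrite E normt.
  have [_ + _] := dC _ _ yB yd.
  by rewrite E normt dotrVZr dotrV_delta mxE.
have := ler_enormB (y + t *: delta_mx 0 i) (t *: delta_mx 0 i).
rewrite addrK normt => yt.
by rewrite f1 ?f1 ?df1; [rewrite mulr0 !subr0 normr0 mulr_ge0// ltW|lra..].
Qed.

Lemma partial_bump i y : partial i ball_bump y = - bump_slope y * y 0 i.
Proof.
have := partial_flat1 0 1 y i.
by rewrite invr1 scale1r subr0 mulN1r.
Qed.

Lemma Ck_bump k : Ck k setT ball_bump.
Proof. exact: Ck_flat_paraboloid. Qed.

Lemma bump_slope_coord i : wint bump_slope (fun y => y 0 i) = 0.
Proof.
case: bump_slope_weight => cs s0 s1.
have := @Rintegral_partial ball_bump i (Ck_bump 1) (flat_paraboloid_vanishes 1).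
have E y : partial i ball_bump y = (- 1) * (y 0 i * bump_slope y).
  by rewrite partial_bump; ring.
have -> : partial i ball_bump = (fun y => (- 1) * (y 0 i * bump_slope y)).
  by apply/funext.
have ci : continuous_on_ball (fun y : 'rV[R]_n => y 0 i).
  by move=> y _; exact: coord_continuous.
rewrite RintegralZl//; last exact: (wint_integrable bump_slope_weight).
move=> H; apply/eqP; rewrite -oppr_eq0 -mulN1r; apply/eqP; apply: H.
by move=> y /s1 ->; rewrite !mulr0.
Qed.

(** Integrate the [j]-th derivative of [ball_bump y * y_i], namely [delta_ij ball_bump y - y_i y_j
    bump_slope y]. This is the isotropy of k, with the mass of the bump as its second moment. *)
Lemma bump_slope_coord2 i j :
  wint bump_slope (fun y => y 0 i * y 0 j) = (i == j)%:R * mass ball_bump.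
Proof.
case: bump_slope_weight (bump_weight) => cs s0 s1 [cb b0 b1].
pose f y := ball_bump y * (1 * (y 0 i - 0)).
have Cf : Ck 1 setT f by apply: CkM; [exact: Ck_bump|exact: Ck_coordinate].
have E : partial j f =
    (fun y => (i == j)%:R * ball_bump y - (y 0 i * y 0 j) * bump_slope y).
  apply/funext => y.
  have := is_deriveM (@Ck_is_derive _ _ 0 _ y j (Ck_bump 1))
    (@coordinate_is_derive R n 1 0 y i j).
  move=> /(@derive_val _ _ _ _ _ _ _); rewrite /partial => -> /=.
  rewrite -/(partial j ball_bump y) partial_bump /GRing.scale/=; ring.
have f1 : vanishes_beyond 1 f by move=> y /b1; rewrite /f => ->; rewrite mul0r.
have df1 : vanishes_beyond 1 (partial j f).
  by move=> y y1; rewrite E (b1 y y1) (s1 y y1) !mulr0 subr0.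
have cij : continuous_on_ball (fun y : 'rV[R]_n => y 0 i * y 0 j).
  by apply: cballM => y _; exact: coord_continuous.
have ib : mu.-integrable setT (EFin \o ball_bump).
  exact: integrable_compact_support cb b1.
have := Rintegral_partial Cf f1 df1; rewrite E RintegralB//; last 2 first.
- exact: (integrableZl measurableT _ ib).
- exact: (wint_integrable bump_slope_weight).
rewrite RintegralZl// => /eqP; rewrite subr_eq0 => /eqP/esym H; exact: H.
Qed.

End kernel.

(** * Testing the equation with a bump *)

Section weak_kernel_identity.
Context {R : realType} {n : nat}.
Notation mu := (lebesgue_rV R n).
Implicit Types (x y z : 'rV[R]_n) (r : R).

Lemma continuous_powR (t a : R) : 0 < t -> {for t, continuous (fun s : R => s `^ a)}.
Proof.
move=> t0; apply: differentiable_continuous; apply/derivable1_diffP.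
exact: (@ex_derive _ _ _ _ _ _ _ (is_derive1_powR a t0)).
Qed.

Lemma cont_powR (T : topologicalType) (g : T -> R) (a : R) (x : T) :
  0 < g x -> {for x, continuous g} -> {for x, continuous (fun s : T => g s `^ a)}.
Proof.
move=> g0 cg.
exact: (@continuous_comp _ _ _ g (fun s : R => s `^ a) x cg (continuous_powR g0)).
Qed.

(** Away from the zeros of [g] the power is smooth; at a zero, [t ^ a <= t] for small [t] because
    [1 <= a]. *)
Lemma continuous_enorm_powR (g : 'rV[R]_n -> 'rV[R]_n) (a : R) x : 1 <= a ->
  {for x, continuous g} -> {for x, continuous (fun z => enorm (g z) `^ a)}.
Proof.
move=> a1 cg.
have cng : {for x, continuous (fun z => enorm (g z))}.
  rewrite (_ : (fun z => enorm (g z)) = (fun z => enorm (z - 0)) \o g).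
    exact: (continuous_comp cg (@enormB_continuous R n 0 (g x))).
  by apply/funext => z /=; rewrite subr0.
have [gx0|gx0] := eqVneq (enorm (g x)) 0; last first.
  by apply: cont_powR => //; rewrite lt_neqAle eq_sym gx0 enorm_ge0.
apply/continuous_enormP => e e0.
have e1 : 0 < Num.min e 1 by rewrite lt_min e0 ltr01.
have /continuous_enormP/(_ _ e1)[d d0 gd] := cng; exists d => // z /gd.
have a0 : a != 0 by rewrite gt_eqF// (lt_le_trans _ a1).
rewrite gx0 powR0// !subr0 ger0_norm ?enorm_ge0// ger0_norm ?powR_ge0//.
rewrite lt_min => /andP[ge g1].
have [->|gz0] := eqVneq (enorm (g z)) 0; first by rewrite powR0.
apply: le_lt_trans ge; apply: ge1r_powR => //.
by rewrite ltW// andbT lt_neqAle eq_sym gz0 enorm_ge0.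
Qed.

Lemma integral_weight_affine (w h : 'rV[R]_n -> R) (Omega : set 'rV[R]_n) x r :
  unit_weight w -> 0 < r -> ecball x r `<=` Omega ->
  (forall z, ecball x r z -> {for z, continuous h}) ->
  (\int[mu]_(z in Omega) (h z * w (r^-1 *: (z - x)))%:E)%E =
  (r ^+ n * wint w (fun y => h (x + r *: y)))%:E.
Proof.
move=> ww r0 xO ch; have [cw w0 w1] := ww.
pose F z := h z * w (r^-1 *: (z - x)); pose H y := h (x + r *: y) * w y.
have in_ball y : enorm y <= 1 -> ecball x r (x + r *: y).
  move=> y1; rewrite /ecball/= addrC addKr enormZ gtr0_norm//.
  by rewrite -[leRHS]mulr1 ler_wpM2l// ltW.
have cH : continuous H.
  apply: continuous_mul_weight => // y /in_ball/ch.
  exact: (continuous_comp (@affine_continuous R n x r y)).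
have HF y : F (x + r *: y) = H y.
  have E : x + r *: y - x = r *: y by rewrite addrC addKr.
  by rewrite /F /H E scalerA mulVf ?gt_eqF// scale1r.
(* Writing [F] as [H] after an affine map gives its continuity on the whole space, although [h] is
   continuous only on the ball. *)
have FH : F = H \o (fun z => - (r^-1 *: x) + r^-1 *: z).
  apply/funext => z /=; rewrite -HF; congr F.
  by rewrite [- _ + _]addrC -scalerBr scalerA divff ?gt_eqF// scale1r subrKC.
have cF : continuous F.
  rewrite FH => z.
  exact: (continuous_comp (@affine_continuous R n (- (r^-1 *: x)) r^-1 z) (cH _)).
have F0 z : r < enorm (z - x) -> F z = 0.
  move=> rz; rewrite /F w1 ?mulr0// enormZ normfV gtr0_norm//.
  by rewrite mulrC ltr_pdivlMr// mul1r.
have Fv : vanishes_beyond (enorm x + r) F.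
  by move=> z xz; apply: F0; have := ler_enormD (z - x) x; rewrite subrK; lra.
rewrite integral_mkcond [X in integral _ _ X](_ : _ = EFin \o F); last first.
  apply/funext => z; rewrite patchE; case: ifPn => //.
  rewrite notin_setE => zO; rewrite /= F0// ltNge; apply/negP => zx.
  by apply: zO; exact: xO.
rewrite -[LHS]fineK; last first.
  by apply: integrable_fin_num => //; exact: (integrable_compact_support cF Fv).
congr EFin; transitivity (\int[mu]_z F z) => //.
rewrite (Rintegral_affine x r0 cF Fv); congr (_ * _).
by apply: eq_Rintegral => y _; rewrite HF.
Qed.

Section solution.
Variables (p M q : R) (Omega : set 'rV[R]_n) (u : 'rV[R]_n -> R).
Hypotheses (q1 : 1 < q) (oO : open Omega)
  (pu : positive_solution p M q Omega u).

Definition rhs z := u z `^ p + M * enorm (grad u z) `^ q.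

Lemma continuous_grad z : Omega z -> {for z, continuous (grad u)}.
Proof.
case: pu => _ [[_ Cu] _ _] Oz; apply: grad_continuous => i.
by have [_ [+ _]] := Cu i; exact.
Qed.

Lemma continuous_power z : Omega z -> {for z, continuous (fun z => u z `^ p)}.
Proof.
case: pu => u0 [[cu _] _ _] Oz.
by apply: cont_powR; [exact: u0|exact: cu].
Qed.

Lemma continuous_grad_power z : Omega z ->
  {for z, continuous (fun z => enorm (grad u z) `^ q)}.
Proof.
by move=> Oz; apply: continuous_enorm_powR; [exact: ltW|exact: continuous_grad].
Qed.

Lemma continuous_rhs z : Omega z -> {for z, continuous rhs}.
Proof.
move=> Oz; exact: (contD (continuous_power Oz)
  (contM (@contcst _ _ M z) (continuous_grad_power Oz))).
Qed.

(** The integrals of the weak formulation all scale by [r ^+ n], which cancels; the factor [- r] is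
    the inverse of the [- r^-1] produced by differentiating the rescaled bump. *)
Lemma weak_kernel_identity x r : 0 < r -> ecball x r `<=` Omega ->
  wint bump_slope (fun y => dotrV (grad u (x + r *: y)) y) =
  - r * wint ball_bump (fun y => rhs (x + r *: y)).
Proof.
move=> r0 xO; have [_ [_ _ weak]] := pu.
pose psi := (fun z => flat 1 (paraboloid x r z)).
have psiE z : psi z = ball_bump (r^-1 *: (z - x)) by rewrite /psi paraboloid_affine.
have [cb b0 b1] := @bump_weight R n.
have psi_supp : closure [set z | psi z != 0] `<=` ecball x r.
  have : closed (ecball x r) by exact: compact_closed (@ecball_compact R n x r).
  move=> /closure_id ->; apply: closure_subset => z /=.
  apply: contraNP => /negP; rewrite -ltNge => rz.
  rewrite psiE b1// enormZ normfV gtr0_norm//.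
  by rewrite mulrC ltr_pdivlMr// mul1r.
have Cpsi : Cc_infty Omega psi.
  split=> [k||]; first exact: Ck_flat_paraboloid.
    apply: subclosed_compact (@ecball_compact R n x r) psi_supp.
    exact: closed_closure.
  exact: subset_trans psi_supp xO.
have := weak psi Cpsi.
have EL z : dotrV (grad u z) (grad psi z) =
    (- r^-1 * dotrV (grad u z) (r^-1 *: (z - x))) * bump_slope (r^-1 *: (z - x)).
  rewrite /dotrV mulr_sumr mulr_suml; apply: eq_bigr => i _.
  by rewrite [X in _ * X]mxE /psi partial_flat1; ring.
under eq_integral do rewrite EL.
under [in X in _ = X -> _]eq_integral do rewrite psiE.
rewrite (@integral_weight_affine bump_slope _ _ x r bump_slope_weight)//; last first.
  move=> z /xO/continuous_grad cg; apply: (contM (@contcst _ _ (- r^-1) z)).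
  apply: (dotrV_continuous cg).
  have cs := @shift_continuous R n (- x) z.
  exact: (continuous_comp cs (@scaler_continuous _ _ r^-1 (z - x))).
rewrite (@integral_weight_affine ball_bump _ _ x r bump_weight)//; last first.
  by move=> z /xO; exact: continuous_power.
under [in X in _ = X -> _]eq_integral do rewrite psiE.
rewrite (@integral_weight_affine ball_bump _ _ x r bump_weight)//; last first.
  by move=> z /xO; exact: continuous_grad_power.
have in_ball y : enorm y <= 1 -> Omega (x + r *: y).
  move=> y1; apply: xO; rewrite /ecball/= addrC addKr enormZ gtr0_norm//.
  by rewrite -[leRHS]mulr1 ler_wpM2l// ltW.
have cball_comp (h : 'rV[R]_n -> R) : (forall z, Omega z -> {for z, continuous h}) ->
    continuous_on_ball (fun y => h (x + r *: y)).
  move=> ch y /in_ball/ch.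
  exact: (continuous_comp (@affine_continuous R n x r y)).
have cdot : continuous_on_ball (fun y => dotrV (grad u (x + r *: y)) y).
  move=> y /in_ball/continuous_grad cg; apply: dotrV_continuous; last exact: cvg_id.
  exact: (continuous_comp (@affine_continuous R n x r y) cg).
have -> : wint bump_slope (fun y =>
      - r^-1 * dotrV (grad u (x + r *: y)) (r^-1 *: (x + r *: y - x))) =
    - r^-1 * wint bump_slope (fun y => dotrV (grad u (x + r *: y)) y).
  rewrite -(wintZ bump_slope_weight)//; apply: eq_wint => [|y _].
    exact: bump_slope_weight.
  have -> : x + r *: y - x = r *: y by rewrite addrC addKr.
  by rewrite scalerA mulVf ?gt_eqF// scale1r.
rewrite /rhs (wintD bump_weight); last 2 first.
- exact: (cball_comp _ continuous_power).
- exact: (cballM (@cball_cst _ _ M) (cball_comp _ continuous_grad_power)).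
rewrite (wintZ bump_weight); last exact: (cball_comp _ continuous_grad_power).
move: (wint _ _) (wint _ _) (wint _ _) => a b c.
rewrite -EFinM -EFinD => -[] /eqP.
rewrite [M * (_ * _)]mulrCA -mulrDr -subr_eq0 -mulrBr mulf_eq0 expf_eq0 (gt_eqF r0) andbF/=.
rewrite subr_eq0 => /eqP <-.
by field; rewrite gt_eqF.
Qed.

End solution.
End weak_kernel_identity.

(** * Scalar estimates *)

Section scalar_estimates.
Context {R : realType}.

(** At a maximum of [Z * eta ^+ m] other values of [Z] are compared through [(eta x0 / eta x) ^+ m];
    with [eta x = eta x0 * (1 + s)] this is the function expanded here. *)
Lemma expV1D_taylor (m : nat) : exists2 C : R, 0 <= C & forall s : R, `|s| <= 2^-1 ->
  `|(1 + s)^-1 ^+ m - 1 + m%:R * s| <= C * s ^+ 2.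
Proof.
elim: m => [|m [C C0 IH]].
  by exists 0 => // s _; rewrite expr0 subrr !mul0r addr0 normr0.
exists (2 * C + 2 + 2 * m%:R); first by rewrite !addr_ge0 ?mulr_ge0.
move=> s s2; pose w := (1 + s)^-1.
have [s2a s2b] : - 2^-1 <= s /\ s <= 2^-1 by move: s2; rewrite ler_norml => /andP[].
have s1 : 0 < 1 + s by lra.
have w0 : 0 < w by rewrite invr_gt0.
have w2 : w <= 2 by rewrite -[leRHS]invrK lef_pV2 ?posrE ?invr_gt0//; lra.
have w1 : w - 1 = - (s * w) by rewrite /w; field; rewrite gt_eqF.
have w1s : w - 1 + s = s ^+ 2 * w by rewrite /w; field; rewrite gt_eqF.
rewrite -/w.
rewrite (_ : w ^+ m.+1 - 1 + m.+1%:R * s =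
  w * (w ^+ m - 1 + m%:R * s) + s ^+ 2 * w + m%:R * s ^+ 2 * w); last first.
  rewrite -w1s exprS -natr1.
  rewrite (_ : m%:R * s ^+ 2 * w = m%:R * s * (s * w)); last by ring.
  by rewrite -[s * w]opprK -w1; ring.
have s0 := sqr_ge0 s; have w0' := ltW w0.
have h1 : `|w * (w ^+ m - 1 + m%:R * s)| <= 2 * C * s ^+ 2.
  by rewrite normrM (gtr0_norm w0) -mulrA ler_pM// IH.
have h2 : `|s ^+ 2 * w| <= 2 * s ^+ 2.
  have sw : 0 <= s ^+ 2 * w by exact: mulr_ge0.
  by rewrite ger0_norm// mulrC ler_wpM2r.
have h3 : `|m%:R * s ^+ 2 * w| <= 2 * m%:R * s ^+ 2.
  have ms : 0 <= m%:R * s ^+ 2 by exact: mulr_ge0.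
  rewrite ger0_norm; last exact: mulr_ge0.
  by rewrite mulrC -mulrA ler_wpM2r.
apply: (le_trans (ler_normD _ _)).
apply: (le_trans (lerD (le_trans (ler_normD _ _) (lerD h1 h2)) h3)).
by rewrite -!mulrDl.
Qed.

(** Moving by [d] multiplies the paraboloid by [1 + s] with [|s| <= 3 |d| / (rho e0)]. The
    admissible length [rho e0 / 6] is what makes [|s| <= 1/2], so that [expV1D_taylor] applies. *)
Lemma barrier_taylor (m : nat) : exists2 C : R, 0 <= C &
  forall n (x1 x0 d : 'rV[R]_n) (rho Z0 Z : R), 0 < rho ->
  0 < paraboloid x1 rho x0 -> enorm d <= rho * paraboloid x1 rho x0 / 6 ->
  0 <= Z0 ->
  0 < paraboloid x1 rho (x0 + d) /\
  (Z * paraboloid x1 rho (x0 + d) ^+ m <= Z0 * paraboloid x1 rho x0 ^+ m ->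
   Z - Z0 <= Z0 * (2 * m%:R / (rho ^+ 2 * paraboloid x1 rho x0) * dotrV (x0 - x1) d
     + C / (rho * paraboloid x1 rho x0) ^+ 2 * enorm d ^+ 2)).
Proof.
have [C C0 HC] := expV1D_taylor m.
(* [m%:R] pays for the quadratic part of [- m s], using [e0 <= 1]; [9 * C] comes from squaring
   [|s| <= 3 |d| / (rho e0)]. *)
exists (m%:R + 9 * C); first by rewrite addr_ge0 ?mulr_ge0.
move=> n x1 x0 d rho Z0 Z rho0; set e0 := paraboloid x1 rho x0 => e00 de Z00.
pose D := enorm d; have D0 : 0 <= D by exact: enorm_ge0.
pose L := dotrV (x0 - x1) d; pose Y := enorm (x0 - x1).
have Y0 : 0 <= Y by exact: enorm_ge0.
have e0E : e0 = 1 - rho^-1 ^+ 2 * Y ^+ 2 by rewrite /e0 /paraboloid sqr_enorm.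
have rV : 0 < rho^-1 ^+ 2 by rewrite exprn_gt0// invr_gt0.
have e01 : e0 <= 1 by rewrite e0E lerBlDr lerDl mulr_ge0 ?sqr_ge0// ltW.
have Yrho : Y <= rho.
  rewrite -(@ler_pXn2r _ 2)// ?nnegrE// ?(ltW rho0)//.
  move: e00; rewrite e0E subr_gt0 exprVn mulrC ltr_pdivrMr ?exprn_gt0// mul1r.
  exact: ltW.
have LY : `|L| <= Y * D by exact: ler_dotrV.
pose s := - rho^-1 ^+ 2 * (2 * L + D ^+ 2) / e0.
have ed : paraboloid x1 rho (x0 + d) = e0 * (1 + s).
  rewrite /s mulrDr mulr1 mulrC divfK ?gt_eqF// /e0 /paraboloid.
  have -> : x0 + d - x1 = (x0 - x1) + d by rewrite addrAC.
  rewrite dotrV_sqrD -/L /D sqr_enorm.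
  by move: (dotrV _ _) (dotrV d d) (_ ^+ 2) => P Q b; ring.
have Drho : D <= rho by rewrite (le_trans de)// -[leRHS]mulr1 -mulrA ler_wpM2l ?(ltW rho0)//; lra.
have sD : `|s| <= 3 * D / (rho * e0).
  rewrite /s !normrM normrN (gtr0_norm rV) normfV (gtr0_norm e00).
  rewrite (_ : 3 * D / (rho * e0) = rho^-1 ^+ 2 * (3 * rho * D) / e0); last first.
    by field; rewrite !gt_eqF.
  rewrite ler_wpM2r ?invr_ge0 ?(ltW e00)// ler_wpM2l ?(ltW rV)//.
  have : `|2 * L + D ^+ 2| <= 2 * (Y * D) + D ^+ 2.
    rewrite (le_trans (ler_normD _ _))// normrM (ger0_norm (sqr_ge0 D)) ger0_norm// lerD2r.
    by rewrite ler_wpM2l.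
  move=> /le_trans; apply; nra.
have s12 : `|s| <= 2^-1.
  rewrite (le_trans sD)// ler_pdivrMr ?mulr_gt0//.
  by move: de; rewrite -/D; lra.
have s1 : 0 < 1 + s by move: s12; rewrite ler_norml => /andP[]; lra.
split; first by rewrite ed mulr_gt0.
rewrite ed exprMn mulrA mulrAC ler_pM2r ?exprn_gt0// => ZZ0.
have Z1 : Z <= Z0 * (1 + s)^-1 ^+ m.
  by rewrite exprVn ler_pdivlMr ?exprn_gt0.
have := HC s s12; rewrite ler_norml => /andP[_ wm].
have s2 : s ^+ 2 <= 9 * D ^+ 2 / (rho * e0) ^+ 2.
  rewrite -[leLHS]real_normK ?num_real//.
  rewrite (_ : 9 * D ^+ 2 / (rho * e0) ^+ 2 = (3 * D / (rho * e0)) ^+ 2); last first.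
    by field; rewrite !gt_eqF.
  by rewrite ler_pXn2r ?nnegrE// divr_ge0 ?mulr_ge0// ltW.
apply: (@le_trans _ _ (Z0 * ((1 + s)^-1 ^+ m - 1))).
  by rewrite mulrBr mulr1 lerD2r.
rewrite ler_wpM2l//.
apply: (@le_trans _ _ (- (m%:R * s) + C * s ^+ 2)); first by lra.
have -> : - (m%:R * s) = 2 * m%:R / (rho ^+ 2 * e0) * L + m%:R / (rho ^+ 2 * e0) * D ^+ 2.
  by rewrite /s; field; rewrite !gt_eqF.
rewrite -addrA lerD2l mulrDl mulrDl lerD//.
  rewrite ler_wpM2r ?sqr_ge0// ler_wpM2l// lef_pV2 ?posrE ?mulr_gt0 ?exprn_gt0 ?mulr_gt0//.
  rewrite exprMn ler_wpM2l ?sqr_ge0// expr2 -[leRHS]mulr1 ler_wpM2l// ltW//.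
rewrite (_ : 9 * C / _ * _ = C * (9 * D ^+ 2 / (rho * e0) ^+ 2)); first by rewrite ler_wpM2l.
by rewrite /D; field; rewrite !gt_eqF.
Qed.

Lemma min_max_between (a b x l h : R) : Num.min a b <= x -> x <= Num.max a b ->
  l <= a <= h -> l <= b <= h -> l <= x <= h.
Proof.
move=> /(le_trans _) lx /le_trans xh /andP[la ah] /andP[lb bh].
by rewrite lx ?xh// ?le_min ?ge_max ?la ?lb ?ah ?bh.
Qed.

Lemma powR_mean_value (r s t : R) : 0 < s -> 0 < t ->
  exists x, [/\ Num.min s t <= x, x <= Num.max s t &
    s `^ r - t `^ r = r * x `^ (r - 1) * (s - t)].
Proof.
wlog st : s t / t <= s.
  move=> H s0 t0; have /orP[ts|st] := le_total t s; first exact: (H s t).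
  have [x []] := H t s st t0 s0; rewrite minC maxC => ? ? E; exists x; split=> //.
  by rewrite -opprB E -mulrN opprB.
move=> s0 t0; rewrite min_r// max_l//.
have d (x : R) : t <= x -> is_derive x 1 (fun y : R => y `^ r) (r * x `^ (r - 1)).
  by move=> tx; apply: is_derive1_powR; exact: lt_le_trans tx.
have dst (x : R) : x \in `]t, s[%R -> is_derive x 1 (fun y : R => y `^ r) (r * x `^ (r - 1)).
  by rewrite in_itv/= => /andP[/ltW/d].
have cst : {within `[t, s], continuous (fun y : R => y `^ r)}.
  apply: derivable_within_continuous => x; rewrite in_itv/= => /andP[tx _].
  exact: (@ex_derive _ _ _ _ _ _ _ (d x tx)).
have [x] := MVT_segment st dst cst.
by rewrite in_itv/= => /andP[? ?] E; exists x.
Qed.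

(** Both signs of the exponent are covered: the power is monotone one way or the other, hence
    dominated by its value at one endpoint. *)
Lemma powR_le_ends (r a b x : R) : 0 < a -> a <= x -> x <= b ->
  x `^ r <= a `^ r + b `^ r.
Proof.
move=> a0 ax xb; have x0 := lt_le_trans a0 ax.
have [r0|r0] := leP 0 r.
  apply: (@le_trans _ _ (b `^ r)); last by rewrite lerDr powR_ge0.
  by rewrite ge0_ler_powR// nnegrE ltW// (lt_le_trans x0).
apply: (@le_trans _ _ (a `^ r)); last by rewrite lerDl powR_ge0.
rewrite -[r]opprK !(powRN _ (- r)) lef_pV2 ?posrE ?powR_gt0//.
by rewrite ge0_ler_powR// ?nnegrE ?(ltW a0)// ?(ltW x0)// oppr_ge0 ltW.
Qed.

(** The lower bound [A] keeps away from the origin, where the exponent [q - 2] may be negative. The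
    mean value theorem is used twice, for the powers [q] and [q - 1] of the length, and
    [dotrV a (b - a)] differs from [t * (s - t)] by a quadratic term only. *)
Lemma enorm_powR_expand (q A L tau : R) : 1 < q -> 0 < A -> A <= L -> 0 < tau ->
  exists2 s : R, 0 < s & forall n (a b : 'rV[R]_n), A <= enorm a -> enorm a <= L ->
    enorm (b - a) <= s ->
    `|enorm b `^ q - enorm a `^ q - q * enorm a `^ (q - 2) * dotrV a (b - a)|
      <= tau * enorm (b - a).
Proof.
move=> q1 A0 AL tau0; have q0 : 0 < q by rewrite (lt_trans _ q1).
pose B := (A / 2) `^ (q - 2) + (2 * L) `^ (q - 2).
have B0 : 0 <= B by rewrite addr_ge0 ?powR_ge0.
pose C := q * (q - 1) * B + q * B.
have C0 : 0 <= C.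
  by rewrite addr_ge0 ?mulr_ge0 ?(ltW q0)// subr_ge0 ltW.
(* [A / 2] confines the length of [b] to the interval from [A / 2] to [2 * L]; [tau / (C + 1)] turns
   the quadratic error [C * D ^+ 2] into [tau * D]. *)
exists (Num.min (A / 2) (tau / (C + 1))).
  by rewrite lt_min !divr_gt0// ltr_wpDl.
move=> n a b Aa aL; rewrite le_min => /andP[dA dt].
set D := enorm (b - a) in dA dt *; set t := enorm a; set s := enorm b.
have D0 : 0 <= D by exact: enorm_ge0.
have stD : `|s - t| <= D by exact: ler_dist_enorm.
have [st1 st2] : - D <= s - t /\ s - t <= D by move: stD; rewrite ler_norml => /andP[].
have t0 : 0 < t by rewrite (lt_le_trans A0).
have s0 : 0 < s by rewrite -/t in Aa; lra.
have dot_ab : dotrV a b = (s ^+ 2 + t ^+ 2 - D ^+ 2) / 2.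
  rewrite /s /t /D !sqr_enorm; have -> : b - a = b + (-1) *: a by rewrite scaleN1r.
  rewrite dotrV_sqrD !dotrVZr dotrVZl (dotrVC b a); lra.
have dot_ad : dotrV a (b - a) = t * (s - t) - (D ^+ 2 - (s - t) ^+ 2) / 2.
  by rewrite dotrVBr dot_ab -(sqr_enorm a) -/t; field.
have [x [x1 x2 E]] := powR_mean_value q s0 t0.
have A2t : A / 2 <= t <= 2 * L by rewrite -/t in Aa aL; apply/andP; split; lra.
have A2s : A / 2 <= s <= 2 * L by rewrite -/t in Aa aL; apply/andP; split; lra.
have /andP xb := min_max_between x1 x2 A2s A2t.
have x0 : 0 < x by case: xb => h _; apply: lt_le_trans h; exact: divr_gt0.
have [y [y1 y2 F]] := powR_mean_value (q - 1) x0 t0.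
have /andP yb := min_max_between y1 y2 (introT andP xb) A2t.
have yB : y `^ (q - 2) <= B by apply: powR_le_ends; [exact: divr_gt0|case: yb..].
have tB : t `^ (q - 2) <= B.
  by apply: powR_le_ends; [exact: divr_gt0|rewrite -/t in Aa; lra|rewrite -/t in aL; lra].
have xt : `|x - t| <= D.
  rewrite ler_distl; apply: (min_max_between x1 x2); apply/andP; split; lra.
have tq : t `^ (q - 1) = t `^ (q - 2) * t.
  have -> : q - 1 = (q - 2) + 1 by ring.
  by rewrite powRD ?powRr1 ?(ltW t0)// (gt_eqF t0) implybT.
have q12 : q - 1 - 1 = q - 2 by ring.
rewrite E dot_ad.
have -> : q * x `^ (q - 1) * (s - t) - q * t `^ (q - 2) *
    (t * (s - t) - (D ^+ 2 - (s - t) ^+ 2) / 2) =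
   q * ((q - 1) * y `^ (q - 2) * (x - t)) * (s - t) +
   q * t `^ (q - 2) * ((D ^+ 2 - (s - t) ^+ 2) / 2).
  by rewrite -q12 -F tq q12; ring.
apply: (@le_trans _ _ (C * D ^+ 2)); last first.
  rewrite expr2 mulrA ler_wpM2r//.
  apply: (@le_trans _ _ ((C + 1) * D)); first by rewrite ler_wpM2r// lerDl.
  by rewrite mulrC -ler_pdivlMr// ltr_wpDl.
apply: (le_trans (ler_normD _ _)); rewrite /C (mulrDl _ _ (D ^+ 2)); apply: lerD.
  rewrite !normrM (gtr0_norm q0) (ger0_norm (powR_ge0 _ _)) (@ger0_norm _ (q - 1)) ?subr_ge0 ?(ltW q1)//.
  rewrite expr2 -!mulrA ler_wpM2l ?(ltW q0)// ler_wpM2l ?subr_ge0 ?(ltW q1)//.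
  by rewrite ler_pM ?powR_ge0 ?mulr_ge0// ler_pM.
rewrite normrM ger0_norm ?mulr_ge0 ?powR_ge0 ?(ltW q0)// -!mulrA.
rewrite ler_wpM2l ?(ltW q0)// ler_pM ?powR_ge0//.
have sD : (s - t) ^+ 2 <= D ^+ 2.
  by rewrite -[leLHS]real_normK ?num_real// ler_pXn2r ?nnegrE.
by have := sqr_ge0 (s - t); have := sqr_ge0 D; rewrite ger0_norm; lra.
Qed.

(** Here [z], [w], [S] are the energy, the gradient-increment energy and the source, normalised by
    [eps ^+ 2 * c1]; [P] is [A ^ (q - 1)] and [Y] is [1 / (rho eta)]. The hypotheses give
    [w <= 2 z B] and [w >= M^2 A^2 P^2 / (4 N)]. With [z <= 2 A^2] the factor [A^2] drops out,
    leaving a quadratic inequality in [P] and [Y]. *)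
Lemma absorption (N M q m C A P Y z w S tau : R) :
  0 < N -> 0 < M -> 0 <= q -> 0 <= m -> 0 <= C -> 0 < A -> 0 < P -> 0 < Y ->
  0 <= z -> 0 <= tau ->
  w - S <= z * (C * Y ^+ 2) ->
  S <= M * q * m * P * Y * z + M * tau / 2 * (z + w) ->
  (M * A * P / 2) ^+ 2 / N <= w ->
  z <= 2 * A ^+ 2 -> M * tau <= 1 -> M * tau <= M ^+ 2 * P ^+ 2 / (16 * N) ->
  P <= (64 * N * q * m / M + 1 + 64 * N * C / M ^+ 2) * Y.
Proof.
move=> N0 M0 q0 m0 C0 A0 P0 Y0 z0 tau0 h1 h2 h3 h4 h5 h6.
pose T := M * tau; rewrite -/T in h2 h5 h6.
have T0 : 0 <= T by rewrite mulr_ge0// ltW.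
pose B := C * Y ^+ 2 + M * q * m * P * Y + T / 2.
have CY : 0 <= C * Y ^+ 2 by rewrite mulr_ge0// sqr_ge0.
have MP : 0 <= M * q * m * P * Y by do ![apply: mulr_ge0 => //; try exact: ltW].
have B0 : 0 <= B by rewrite !addr_ge0// divr_ge0.
have w0 : 0 <= w by rewrite (le_trans _ h3)// divr_ge0 ?sqr_ge0// ltW.
have hw : w <= 2 * (z * B).
  have Tw : T * w <= w by rewrite ler_piMl.
  by rewrite /B !mulrDr; lra.
have hz : z * B <= 2 * A ^+ 2 * B by rewrite ler_wpM2r.
have A2 : 0 < A ^+ 2 by rewrite exprn_gt0.
have : A ^+ 2 * (M ^+ 2 * P ^+ 2 / (16 * N)) <= A ^+ 2 * B.
  have E : (M * A * P / 2) ^+ 2 / N = 4 * (A ^+ 2 * (M ^+ 2 * P ^+ 2 / (16 * N))).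
    by field; rewrite gt_eqF.
  by rewrite E in h3; lra.
rewrite ler_pM2l// => hB.
pose U := M ^+ 2 * P ^+ 2 / (64 * N).
have U16 : M ^+ 2 * P ^+ 2 / (16 * N) = 4 * U by rewrite /U; field; rewrite gt_eqF.
rewrite U16 in h6 hB.
have key : 2 * U <= C * Y ^+ 2 + M * q * m * P * Y by rewrite /B in hB; lra.
rewrite leNgt; apply/negP => XP.
pose a := 64 * N * q * m / M; pose b := 64 * N * C / M ^+ 2.
have a0 : 0 <= a.
  by rewrite divr_ge0 ?(ltW M0)//; do ![apply: mulr_ge0 => //; try exact: ltW].
have b0 : 0 <= b.
  by rewrite divr_ge0 ?sqr_ge0//; do ![apply: mulr_ge0 => //; try exact: ltW].
rewrite -/a -/b in XP.
have MN : 0 < M ^+ 2 / (64 * N) by rewrite divr_gt0 ?exprn_gt0 ?mulr_gt0.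
have aU : M * q * m * P * Y <= U.
  have -> : M * q * m * P * Y = M ^+ 2 / (64 * N) * (P * (a * Y)).
    by rewrite /a; field; rewrite !gt_eqF.
  have -> : U = M ^+ 2 / (64 * N) * (P * P) by rewrite /U; field; rewrite gt_eqF.
  rewrite ler_wpM2l ?(ltW MN)// ler_wpM2l ?(ltW P0)//.
  apply: le_trans (ltW XP); rewrite ler_wpM2r ?(ltW Y0)//; lra.
have bU : C * Y ^+ 2 < U.
  have -> : C * Y ^+ 2 = M ^+ 2 / (64 * N) * (b * Y ^+ 2).
    by rewrite /b; field; rewrite !gt_eqF.
  have -> : U = M ^+ 2 / (64 * N) * P ^+ 2 by rewrite /U; field; rewrite gt_eqF.
  rewrite ltr_pM2l//.
  (* The summand 1 in the constant ensures [b <= (a + 1 + b) ^+ 2]. *)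
  apply: (@le_lt_trans _ _ (((a + 1 + b) * Y) ^+ 2)).
    rewrite exprMn ler_wpM2r ?sqr_ge0//.
    by have := sqr_ge0 (a + b); have := mulr_ge0 a0 a0; nra.
  rewrite ltr_pXn2r// nnegrE ?(ltW P0)// mulr_ge0 ?(ltW Y0)//.
  by rewrite !addr_ge0.
lra.
Qed.

End scalar_estimates.

(** * Mean value expansion of solutions *)

Opaque wint mass ball_bump bump_slope rhs grad.

Section averages.
Context {R : realType} {n : nat}.
Implicit Types (a b x y z : 'rV[R]_n).

Lemma is_derive_eps (f : R -> R) (x l : R) :
  (forall e, 0 < e -> exists2 d, 0 < d &
    forall t, `|t| < d -> `|f (x + t) - f x - t * l| <= e * `|t|) ->
  is_derive x 1 f l.
Proof.
move=> H.
have lim : h^-1 *: ((f \o shift x) (h *: 1) - f x) @[h --> 0^'] --> l.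
  apply/cvgrPdist_le => e e0; have [d d0 dH] := H e e0; near=> h.
  have h0 : h != 0 by near: h; exact: nbhs_dnbhs_neq.
  have hd : `|h| < d by near: h; exact: dnbhs0_lt.
  rewrite /= [h *: 1]mulr1 [h + x]addrC distrC.
  rewrite (_ : _ - l = (f (x + h) - f x - h * l) / h); last first.
    by rewrite /GRing.scale/=; field.
  by rewrite normrM normfV ler_pdivrMr ?normr_gt0// dH.
split; first by apply/cvg_ex; exists l.
exact: cvg_lim lim.
Unshelve. all: by end_near. Qed.

(** Joint continuity along the slice over [x] becomes uniform in [y] by compactness of the unit
    ball; the last hypothesis makes the integrands for [z] near [x] integrable. *)
Lemma wint_continuous (w : 'rV[R]_n -> R) (F : 'rV[R]_n -> 'rV[R]_n -> R) x :
  unit_weight w ->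
  (forall y, enorm y <= 1 ->
    {for (x, y), continuous (fun z : 'rV[R]_n * 'rV[R]_n => F z.1 z.2)}) ->
  (\forall z \near x, continuous_on_ball (F z)) ->
  {for x, continuous (fun z => wint w (F z))}.
Proof.
move=> ww cF nF.
apply/(@cvgrPdist_le _ _ _ _ (nbhs_filter x)) => e e0.
have w0 := mass_ge0 ww; pose e' := e / (mass w + 1) / 2.
have e'0 : 0 < e' by rewrite !divr_gt0// ltr_wpDl.
have /compact_near_coveringP cB := @ecball_compact R n 0 1.
have near_x : \forall z \near x, forall y, ecball 0 1 y -> `|F z y - F x y| <= 2 * e'.
  apply: (cB _ (nbhs x) (fun z y => `|F z y - F x y| <= 2 * e')) => y.
  rewrite /ecball/= subr0 => /cF /(@cvgrPdist_le _ _ _ _ (nbhs_filter _)) /(_ _ e'0).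
  move=> [[A B] /= [Ax By] AB].
  exists (B, A) => // -[y' z] /= [By' Az].
  have h1 := AB (z, y') (conj Az By').
  have h2 := AB (x, y') (conj (nbhs_singleton Ax) By').
  rewrite /= in h1 h2.
  have := ler_normB (F x y - F x y') (F x y - F z y').
  by rewrite opprB addrC addrA subrK; lra.
have cx : continuous_on_ball (F x) := nbhs_singleton nF.
apply: filterS2 nF near_x => z cz xz.
rewrite -wintB//.
apply: (le_trans (ler_norm_wint ww (c := 2 * e') _ _)).
- exact: cballB.
- by move=> y y1; rewrite distrC xz// /ecball/= subr0.
have m1 : 0 < mass w + 1 by rewrite ltr_wpDl.
rewrite (_ : 2 * e' * mass w = e * (mass w / (mass w + 1))); last first.
  by rewrite /e'; field; rewrite gt_eqF.
by rewrite ler_piMr ?(ltW e0)// ler_pdivrMr// mul1r lerDl.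
Qed.

End averages.

Section kernel_average.
Context {R : realType} {n : nat}.
Variables (p M q : R) (Omega : set 'rV[R]_n) (u : 'rV[R]_n -> R).
Hypotheses (q1 : 1 < q) (oO : open Omega)
  (pu : positive_solution p M q Omega u).
Implicit Types (a b x y z : 'rV[R]_n) (r s : R).

Local Notation f := (rhs p M q u).

Lemma in_ecball a s r y : 0 <= s -> s <= r -> enorm y <= 1 ->
  ecball a r (a + s *: y).
Proof.
move=> s0 sr y1; rewrite /ecball/=.
have -> : a + s *: y - a = s *: y by rewrite addrC addKr.
rewrite enormZ ger0_norm// -[leRHS]mulr1.
by rewrite ler_pM ?enorm_ge0.
Qed.

Lemma cball_affine (h : 'rV[R]_n -> R) a s :
  (forall y, enorm y <= 1 -> {for a + s *: y, continuous h}) ->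
  continuous_on_ball (fun y => h (a + s *: y)).
Proof.
move=> ch y /ch; exact: (continuous_comp (@affine_continuous R n a s y)).
Qed.

Lemma continuous_solution z : Omega z -> {for z, continuous u}.
Proof. by case: pu => _ [[cu _] _ _] /cu. Qed.

Lemma cball_dot_grad a s :
  (forall y, enorm y <= 1 -> Omega (a + s *: y)) ->
  continuous_on_ball (fun y => dotrV (grad u (a + s *: y)) y).
Proof.
move=> H y /H Oy; apply: dotrV_continuous; last exact: cvg_id.
exact: (continuous_comp (@affine_continuous R n a s y) (continuous_grad pu Oy)).
Qed.

(** Differentiation under the integral by the uniform expansion. The derivative is two-sided even at
    [s = 0] and [s = r], because points slightly beyond the ball still lie in [Omega]. *)
Lemma is_derive_average a r s : ecball a r `<=` Omega -> 0 <= s <= r ->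
  is_derive s 1 (fun s : R => wint bump_slope (fun y => u (a + s *: y)))
    (wint bump_slope (fun y => dotrV (grad u (a + s *: y)) y)).
Proof.
move=> aO /andP[s0 sr]; apply: is_derive_eps => e e0.
have kw := @bump_slope_weight R n; have k0 := mass_ge0 kw.
have [_ [Cu _ _]] := pu.
pose e' := e / (mass (@bump_slope R n) + 1).
have e'0 : 0 < e' by rewrite divr_gt0// ltr_wpDl.
have [d d0 dC] := C1_uniform oO Cu (@ecball_compact R n a r) aO e'0.
exists d => // t td.
have inO y : enorm y <= 1 -> [/\ Omega (a + s *: y), Omega (a + (s + t) *: y) &
    `|u (a + (s + t) *: y) - u (a + s *: y) - t * dotrV (grad u (a + s *: y)) y|
      <= e' * `|t|].
  move=> y1; have ay := in_ecball a s0 sr y1.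
  have E : a + (s + t) *: y - (a + s *: y) = t *: y.
    by rewrite scalerDl addrA [_ + t *: y]addrC addrK.
  have ty : enorm (t *: y) <= `|t| by rewrite enormZ ler_piMr.
  have yd : enorm (a + (s + t) *: y - (a + s *: y)) < d.
    by rewrite E; exact: le_lt_trans ty td.
  have [bO H _] := dC _ _ ay yd; rewrite E in H.
  split=> //; first exact: aO.
  by rewrite -dotrVZr (le_trans H)// ler_wpM2l// ltW.
have c1 : continuous_on_ball (fun y => u (a + s *: y)).
  by apply: cball_affine => y /inO[? _ _]; exact: continuous_solution.
have c2 : continuous_on_ball (fun y => u (a + (s + t) *: y)).
  by apply: cball_affine => y /inO[_ ? _]; exact: continuous_solution.
have c3 : continuous_on_ball (fun y => dotrV (grad u (a + s *: y)) y).
  by apply: cball_dot_grad => y /inO[].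
have c4 := cballM (@cball_cst _ _ t) c3.
rewrite -(wintZ kw t c3) -!wintB//; last exact: cballB.
apply: (le_trans (ler_norm_wint kw (c := e' * `|t|) _ _)).
- by apply: cballB => //; exact: cballB.
- by move=> y /inO[].
have m1 : 0 < mass (@bump_slope R n) + 1 by rewrite ltr_wpDl.
rewrite mulrAC ler_wpM2r// /e' mulrAC -mulrA ler_piMr ?(ltW e0)//.
by rewrite ler_pdivrMr// mul1r lerDl.
Qed.

(** A mean value theorem replaces the integration in the radius. Adding [c1 / 2 * f a * s ^+ 2] to
    the average leaves, by [weak_kernel_identity], the derivative [s * wint ball_bump (f a - f (a +
    s *: y))], of size at most [s * c1 * w]. *)
Lemma kernel_average a r w : 0 < r -> ecball a r `<=` Omega ->
  (forall b, ecball a r b -> `|f b - f a| <= w) ->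
  `|wint bump_slope (fun y => u (a + r *: y) - u a)
     + mass (@ball_bump R n) / 2 * f a * r ^+ 2|
  <= mass (@ball_bump R n) * w * r ^+ 2.
Proof.
move=> r0 aO fw; set c1 := mass (@ball_bump R n).
have Kw := @bump_weight R n; have kw := @bump_slope_weight R n.
have c10 : 0 <= c1 := mass_ge0 Kw.
pose m s := wint bump_slope (fun y => u (a + s *: y)).
pose dm s := wint bump_slope (fun y => dotrV (grad u (a + s *: y)) y).
pose E s := m s + c1 / 2 * f a * s ^+ 2.
pose dE s := dm s + c1 / 2 * f a * (2 * s).
have d (s : R) : 0 <= s <= r -> is_derive s 1 E (dE s).
  move=> sr; have dm1 := is_derive_average aO sr.
  apply: (@is_deriveD _ _ _ m (fun s => c1 / 2 * f a * s ^+ 2)) => //.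
  have -> : (fun s : R => c1 / 2 * f a * s ^+ 2) = horner ((c1 / 2 * f a) *: 'X^2).
    by apply/funext => t; rewrite !hornerE.
  by apply: is_derive_eq; rewrite !poly.derivE !hornerE/=; ring.
have dE0 (s : R) : s \in `]0, r[%R -> is_derive s 1 E (dE s).
  by rewrite in_itv/= => /andP[/ltW s0 /ltW sr]; apply: d; rewrite s0.
have cE : {within `[0, r], continuous E}.
  apply: derivable_within_continuous => s; rewrite in_itv/= => sr.
  exact: (@ex_derive _ _ _ _ _ _ _ (d s sr)).
have [s] := MVT r0 dE0 cE.
rewrite in_itv/= subr0 => /andP[s0 sr] EE.
have asO : ecball a s `<=` Omega.
  by move=> b ab; apply: aO; rewrite /ecball/= (le_trans ab)// ltW.
have inO t y : 0 <= t -> t <= r -> enorm y <= 1 -> Omega (a + t *: y).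
  by move=> t0 tr y1; apply: aO; exact: in_ecball.
have Oa : Omega a by apply: aO; rewrite /ecball/= subrr enorm0 ltW.
have cfs : continuous_on_ball (fun y => f (a + s *: y)).
  apply: cball_affine => y /(inO s y (ltW s0) (ltW sr)).
  exact: (continuous_rhs q1 pu).
have dEs : dE s = s * wint ball_bump (fun y => f a - f (a + s *: y)).
  rewrite /dE /dm (weak_kernel_identity q1 pu s0 asO).
  have -> : wint ball_bump (fun y => f a - f (a + s *: y)) =
      f a * c1 - wint ball_bump (fun y => f (a + s *: y)).
    exact: (etrans (wintB Kw (@cball_cst _ _ (f a)) cfs)
      (congr1 (fun t => t - _) (wint_cst Kw (f a)))).
  by field.
have E0 : E 0 = u a * mass (@bump_slope R n).
  rewrite /E expr0n/= mulr0 addr0 /m -(wint_cst kw (u a)).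
  by apply: eq_wint => // y _; rewrite scale0r addr0.
have cur : continuous_on_ball (fun y => u (a + r *: y)).
  apply: cball_affine => y /(inO r y (ltW r0) (lexx _)).
  exact: continuous_solution.
rewrite (@wintB _ _ _ kw (fun y => u (a + r *: y)) (fun=> u a) cur (@cball_cst _ _ _)).
rewrite (wint_cst kw (u a)) -E0.
rewrite -/(m r) addrAC -/(E r).
rewrite EE dEs !normrM (gtr0_norm s0) (gtr0_norm r0) expr2 mulrA.
rewrite ler_wpM2r ?(ltW r0)// mulrC ler_pM ?(ltW s0) ?(ltW sr)//.
rewrite mulrC; apply: (ler_norm_wint Kw).
  exact: (cballB (@cball_cst _ _ _) cfs).
move=> y y1; rewrite distrC; apply: fw.
exact: in_ecball (ltW s0) (ltW sr) y1.
Qed.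

End kernel_average.

(** * Moments of the slope weight in invariant form *)

Section slope_moments.
Context {R : realType} {n : nat}.
Implicit Types (v x y : 'rV[R]_n).
Local Notation c1 := (mass (@ball_bump R n)).
Let kw := @bump_slope_weight R n.

Lemma cball_coord i : continuous_on_ball (fun y : 'rV[R]_n => y 0 i).
Proof. by move=> y _; exact: coord_continuous. Qed.

Lemma cball_dot v : continuous_on_ball (fun y => dotrV v y).
Proof.
move=> y _; apply: dotrV_continuous; last exact: cvg_id.
exact: cst_continuous.
Qed.

Lemma wint_slope_dot v : wint bump_slope (fun y => dotrV v y) = 0.
Proof.
rewrite /dotrV (wint_sum kw) => [|i].
  apply: big1 => i _; rewrite (wintZ kw); last exact: cball_coord.
  by rewrite bump_slope_coord mulr0.
exact: (cballM (@cball_cst _ _ _) (@cball_coord i)).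
Qed.

Lemma wint_slope_dot_sq v :
  wint bump_slope (fun y => dotrV v y ^+ 2) = c1 * dotrV v v.
Proof.
have E y : dotrV v y ^+ 2 =
    \sum_(i < n) \sum_(j < n) (v 0 i * v 0 j) * (y 0 i * y 0 j).
  rewrite expr2 /dotrV mulr_suml; apply: eq_bigr => i _.
  by rewrite mulr_sumr; apply: eq_bigr => j _; ring.
have cij i j : continuous_on_ball (fun y : 'rV[R]_n => y 0 i * y 0 j).
  exact: (cballM (@cball_coord i) (@cball_coord j)).
have cvij i j : continuous_on_ball (fun y => (v 0 i * v 0 j) * (y 0 i * y 0 j)).
  exact: (cballM (@cball_cst _ _ _) (cij i j)).
have csum i : continuous_on_ball (fun y => \sum_(j < n) (v 0 i * v 0 j) * (y 0 i * y 0 j)).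
  exact: cball_sum.
rewrite (eq_wint kw (fun y _ => E y)) (wint_sum kw)// /dotrV mulr_sumr.
apply: eq_bigr => i _; rewrite (wint_sum kw)// (bigD1 i)//= big1 ?addr0.
  by rewrite (wintZ kw)// bump_slope_coord2 eqxx mul1r mulrC.
move=> j ji; rewrite (wintZ kw)// bump_slope_coord2 eq_sym (negbTE ji).
by rewrite mul0r mulr0.
Qed.

Lemma wint_slope_norm : wint bump_slope (fun y => dotrV y y) = n%:R * c1.
Proof.
rewrite /dotrV (wint_sum kw) => [|i]; last exact: (cballM (@cball_coord i) (@cball_coord i)).
under eq_bigr do rewrite bump_slope_coord2 eqxx mul1r.
by rewrite sumr_const card_ord mulr_natl.
Qed.

End slope_moments.

Lemma compact_modulus {R : realType} {n : nat} (Omega K : set 'rV[R]_n)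
    (u f : 'rV[R]_n -> R) (s : R) :
  open Omega -> Ck 1 Omega u -> (forall z, Omega z -> {for z, continuous f}) ->
  compact K -> K `<=` Omega -> 0 < s -> exists2 d, 0 < d &
  forall a b, K a -> enorm (b - a) < d ->
  [/\ Omega b, `|u b - u a - dotrV (grad u a) (b - a)| <= s * enorm (b - a),
      enorm (grad u b - grad u a) <= s & `|f b - f a| <= s].
Proof.
move=> oO Cu cf cK KO s0.
have [d1 d10 H1] := C1_uniform oO Cu cK KO s0.
have loc a : K a -> exists2 d, 0 < d & forall x y,
    enorm (x - a) < d -> enorm (y - a) < d -> `|f y - f x| <= s.
  move=> /KO Oa; have s2 : 0 < s / 2 by exact: divr_gt0.
  have /continuous_enormP/(_ _ s2)[d d0 fd] := cf a Oa.
  exists d => // x y /fd xa /fd ya.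
  have := ler_normB (f y - f a) (f x - f a).
  by rewrite opprB addrA subrK; lra.
have [d2 d20 H2] := compact_uniform cK loc.
exists (Num.min d1 d2) => [|a b Ka]; first by rewrite lt_min d10.
rewrite lt_min => /andP[ba1 ba2]; have [? ? ?] := H1 a b Ka ba1.
by split=> //; exact: H2.
Qed.

Lemma compact_bound {R : realType} {n : nat} (Omega K : set 'rV[R]_n)
    (u : 'rV[R]_n -> R) (g : 'rV[R]_n -> 'rV[R]_n) :
  (forall z, Omega z -> {for z, continuous u}) ->
  (forall z, Omega z -> {for z, continuous g}) ->
  compact K -> K `<=` Omega ->
  exists2 L, 0 < L & forall a, K a -> `|u a| <= L /\ enorm (g a) <= L.
Proof.
move=> cu cg cK KO.
have bnd (h : 'rV[R]_n -> R) : (forall z, Omega z -> {for z, continuous h}) ->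
    exists L, forall a, K a -> `|h a| <= L.
  move=> ch; have chK : {within K, continuous h}.
    by apply: continuous_in_subspaceT => z /set_mem /KO; exact: ch.
  have [B [_ HB]] := compact_bounded (continuous_compact chK cK).
  exists (`|B| + 1) => a Ka; apply: HB; last by exists a.
  by rewrite (le_lt_trans (ler_norm _))// ltrDl.
have [L1 H1] := bnd u cu.
have [|L2 H2] := bnd (fun z => enorm (g z)).
  move=> z /cg cgz.
  rewrite (_ : (fun z => enorm (g z)) = (fun z => enorm (z - 0)) \o g).
    exact: (continuous_comp cgz (@enormB_continuous R n 0 (g z))).
  by apply/funext => y /=; rewrite subr0.
exists (`|L1| + `|L2| + 1) => [|a Ka]; first by rewrite ltr_wpDl// addr_ge0.
have := H1 a Ka; have := H2 a Ka; rewrite (ger0_norm (enorm_ge0 _)).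
have := ler_norm L1; have := ler_norm L2.
by have := normr_ge0 L1; have := normr_ge0 L2; split; lra.
Qed.

(** * The Bernstein argument *)

Section bernstein.
Context {R : realType} {n : nat}.
(** The kernel is abstract: only its three moment identities are kept. [f] and [g] stand for the
    right-hand side and the gradient, tied to [u] by [average], [slope] and the common modulus; the
    explicit form of [f] enters at [source_le]. *)
Variables (k : 'rV[R]_n -> R) (c1 : R).
Hypotheses (kw : unit_weight k) (c10 : 0 < c1)
  (k_dot : forall v, wint k (fun y => dotrV v y) = 0)
  (k_dot_sq : forall v, wint k (fun y => dotrV v y ^+ 2) = c1 * dotrV v v)
  (k_norm : wint k (fun y => dotrV y y) = n%:R * c1).
Variables (Omega : set 'rV[R]_n) (u f : 'rV[R]_n -> R) (g : 'rV[R]_n -> 'rV[R]_n).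
Hypotheses (oO : open Omega)
  (cu : forall z, Omega z -> {for z, continuous u})
  (cf : forall z, Omega z -> {for z, continuous f})
  (cg : forall z, Omega z -> {for z, continuous g})
  (average : forall a r w, 0 < r -> ecball a r `<=` Omega ->
    (forall b, ecball a r b -> `|f b - f a| <= w) ->
    `|wint k (fun y => u (a + r *: y) - u a) + c1 / 2 * f a * r ^+ 2|
      <= c1 * w * r ^+ 2)
  (slope : forall a r w, 0 < r -> ecball a r `<=` Omega ->
    (forall b, ecball a r b -> `|f b - f a| <= w) ->
    wint k (fun y => dotrV (g (a + r *: y)) y) <= - r * (c1 * (f a - w))).
Variables (x1 : 'rV[R]_n) (rho L : R).
Hypotheses (rho0 : 0 < rho) (inO : ecball x1 (2 * rho) `<=` Omega)
  (L0 : 0 < L)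
  (uL : forall a, ecball x1 (2 * rho) a -> `|u a| <= L)
  (gL : forall a, ecball x1 (2 * rho) a -> enorm (g a) <= L)
  (modulus : forall s, 0 < s -> exists2 d, 0 < d &
    forall a b, ecball x1 (2 * rho) a -> enorm (b - a) < d ->
    [/\ Omega b, `|u b - u a - dotrV (g a) (b - a)| <= s * enorm (b - a),
      enorm (g b - g a) <= s & `|f b - f a| <= s]).
Implicit Types (a b x y z h e : 'rV[R]_n) (r s : R).

(** * The discrete Bochner inequality at a fixed scale *)

Section fixed_scale.
Variable eps : R.
Hypotheses (eps0 : 0 < eps) (eps_rho : eps <= rho / 2).

Definition incr h x := u (x + eps *: h) - u x.
Definition gincr h x := g (x + eps *: h) - g x.
Definition energy x := wint k (fun h => incr h x ^+ 2).
Definition gincr_energy x := wint k (fun h => dotrV (gincr h x) (gincr h x)).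
(** Divided by [eps ^+ 2 * c1], for smooth [u] and small [eps], [energy], [gincr_energy] and
    [source] approximate [|grad u|^2], [|D^2 u|^2] and [grad u . grad f]. Since [Delta u = - f],
    Bochner's formula says that half the Laplacian of the first is the second minus the third. *)
Definition source x := wint k (fun h => incr h x * (f (x + eps *: h) - f x)).

Lemma shift_in r x y : enorm (x - x1) < 3 / 2 * rho -> enorm y <= 1 ->
  0 <= r -> r <= rho / 2 -> ecball x1 (2 * rho) (x + r *: y).
Proof.
move=> xx y1 r0 rr; have := in_ecball x r0 rr y1; rewrite /ecball/= => xy.
by have := ler_enorm_dist (x + r *: y) x x1; lra.
Qed.

Lemma self_in x : enorm (x - x1) < 3 / 2 * rho -> ecball x1 (2 * rho) x.
Proof. by move=> xx; rewrite /ecball/=; have := rho0; lra. Qed.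

Lemma joint_continuous (c : 'rV[R]_n) s r x y : Omega (c + s *: x + r *: y) ->
  {for (x, y), continuous (fun z : 'rV[R]_n * 'rV[R]_n => u (c + s *: z.1 + r *: z.2))}.
Proof.
move=> Oc.
have h1 : {for (x, y), continuous (fun z : 'rV[R]_n * 'rV[R]_n => c + s *: z.1)}.
  exact: (@continuous_comp _ _ _ fst _ (x, y) cvg_fst (@affine_continuous R n c s x)).
have h2 : {for (x, y), continuous (fun z : 'rV[R]_n * 'rV[R]_n => r *: z.2)}.
  exact: (@continuous_comp _ _ _ snd _ (x, y) cvg_snd (@scaler_continuous _ _ r y)).
have cmap : {for (x, y), continuous
    (fun z : 'rV[R]_n * 'rV[R]_n => c + s *: z.1 + r *: z.2)}.
  exact: (cvgD h1 h2).
exact: (@continuous_comp _ _ _ (fun z : 'rV[R]_n * 'rV[R]_n => c + s *: z.1 + r *: z.2)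
  u (x, y) cmap (cu Oc)).
Qed.

Lemma incr_continuous2 x r h y :
  enorm (x - x1) + eps * enorm h + r * enorm y <= 2 * rho -> 0 <= r ->
  {for (h, y), continuous (fun z : 'rV[R]_n * 'rV[R]_n => incr z.1 (x + r *: z.2))}.
Proof.
move=> xhy r0.
have ry : enorm (r *: y) = r * enorm y by rewrite enormZ ger0_norm.
have eh : enorm (eps *: h) = eps * enorm h by rewrite enormZ gtr0_norm.
have O1 : Omega (x + eps *: h + r *: y).
  apply: inO; rewrite /ecball/=.
  have -> : x + eps *: h + r *: y - x1 = (x - x1) + (eps *: h + r *: y).
    by rewrite addrA (addrAC x (- x1)) (addrAC _ (- x1)).
  have := ler_enormD (x - x1) (eps *: h + r *: y).
  by have := ler_enormD (eps *: h) (r *: y); rewrite ry eh; lra.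
have O2 : Omega (x + 0 *: h + r *: y).
  rewrite scale0r addr0; apply: inO; rewrite /ecball/= addrAC.
  have eh0 : 0 <= eps * enorm h by rewrite mulr_ge0 ?(ltW eps0)// enorm_ge0.
  by have := ler_enormD (x - x1) (r *: y); rewrite ry; lra.
have := contB (joint_continuous O1) (joint_continuous O2).
rewrite (_ : (fun z : 'rV[R]_n * 'rV[R]_n => u (x + eps *: z.1 + r *: z.2)
    - u (x + 0 *: z.1 + r *: z.2)) =
    (fun z : 'rV[R]_n * 'rV[R]_n => incr z.1 (x + r *: z.2)))//.
by apply/funext => z; rewrite /incr scale0r addr0 addrAC.
Qed.

Lemma incr_continuous x h : enorm (x - x1) < 3 / 2 * rho -> enorm h <= 1 ->
  {for (x, h), continuous (fun z : 'rV[R]_n * 'rV[R]_n => incr z.2 z.1)}.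
Proof.
move=> xx h1.
have O1 : Omega (0 + 1 *: x + eps *: h).
  by rewrite scale1r add0r; apply: inO; apply: shift_in => //; exact: ltW.
have O2 : Omega (0 + 1 *: x + 0 *: h).
  by rewrite scale1r scale0r add0r addr0; apply: inO; exact: self_in.
have := contB (joint_continuous O1) (joint_continuous O2).
rewrite (_ : (fun z : 'rV[R]_n * 'rV[R]_n => u (0 + 1 *: z.1 + eps *: z.2)
    - u (0 + 1 *: z.1 + 0 *: z.2)) = (fun z : 'rV[R]_n * 'rV[R]_n => incr z.2 z.1))//.
by apply/funext => z; rewrite /incr scale1r scale0r add0r addr0.
Qed.

Lemma cball_incr x : enorm (x - x1) < 3 / 2 * rho ->
  continuous_on_ball (fun h => incr h x).
Proof.
move=> xx h h1; have := incr_continuous xx h1.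
exact: (@continuous_comp _ _ _ (fun h => (x, h))
  (fun z : 'rV[R]_n * 'rV[R]_n => incr z.2 z.1) h
  (cvg_pair (@cst_continuous _ _ x h) (@cvg_id _ (nbhs h)))).
Qed.

Lemma gincr_continuous x h : enorm (x - x1) < 3 / 2 * rho -> enorm h <= 1 ->
  {for h, continuous (fun h => gincr h x)}.
Proof.
move=> xx h1; have cga := continuous_comp (@affine_continuous R n x eps h)
  (cg (inO (shift_in xx h1 (ltW eps0) eps_rho))).
exact: (cvgB cga (@cst_continuous _ _ (g x) h)).
Qed.

Lemma energy_continuous x : enorm (x - x1) < 3 / 2 * rho ->
  {for x, continuous energy}.
Proof.
move=> xx; apply: (wint_continuous (F := fun x h => incr h x ^+ 2) kw).
  move=> y y1; exact: (contX (k := 2) (incr_continuous xx y1)).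
apply/nbhs_enormP; exists (3 / 2 * rho - enorm (x - x1)); first by rewrite subr_gt0.
move=> z zx; apply: cballX; apply: cball_incr.
by have := ler_enorm_dist z x x1; lra.
Qed.

Lemma incr_bound x h : enorm (x - x1) < 3 / 2 * rho -> enorm h <= 1 ->
  `|incr h x| <= 2 * L.
Proof.
move=> xx h1; rewrite /incr (le_trans (ler_normB _ _))//.
have := uL (shift_in xx h1 (ltW eps0) eps_rho); have := uL (self_in xx); lra.
Qed.

Lemma in_range x r h y : enorm (x - x1) <= rho -> enorm h <= 1 ->
  enorm y <= 1 -> 0 <= r -> r < rho / 2 ->
  enorm (x - x1) + eps * enorm h + r * enorm y <= 2 * rho.
Proof.
move=> xx h1 y1 r0 rr.
have := ler_wpM2l (ltW eps0) h1; have := ler_wpM2l r0 y1.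
by have := eps_rho; rewrite !mulr1; lra.
Qed.

Lemma energy_fubini x r : enorm (x - x1) <= rho -> 0 <= r -> r < rho / 2 ->
  wint k (fun y => energy (x + r *: y)) =
  wint k (fun h => wint k (fun y => incr h (x + r *: y) ^+ 2)).
Proof.
move=> xx r0 rr; rewrite /energy.
apply: (wint_fubini kw (F := fun h y => incr h (x + r *: y) ^+ 2)).
  move=> h y h1 y1; apply: (contX (k := 2)); apply: incr_continuous2 => //.
  exact: in_range.
by move=> h y; exact: sqr_ge0.
Qed.

(** Averaged form of [(V + D)^2 - V^2 = 2 V D + D^2]: [P] and [Q] are the k-averages of [D] and
    [D^2], and [dF] is the increment of [f]. *)
Lemma lower_bound_algebra (V P Q dF G2 c0 s r : R) :
  0 <= s -> `|V| <= 2 * L -> `|P + c1 / 2 * dF * r ^+ 2| <= 2 * c1 * s * r ^+ 2 ->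
  r ^+ 2 * (c1 * G2) - 8 * L * s * r ^+ 2 * c0 <= Q ->
  r ^+ 2 * (c1 * (G2 - V * dF) - s * (8 * L * c1 + 8 * L * c0)) <= 2 * (V * P) + Q.
Proof.
move=> s0 VL; set X := P + _ => XP QP.
have VX : - (2 * L * (2 * c1 * s * r ^+ 2)) <= V * X.
  by rewrite lerNl (le_trans (ler_norm _))// normrN normrM ler_pM.
have -> : 2 * (V * P) = 2 * (V * X) - c1 * dF * r ^+ 2 * V by rewrite /X; field.
lra.
Qed.

Lemma shift_shift (x y : 'rV[R]_n) r h : x + r *: y + eps *: h = (x + eps *: h) + r *: y.
Proof. by rewrite addrAC. Qed.

(** The Bochner inequality for one fixed [h]. The variation of [incr h] around [x] is a difference
    of variations of [u] at the centres [x + eps *: h] and [x]: [average] at both gives its mean,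
    and its linear part [r * dotrV (gincr h x) y] gives the mean of its square. *)
Lemma incr_average x h r s d : enorm (x - x1) <= rho -> enorm h <= 1 ->
  0 < s -> 0 < r -> r < d -> r < rho / 2 ->
  (forall a b, ecball x1 (2 * rho) a -> enorm (b - a) < d ->
    [/\ Omega b, `|u b - u a - dotrV (g a) (b - a)| <= s * enorm (b - a),
      enorm (g b - g a) <= s & `|f b - f a| <= s]) ->
  r ^+ 2 * (c1 * (dotrV (gincr h x) (gincr h x)
      - incr h x * (f (x + eps *: h) - f x)) - s * (8 * L * c1 + 8 * L * mass k))
  <= wint k (fun y => incr h (x + r *: y) ^+ 2) - incr h x ^+ 2 * mass k.
Proof.
move=> xx h1 s0 r0 rd rr mod_d; set a := x + eps *: h.
have rho_gt0 := rho0; have eps_gt0 := eps0; have eps_le := eps_rho.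
have xx' : enorm (x - x1) < 3 / 2 * rho by lra.
have xK := self_in xx'; have aK : ecball x1 (2 * rho) a by exact: shift_in (ltW _) _.
have near_ball b z : ecball x1 (2 * rho) b -> ecball b r z -> enorm (z - b) < d.
  by move=> _ zb; exact: le_lt_trans zb rd.
have ball_in b : ecball x1 (2 * rho) b -> ecball b r `<=` Omega.
  by move=> bK z /(near_ball _ _ bK) zb; have [] := mod_d _ _ bK zb.
have osc b : ecball x1 (2 * rho) b -> forall z, ecball b r z -> `|f z - f b| <= s.
  by move=> bK z /(near_ball _ _ bK) zb; have [] := mod_d _ _ bK zb.
have expand b y : ecball x1 (2 * rho) b -> enorm y <= 1 ->
    `|u (b + r *: y) - u b - r * dotrV (g b) y| <= s * r.
  move=> bK y1; have yb := in_ecball b (ltW r0) (lexx r) y1.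
  have [_ + _ _] := mod_d _ _ bK (near_ball _ _ bK yb).
  have -> : b + r *: y - b = r *: y by rewrite addrC addKr.
  rewrite dotrVZr => /le_trans; apply; rewrite ler_wpM2l ?(ltW s0)//.
  by rewrite enormZ gtr0_norm// ler_piMr// ltW.
have cball_u b : ecball x1 (2 * rho) b ->
    continuous_on_ball (fun y => u (b + r *: y) - u b).
  move=> bK; apply: cballB; last exact: cball_cst.
  apply: cball_affine => y y1; apply: cu; apply: (ball_in b bK).
  exact: in_ecball (ltW r0) (lexx r) y1.
pose A b y := u (b + r *: y) - u b.
pose D y := A a y - A x y; pose V := incr h x.
have cD : continuous_on_ball D by exact: cballB (cball_u a aK) (cball_u x xK).
have VD y : incr h (x + r *: y) = V + D y.
  by rewrite /D /A /V /incr shift_shift -/a; ring.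
have cD2 : continuous_on_ball (fun y => D y ^+ 2) by exact: cballX.
have -> : wint k (fun y => incr h (x + r *: y) ^+ 2) - incr h x ^+ 2 * mass k =
    2 * (V * wint k D) + wint k (fun y => D y ^+ 2).
  have -> : wint k (fun y => incr h (x + r *: y) ^+ 2) =
      wint k (fun y => (V ^+ 2 + 2 * V * D y) + D y ^+ 2).
    by apply: (eq_wint kw) => y _; rewrite VD; ring.
  have cVD := cballM (@cball_cst _ _ (2 * V)) cD.
  rewrite (wintD kw (cballD (@cball_cst _ _ (V ^+ 2)) cVD) cD2).
  rewrite (wintD kw (@cball_cst _ _ (V ^+ 2)) cVD) (wint_cst kw (V ^+ 2)).
  by rewrite (wintZ kw (2 * V) cD) -/V; ring.
have avg b (bK : ecball x1 (2 * rho) b) := average r0 (ball_in b bK) (osc b bK).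
apply: lower_bound_algebra; [exact: ltW|exact: incr_bound| |].
  have Ha : `|wint k (A a) + c1 / 2 * f a * r ^+ 2| <= c1 * s * r ^+ 2 := avg a aK.
  have Hx : `|wint k (A x) + c1 / 2 * f x * r ^+ 2| <= c1 * s * r ^+ 2 := avg x xK.
  have -> : wint k D = wint k (A a) - wint k (A x).
    exact: (wintB kw (cball_u a aK) (cball_u x xK)).
  move: (wint k (A a)) (wint k (A x)) (f a) (f x) Ha Hx => Pa Px fa fx Ha Hx.
  rewrite [X in `|X|](_ : _ =
    (Pa + c1 / 2 * fa * r ^+ 2) - (Px + c1 / 2 * fx * r ^+ 2)); last by field.
  by rewrite (le_trans (ler_normB _ _))//; lra.
pose G := gincr h x.
have G2L : enorm G <= 2 * L.
  have := ler_enormB (g a) (g x); have := gL aK; have := gL xK.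
  by rewrite /G /gincr -/a; lra.
(* The linear part is at most [2 * L * r] and the remainder at most [2 * s * r], so the cross term
   costs at most [8 * L * s * r ^+ 2]. *)
have pointwise y : enorm y <= 1 ->
    r ^+ 2 * dotrV G y ^+ 2 - 8 * L * s * r ^+ 2 <= D y ^+ 2.
  move=> y1; have Ea := expand a y aK y1; have Ex := expand x y xK y1.
  have Gy : `|dotrV G y| <= 2 * L.
    rewrite (le_trans (ler_dotrV _ _))// -[leRHS]mulr1.
    by rewrite ler_pM ?enorm_ge0.
  have GE : dotrV G y = dotrV (g a) y - dotrV (g x) y by rewrite -dotrVBl.
  pose de := D y - r * dotrV G y.
  have deE : `|de| <= 2 * (s * r).
    rewrite (_ : de = (u (a + r *: y) - u a - r * dotrV (g a) y) -
        (u (x + r *: y) - u x - r * dotrV (g x) y)); last first.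
      by rewrite /de /D /A GE; ring.
    by rewrite (le_trans (ler_normB _ _))//; lra.
  have -> : D y = r * dotrV G y + de by rewrite /de; ring.
  move: (dotrV G y) de deE Gy => t de deE Gy.
  have : - (2 * L * (2 * (s * r))) <= t * de.
    by rewrite lerNl (le_trans (ler_norm _))// normrN normrM ler_pM.
  move=> /(ler_wpM2l (ltW r0)); have := sqr_ge0 de; nra.
have cG : continuous_on_ball (fun y => r ^+ 2 * dotrV G y ^+ 2).
  exact: (cballM (@cball_cst _ _ (r ^+ 2)) (@cballX _ _ _ 2 (@cball_dot _ _ G))).
have := le_wint kw (cballB cG (@cball_cst _ _ (8 * L * s * r ^+ 2))) cD2 pointwise.
rewrite (wintB kw cG (@cball_cst _ _ (8 * L * s * r ^+ 2))).
rewrite (wint_cst kw (8 * L * s * r ^+ 2)).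
by rewrite (wintZ kw (r ^+ 2) (@cballX _ _ _ 2 (@cball_dot _ _ G))) k_dot_sq.
Qed.

Lemma div_succ_le (a b : R) : 0 <= a -> 0 <= b -> b / (a + 1) * a <= b.
Proof.
move=> a0 b0; rewrite mulrAC -mulrA ler_piMr//.
by rewrite ler_pdivrMr ?mul1r ?lerDl// ltr_wpDl.
Qed.

(** [incr_average] integrated in [h], after exchanging the integrals in [h] and [y]; [s] is chosen
    so that the accumulated error stays below [kap]. *)
Lemma energy_lower x kap : enorm (x - x1) <= rho -> 0 < kap ->
  exists2 r0, 0 < r0 & forall r, 0 < r -> r < r0 ->
  r ^+ 2 * (c1 * (gincr_energy x - source x) - kap) <=
  wint k (fun y => energy (x + r *: y) - energy x).
Proof.
move=> xx kap0; have k0 := mass_ge0 kw.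
pose Cs := 8 * L * c1 + 8 * L * mass k.
have Cs0 : 0 <= Cs by rewrite addr_ge0// !mulr_ge0// ltW.
have CsK : 0 <= Cs * mass k by exact: mulr_ge0.
pose s := kap / (Cs * mass k + 1).
have s0 : 0 < s by rewrite divr_gt0// ltr_wpDl.
have [d d0 mod_d] := modulus s0.
have rho2 : 0 < rho / 2 by exact: divr_gt0.
exists (Num.min d (rho / 2)); first by rewrite lt_min d0.
move=> r r0; rewrite lt_min => /andP[rd rr].
have rho_gt0 := rho0; have eps_gt0 := eps0; have eps_le := eps_rho.
have xx' : enorm (x - x1) < 3 / 2 * rho by lra.
pose V h := incr h x; pose G h := gincr h x; pose dF h := f (x + eps *: h) - f x.
have cV : continuous_on_ball V by exact: cball_incr.
have cG h : enorm h <= 1 -> {for h, continuous G} by exact: gincr_continuous.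
have cdF : continuous_on_ball dF.
  apply: cballB; last exact: cball_cst.
  apply: cball_affine => h h1; apply: cf; apply: inO.
  exact: shift_in (ltW _) _.
have cGG : continuous_on_ball (fun h => dotrV (G h) (G h)).
  by move=> h h1; exact: dotrV_continuous (cG h h1) (cG h h1).
have cVF := cballM cV cdF.
pose low h := r ^+ 2 * (c1 * (dotrV (G h) (G h) - V h * dF h) - s * Cs).
pose Y h := wint k (fun y => incr h (x + r *: y) ^+ 2).
have cY : continuous_on_ball Y.
  move=> h h1; apply: (wint_continuous (F := fun h y => incr h (x + r *: y) ^+ 2) kw).
    move=> y y1; apply: (contX (k := 2)); apply: incr_continuous2; last exact: ltW.
    by apply: in_range => //; exact: ltW.
  (* Continuity at the points of the unit sphere requires [h'] slightly outside the ball; the room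
     left by [r < rho / 2] keeps the shifted points in the ball of radius [2 * rho]. *)
  have slack : 0 < (rho / 2 - r) / eps by rewrite divr_gt0// subr_gt0.
  apply/nbhs_enormP; exists ((rho / 2 - r) / eps) => // h' hh'.
  apply: cballX => y y1.
  have cpair := @incr_continuous2 x r h' y.
  have rng : enorm (x - x1) + eps * enorm h' + r * enorm y <= 2 * rho.
    have e1 : eps * enorm (h' - h) < rho / 2 - r.
      by rewrite mulrC -ltr_pdivlMr.
    have := ler_wpM2l (ltW eps0) (ler_enormD (h' - h) h); rewrite subrK mulrDr.
    have := ler_wpM2l (ltW eps0) h1; have := ler_wpM2l (ltW r0) y1.
    by rewrite !mulr1; lra.
  exact: (@continuous_comp _ _ _ (fun y => (h', y))
    (fun z : 'rV[R]_n * 'rV[R]_n => incr z.1 (x + r *: z.2)) y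
    (cvg_pair (@cst_continuous _ _ h' y) (@cvg_id _ (nbhs y))) (cpair rng (ltW r0))).
have cE : continuous_on_ball (fun y => energy (x + r *: y)).
  apply: cball_affine => y y1; apply: energy_continuous.
  have := in_ecball x (ltW r0) (lexx r) y1; rewrite /ecball/=.
  by have := ler_enorm_dist (x + r *: y) x x1; lra.
have clow : continuous_on_ball low.
  apply: (cballM (@cball_cst _ _ (r ^+ 2))); apply: (cballB _ (@cball_cst _ _ (s * Cs))).
  exact: (cballM (@cball_cst _ _ c1) (cballB cGG cVF)).
have cV2 := cballX (k := 2) cV.
have -> : wint k (fun y => energy (x + r *: y) - energy x) =
    wint k (fun h => Y h - mass k * V h ^+ 2).
  rewrite (wintB kw cE (@cball_cst _ _ (energy x))) (wint_cst kw (energy x)).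
  rewrite (wintB kw cY (cballM (@cball_cst _ _ (mass k)) cV2)).
  rewrite (wintZ kw (mass k) cV2) energy_fubini//; last exact: ltW.
  by rewrite [energy x * _]mulrC.
apply: (@le_trans _ _ (wint k low)); last first.
  apply: le_wint => //; first exact: cballB cY (cballM (@cball_cst _ _ (mass k)) cV2).
  move=> h h1; rewrite [mass k * _]mulrC.
  exact: incr_average mod_d.
have cin := cballB cGG cVF.
rewrite (wintZ kw (r ^+ 2) (cballB (cballM (@cball_cst _ _ c1) cin) (@cball_cst _ _ (s * Cs)))).
rewrite (wintB kw (cballM (@cball_cst _ _ c1) cin) (@cball_cst _ _ (s * Cs))).
rewrite (wintZ kw c1 cin) (wintB kw cGG cVF) (wint_cst kw (s * Cs)).
rewrite ler_wpM2l ?sqr_ge0// lerD2l lerN2 -mulrA.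
by apply: div_succ_le => //; exact: ltW.
Qed.

(** A lower bound is enough at a maximum, so the square of the variation of [incr h] is simply
    dropped. *)
Lemma energy_first_order x e kap : enorm (x - x1) <= rho -> 0 < kap ->
  exists2 r0, 0 < r0 & forall r, 0 < r -> r < r0 ->
  r * (2 * wint k (fun h => incr h x * dotrV (gincr h x) e) - kap) <=
  energy (x + r *: e) - energy x.
Proof.
move=> xx kap0; have k0 := mass_ge0 kw; have e0 := enorm_ge0 e.
pose Cs := 8 * L * enorm e * mass k.
have Cs0 : 0 <= Cs by rewrite !mulr_ge0// ltW.
pose s := kap / (Cs + 1).
have s0 : 0 < s by rewrite divr_gt0// ltr_wpDl.
have [d d0 mod_d] := modulus s0.
have rho2 : 0 < rho / 2 by exact: divr_gt0.
have e1 : 0 < enorm e + 1 by rewrite ltr_wpDl.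
exists (Num.min d (rho / 2) / (enorm e + 1)); first by rewrite divr_gt0// lt_min d0.
move=> r r0; rewrite ltr_pdivlMr// lt_min => /andP[rd rr].
have rho_gt0 := rho0; have eps_gt0 := eps0; have eps_le := eps_rho.
have xx' : enorm (x - x1) < 3 / 2 * rho by lra.
have re : enorm (r *: e) = r * enorm e by rewrite enormZ gtr0_norm.
have re1 : r * enorm e <= r * (enorm e + 1) by rewrite ler_wpM2l ?(ltW r0)// lerDl.
have xe : enorm (x + r *: e - x1) < 3 / 2 * rho.
  by rewrite addrAC; have := ler_enormD (x - x1) (r *: e); rewrite re; lra.
pose V h := incr h x; pose G h := gincr h x.
have cV : continuous_on_ball V by exact: cball_incr.
have cV' : continuous_on_ball (fun h => incr h (x + r *: e)) by exact: cball_incr.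
have cGe : continuous_on_ball (fun h => dotrV (G h) e).
  move=> h h1; apply: dotrV_continuous; first exact: gincr_continuous.
  exact: cst_continuous.
have expand b : ecball x1 (2 * rho) b ->
    `|u (b + r *: e) - u b - r * dotrV (g b) e| <= s * (r * enorm e).
  move=> bK; have := mod_d b (b + r *: e) bK.
  have -> : b + r *: e - b = r *: e by rewrite addrC addKr.
  by rewrite re dotrVZr => -[|_ + _ _]; first exact: le_lt_trans rd.
have cVGe := cballM cV cGe.
have clow := cballB (cballM (@cball_cst _ _ (2 * r)) cVGe)
  (@cball_cst _ _ (8 * L * s * (r * enorm e))).
have := le_wint kw clow (cballB (cballX (k := 2) cV') (cballX (k := 2) cV)).
rewrite (wintB kw (cballX (k := 2) cV') (cballX (k := 2) cV)).
rewrite (wintB kw (cballM (@cball_cst _ _ (2 * r)) cVGe)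
  (@cball_cst _ _ (8 * L * s * (r * enorm e)))).
rewrite (wintZ kw (2 * r) cVGe) (wint_cst kw (8 * L * s * (r * enorm e))).
move=> H; apply: le_trans (H _).
  rewrite mulrBr mulrCA -mulrA lerD2l lerN2.
  rewrite [leLHS](_ : _ = r * (s * Cs)); last by rewrite /Cs; ring.
  rewrite ler_wpM2l ?(ltW r0)//.
  by apply: div_succ_le => //; exact: ltW.
move=> h h1; have xK := self_in xx'.
have aK : ecball x1 (2 * rho) (x + eps *: h) by exact: shift_in (ltW _) _.
have Ea := expand _ aK; have Ex := expand _ xK.
have VL : `|V h| <= 2 * L by exact: incr_bound.
pose D := incr h (x + r *: e) - V h.
have GE : dotrV (G h) e = dotrV (g (x + eps *: h)) e - dotrV (g x) e.
  by rewrite -dotrVBl.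
pose de := D - r * dotrV (G h) e.
have deE : `|de| <= 2 * (s * (r * enorm e)).
  rewrite (_ : de = (u (x + eps *: h + r *: e) - u (x + eps *: h)
      - r * dotrV (g (x + eps *: h)) e) -
      (u (x + r *: e) - u x - r * dotrV (g x) e)); last first.
    by rewrite /de /D /V /incr GE shift_shift; ring.
  by rewrite (le_trans (ler_normB _ _))//; lra.
have -> : incr h (x + r *: e) = V h + (r * dotrV (G h) e + de).
  by rewrite /de /D; ring.
have : - (2 * L * (2 * (s * (r * enorm e)))) <= V h * de.
  by rewrite lerNl (le_trans (ler_norm _))// normrN normrM ler_pM.
move: (V h) (dotrV (G h) e) (de) => v t w vw.
have := sqr_ge0 (r * t + w); lra.
Qed.

(** Discrete form of [|D^2 u|^2 >= (Delta u)^2 / n]. The weighted integral of [|gincr h x + th h|^2]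
    is nonnegative, and [slope] bounds its cross term, the contribution of [g x] vanishing by
    [k_dot]. *)
Lemma gincr_energy_ge x s : (0 < n)%N -> enorm (x - x1) <= rho ->
  (forall b, ecball x eps b -> `|f b - f x| <= s) -> s <= f x ->
  c1 * eps ^+ 2 * (f x - s) ^+ 2 / n%:R <= gincr_energy x.
Proof.
move=> n0 xx fs sf; have nR : 0 < n%:R :> R by rewrite ltr0n.
have rho_gt0 := rho0; have eps_gt0 := eps0; have eps_le := eps_rho.
have xx' : enorm (x - x1) < 3 / 2 * rho by lra.
have xO : ecball x eps `<=` Omega.
  move=> z zx; apply: inO; move: zx; rewrite /ecball/=.
  by have := ler_enorm_dist z x x1; lra.
(* The minimiser of the resulting quadratic in [th]; it is nonnegative thanks to [s <= f x], as
   multiplying the bound on the cross term requires. *)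
pose th := eps * (f x - s) / n%:R.
have th0 : 0 <= th by rewrite divr_ge0 ?mulr_ge0 ?subr_ge0 ?(ltW eps0)// ltW.
pose G h := gincr h x.
have cG h : enorm h <= 1 -> {for h, continuous G} by exact: gincr_continuous.
have cid h : {for h, continuous (fun h : 'rV[R]_n => h)} by exact: cvg_id.
have cGG : continuous_on_ball (fun h => dotrV (G h) (G h)).
  by move=> h h1; exact: dotrV_continuous (cG h h1) (cG h h1).
have cGh : continuous_on_ball (fun h => dotrV (G h) h).
  by move=> h h1; exact: dotrV_continuous (cG h h1) (cid h).
have chh : continuous_on_ball (fun h : 'rV[R]_n => dotrV h h).
  by move=> h h1; exact: dotrV_continuous (cid h) (cid h).
have cgh : continuous_on_ball (fun h => dotrV (g (x + eps *: h)) h).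
  move=> h h1; apply: dotrV_continuous (cid h).
  apply: (continuous_comp (@affine_continuous R n x eps h)).
  by apply: cg; apply: inO; exact: shift_in (ltW _) _.
have GhE : wint k (fun h => dotrV (G h) h) <= - eps * (c1 * (f x - s)).
  rewrite (eq_wint kw (g := fun h => dotrV (g (x + eps *: h)) h - dotrV (g x) h)); last first.
    by move=> h _; rewrite -dotrVBl.
  by rewrite (wintB kw cgh (@cball_dot _ _ (g x))) k_dot subr0; exact: slope.
have c2 := cballM (@cball_cst _ _ (2 * th)) cGh.
have c3 := cballM (@cball_cst _ _ (th ^+ 2)) chh.
have : 0 <= wint k (fun h => (dotrV (G h) (G h) + 2 * th * dotrV (G h) h)
    + th ^+ 2 * dotrV h h).
  rewrite -(mul0r (mass k)) -(wint_cst kw 0).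
  apply: (le_wint kw (@cball_cst _ _ 0) (cballD (cballD cGG c2) c3)) => h _.
  have := dotrV_ge0 (G h + th *: h); rewrite dotrV_sqrD !dotrVZr dotrVZl.
  by move/le_trans; apply; rewrite le_eqVlt; apply/orP; left; apply/eqP; ring.
rewrite (wintD kw (cballD cGG c2) c3) (wintD kw cGG c2).
rewrite (wintZ kw (2 * th) cGh) (wintZ kw (th ^+ 2) chh) k_norm -/(gincr_energy x).
move=> H; have {GhE} := ler_wpM2l th0 GhE.
have E : th * (- eps * (c1 * (f x - s))) = - (c1 * eps ^+ 2 * (f x - s) ^+ 2 / n%:R).
  by rewrite /th; field; rewrite gt_eqF.
have F : th ^+ 2 * (n%:R * c1) = c1 * eps ^+ 2 * (f x - s) ^+ 2 / n%:R.
  by rewrite /th; field; rewrite gt_eqF.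
rewrite E => GhE; rewrite F in H; lra.
Qed.

(** Both sides are averages of squares, the second through [k_dot_sq]; the difference of squares
    factors as [(v - eps t) ((v - eps t) + 2 eps t)]. *)
Lemma energy_close x s : enorm (x - x1) < 3 / 2 * rho -> 0 <= s ->
  (forall h, enorm h <= 1 -> `|incr h x - eps * dotrV (g x) h| <= s * eps) ->
  `|energy x - eps ^+ 2 * (c1 * dotrV (g x) (g x))|
    <= eps ^+ 2 * (s * (2 * L + s)) * mass k.
Proof.
move=> xx s0 Hs; have eps_gt0 := ltW eps0.
have cV2 := cballX (k := 2) (cball_incr xx).
have cd2 : continuous_on_ball (fun h => eps ^+ 2 * dotrV (g x) h ^+ 2).
  exact: (cballM (@cball_cst _ _ (eps ^+ 2)) (cballX (k := 2) (@cball_dot _ _ (g x)))).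
rewrite -k_dot_sq -(wintZ kw (eps ^+ 2) (cballX (k := 2) (@cball_dot _ _ (g x)))).
rewrite /energy -(wintB kw cV2 cd2).
apply: (ler_norm_wint kw (cballB cV2 cd2)) => h h1.
have := Hs h h1; set t := dotrV (g x) h; set v := incr h x => vt.
have tL : `|t| <= L.
  rewrite (le_trans (ler_dotrV _ _))// -[leRHS]mulr1.
  by rewrite ler_pM ?enorm_ge0//; apply: gL; exact: self_in.
rewrite (_ : v ^+ 2 - _ = (v - eps * t) * ((v - eps * t) + 2 * eps * t)); last by ring.
rewrite normrM (_ : eps ^+ 2 * _ = (s * eps) * (s * eps + 2 * eps * L)); last by ring.
rewrite ler_pM// (le_trans (ler_normD _ _))// lerD//.
by rewrite !normrM (ger0_norm eps_gt0) ger0_norm// ler_wpM2l// mulr_ge0.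
Qed.

Lemma energy_ge0 x : enorm (x - x1) < 3 / 2 * rho -> 0 <= energy x.
Proof.
move=> xx; rewrite -(mul0r (mass k)) -(wint_cst kw 0).
apply: (le_wint kw (@cball_cst _ _ 0) (cballX (k := 2) (cball_incr xx))) => h _.
exact: sqr_ge0.
Qed.

(** * Inequalities at a maximum of the energy times a power of the cutoff *)

Section maximum_point.
Variables (m : nat) (C : R) (x0 : 'rV[R]_n).
Local Notation eta := (paraboloid x1 rho).
Hypotheses (C0 : 0 <= C) (eta0 : 0 < eta x0)
  (barrier : forall d Z0 Z, enorm d <= rho * eta x0 / 6 -> 0 <= Z0 ->
    0 < eta (x0 + d) /\
    (Z * eta (x0 + d) ^+ m <= Z0 * eta x0 ^+ m ->
     Z - Z0 <= Z0 * (2 * m%:R / (rho ^+ 2 * eta x0) * dotrV (x0 - x1) d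
       + C / (rho * eta x0) ^+ 2 * enorm d ^+ 2)))
  (maximal : forall x, enorm (x - x1) <= rho ->
    energy x * eta x ^+ m <= energy x0 * eta x0 ^+ m).

Lemma paraboloid_gt0_ball x : 0 < eta x -> enorm (x - x1) <= rho.
Proof.
rewrite /paraboloid subr_gt0 -sqr_enorm exprVn mulrC.
rewrite ltr_pdivrMr ?exprn_gt0// mul1r => /ltW.
by rewrite ler_pXn2r// nnegrE ?enorm_ge0// ltW.
Qed.

Lemma energy_upper d : enorm d <= rho * eta x0 / 6 ->
  energy (x0 + d) - energy x0 <= energy x0 *
    (2 * m%:R / (rho ^+ 2 * eta x0) * dotrV (x0 - x1) d
     + C / (rho * eta x0) ^+ 2 * enorm d ^+ 2).
Proof.
move=> de; have x0B := paraboloid_gt0_ball eta0; have rho_gt0 := rho0.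
have E0 : 0 <= energy x0 by apply: energy_ge0; lra.
have [ed H] := barrier (energy (x0 + d)) de E0; apply: H.
by apply: maximal; exact: paraboloid_gt0_ball.
Qed.

(** Substitute for the sign of the Laplacian at a maximum: averaging [energy_upper] over a small
    ball kills the linear term by [k_dot], and [energy_lower] bounds the same average from below.
    Dividing by [r ^+ 2] leaves an error [kap] that is arbitrary. *)
Lemma maximum_second_order :
  c1 * (gincr_energy x0 - source x0) <= energy x0 * (C / (rho * eta x0) ^+ 2) * mass k.
Proof.
have x0B := paraboloid_gt0_ball eta0; have rho_gt0 := rho0.
have E0 : 0 <= energy x0 by apply: energy_ge0; lra.
apply/ler_addgt0Pr => kap kap0; rewrite -lerBlDr.
have [r1 r10 H] := energy_lower x0B kap0.
have re0 : 0 < rho * eta x0 / 6 by rewrite divr_gt0 ?mulr_gt0.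
(* The three bounds serve [energy_lower], the barrier expansion, and continuity of the energy on the
   ball around [x0]. *)
pose r := Num.min (Num.min (r1 / 2) (rho * eta x0 / 6)) (rho / 4).
have r0 : 0 < r by rewrite !lt_min !divr_gt0 ?mulr_gt0.
have rr1 : r < r1.
  by apply: (@le_lt_trans _ _ (r1 / 2)); [rewrite !ge_min lexx|lra].
have rre : r <= rho * eta x0 / 6 by rewrite !ge_min lexx orbT.
have rr4 : r <= rho / 4 by rewrite !ge_min lexx !orbT.
have := H r r0 rr1; set B := C / _; set A := 2 * m%:R / (rho ^+ 2 * eta x0).
have B0 : 0 <= B by rewrite divr_ge0// sqr_ge0.
have small y : enorm y <= 1 -> enorm (r *: y) <= r.
  by move=> y1; rewrite enormZ gtr0_norm// ler_piMr// ltW.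
have cE : continuous_on_ball (fun y => energy (x0 + r *: y)).
  apply: cball_affine => y y1; apply: energy_continuous.
  have := in_ecball x0 (ltW r0) (lexx r) y1; rewrite /ecball/=.
  by have := ler_enorm_dist (x0 + r *: y) x0 x1; lra.
have cl := cballM (@cball_cst _ _ (energy x0 * A * r)) (@cball_dot _ _ (x0 - x1)).
have := le_wint kw (cballB cE (@cball_cst _ _ (energy x0)))
  (cballD cl (@cball_cst _ _ (energy x0 * B * r ^+ 2))).
rewrite (wintD kw cl (@cball_cst _ _ (energy x0 * B * r ^+ 2))).
rewrite (wintZ kw (energy x0 * A * r) (@cball_dot _ _ (x0 - x1))) k_dot mulr0 add0r.
rewrite (wint_cst kw (energy x0 * B * r ^+ 2)) => up low.
have {up} : wint k (fun y => energy (x0 + r *: y) - energy x0) <=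
    energy x0 * B * r ^+ 2 * mass k.
  apply: up => y y1; have ys := small y y1.
  apply: (le_trans (energy_upper (le_trans ys rre))).
  rewrite mulrDr -/A -/B dotrVZr lerD//.
    by rewrite le_eqVlt; apply/orP; left; apply/eqP; ring.
  rewrite -mulrA ler_wpM2l// ler_wpM2l//.
  by rewrite ler_pXn2r ?nnegrE ?enorm_ge0// ltW.
move=> /(le_trans low).
rewrite (_ : energy x0 * B * r ^+ 2 * mass k = r ^+ 2 * (energy x0 * B * mass k)); last by ring.
by rewrite ler_pM2l// exprn_gt0.
Qed.

(** Stationarity in the direction [e], as the one inequality that is used: [energy_first_order] from
    below, [energy_upper] from above, divided by [r]. *)
Lemma maximum_first_order e :
  2 * wint k (fun h => incr h x0 * dotrV (gincr h x0) e) <=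
  energy x0 * (2 * m%:R / (rho ^+ 2 * eta x0) * dotrV (x0 - x1) e).
Proof.
have x0B := paraboloid_gt0_ball eta0; have rho_gt0 := rho0.
have E0 : 0 <= energy x0 by apply: energy_ge0; lra.
have e0 := enorm_ge0 e.
set B := C / (rho * eta x0) ^+ 2; set A := 2 * m%:R / (rho ^+ 2 * eta x0).
have B0 : 0 <= B by rewrite divr_ge0// sqr_ge0.
apply/ler_addgt0Pr => kap kap0; rewrite -lerBlDr.
have kap2 : 0 < kap / 2 by exact: divr_gt0.
have [r1 r10 H] := energy_first_order e x0B kap2.
pose Q := energy x0 * (B * enorm e ^+ 2).
have Q0 : 0 <= Q by rewrite mulr_ge0// mulr_ge0// sqr_ge0.
pose r := Num.min (Num.min (r1 / 2) (rho * eta x0 / 6 / (enorm e + 1))) (kap / 2 / (Q + 1)).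
have e1 : 0 < enorm e + 1 by rewrite ltr_wpDl.
have Q1 : 0 < Q + 1 by rewrite ltr_wpDl.
have r0 : 0 < r by rewrite !lt_min !divr_gt0 ?mulr_gt0.
have rr1 : r < r1.
  by apply: (@le_lt_trans _ _ (r1 / 2)); [rewrite !ge_min lexx|lra].
have rre : r * (enorm e + 1) <= rho * eta x0 / 6.
  by rewrite -ler_pdivlMr// !ge_min lexx orbT.
have rQ : r * Q <= kap / 2.
  apply: (@le_trans _ _ (r * (Q + 1))); first by rewrite ler_wpM2l ?(ltW r0)// lerDl.
  by rewrite -ler_pdivlMr// !ge_min lexx !orbT.
have re : enorm (r *: e) = r * enorm e by rewrite enormZ gtr0_norm.
have small : enorm (r *: e) <= rho * eta x0 / 6.
  by rewrite re (le_trans _ rre)// ler_wpM2l ?(ltW r0)// lerDl.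
have := le_trans (H r r0 rr1) (energy_upper small).
rewrite -/A -/B re dotrVZr.
rewrite (_ : energy x0 * _ = r * (energy x0 * (A * dotrV (x0 - x1) e) + r * Q)); last first.
  by rewrite /Q; ring.
by rewrite ler_pM2l//; move: (wint _ _) (energy x0 * _) => a b; lra.
Qed.

(** The part of the source coming from [u^p] is discarded by its sign. The part from [|grad u|^q] is
    linearised, and its error is split by [V D <= (V^2 + D^2) / 2]. *)
Lemma source_le (M q p tau : R) : 0 < M -> p <= 0 -> 0 <= tau ->
  (forall z, Omega z -> 0 < u z) ->
  (forall z, Omega z -> f z = u z `^ p + M * enorm (g z) `^ q) ->
  (forall h, enorm h <= 1 ->
    `|enorm (g (x0 + eps *: h)) `^ q - enorm (g x0) `^ q
      - q * enorm (g x0) `^ (q - 2) * dotrV (g x0) (gincr h x0)|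
    <= tau * enorm (gincr h x0)) ->
  source x0 <= M * q * enorm (g x0) `^ (q - 2) *
      wint k (fun h => incr h x0 * dotrV (gincr h x0) (g x0))
    + M * tau / 2 * (energy x0 + gincr_energy x0).
Proof.
move=> M0 p0 tau0 u0 fE gE; have x0B := paraboloid_gt0_ball eta0; have rho_gt0 := rho0.
have xx' : enorm (x0 - x1) < 3 / 2 * rho by lra.
set N := M * q * _.
have cV := cball_incr xx'.
have cG h : enorm h <= 1 -> {for h, continuous (fun h => gincr h x0)}.
  exact: gincr_continuous.
have cGG : continuous_on_ball (fun h => dotrV (gincr h x0) (gincr h x0)).
  by move=> h h1; exact: dotrV_continuous (cG h h1) (cG h h1).
have cGa : continuous_on_ball (fun h => dotrV (gincr h x0) (g x0)).
  by move=> h h1; apply: dotrV_continuous (cG h h1) _; exact: cst_continuous.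
have hO h : enorm h <= 1 -> Omega (x0 + eps *: h).
  by move=> h1; apply: inO; exact: shift_in (ltW _) _.
have x0O : Omega x0 by apply: inO; exact: self_in.
have cdF : continuous_on_ball (fun h => f (x0 + eps *: h) - f x0).
  by apply: cballB; [apply: cball_affine => h /hO/cf|exact: cball_cst].
have cVGa := cballM cV cGa.
have c1' := cballM (@cball_cst _ _ N) cVGa.
have cs := cballD (cballX (k := 2) cV) cGG.
have c2 := cballM (@cball_cst _ _ (M * tau / 2)) cs.
rewrite /source -(wintD kw (cballX (k := 2) cV) cGG).
rewrite -(wintZ kw N cVGa) -(wintZ kw (M * tau / 2) cs) -(wintD kw c1' c2).
apply: (le_wint kw (cballM cV cdF) (cballD c1' c2)) => h h1.
rewrite (fE _ (hO h h1)) (fE _ x0O).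
(* Since [p <= 0], the power is nonincreasing, so increments of [u] and of [u^p] have opposite
   signs. *)
have up : incr h x0 * (u (x0 + eps *: h) `^ p - u x0 `^ p) <= 0.
  have ua := u0 _ (hO h h1); have ux := u0 _ x0O; rewrite /incr.
  have anti (s t : R) : 0 < s -> s <= t -> t `^ p <= s `^ p.
    move=> s0 st; have t0 := lt_le_trans s0 st.
    rewrite -[p]opprK !(powRN _ (- p)) lef_pV2 ?posrE ?powR_gt0//.
    by rewrite ge0_ler_powR// ?nnegrE ?(ltW s0) ?(ltW t0)// oppr_ge0.
  have /orP[ab|ab] := le_total (u x0) (u (x0 + eps *: h)).
    by rewrite mulr_ge0_le0 ?subr_ge0 ?subr_le0// anti.
  by rewrite mulr_le0_ge0 ?subr_ge0 ?subr_le0// anti.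
have := gE h h1; rewrite (dotrVC (g x0)).
rewrite -sqr_enorm /N.
have G0 := enorm_ge0 (gincr h x0).
set V := incr h x0 in up *; set D := enorm (gincr h x0) in G0 *.
set t := dotrV _ _; set e := _ - _ - _ => eD.
have -> : enorm (g (x0 + eps *: h)) `^ q = e + enorm (g x0) `^ q +
   q * enorm (g x0) `^ (q - 2) * t by rewrite /e; ring.
have Ve : V * e <= tau * ((V ^+ 2 + D ^+ 2) / 2).
  rewrite (le_trans (ler_norm _))// normrM.
  rewrite (le_trans (ler_wpM2l (normr_ge0 V) eD))// mulrCA ler_wpM2l//.
  by have := sqr_ge0 (`|V| - D); rewrite sqrrB real_normK ?num_real//; lra.
move: (_ `^ p) (u x0 `^ p) (_ `^ q) (_ `^ (q - 2)) up => up1 up2 gq gq2 up.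
have := ler_wpM2l (ltW M0) Ve; lra.
Qed.

(** All estimates at the maximum are divided by [N = eps ^+ 2 * c1], which removes the scale, and
    handed to [absorption]. The condition on [s] leaves at least half of [M * A * P] in
    [f x0 - s]. *)
Lemma maximum_gradient_bound (M q p tau s : R) : (0 < n)%N ->
  0 < M -> 0 <= q -> p <= 0 -> 0 <= tau ->
  (forall z, Omega z -> 0 < u z) ->
  (forall z, Omega z -> f z = u z `^ p + M * enorm (g z) `^ q) ->
  0 < enorm (g x0) ->
  (forall h, enorm h <= 1 ->
    `|enorm (g (x0 + eps *: h)) `^ q - enorm (g x0) `^ q
      - q * enorm (g x0) `^ (q - 2) * dotrV (g x0) (gincr h x0)|
    <= tau * enorm (gincr h x0)) ->
  (forall b, ecball x0 eps b -> `|f b - f x0| <= s) ->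
  s <= M * enorm (g x0) * enorm (g x0) `^ (q - 1) / 2 ->
  energy x0 <= 2 * enorm (g x0) ^+ 2 * (eps ^+ 2 * c1) ->
  M * tau <= 1 ->
  M * tau <= M ^+ 2 * (enorm (g x0) `^ (q - 1)) ^+ 2 / (16 * n%:R) ->
  enorm (g x0) `^ (q - 1) <=
    (64 * n%:R * q * m%:R / M + 1 + 64 * n%:R * (C * mass k / c1) / M ^+ 2)
    * (rho * eta x0)^-1.
Proof.
move=> n0 M0 q0 p0 tau0 u0 fE A0 gE fs sA EA tau1 tau2.
have src := source_le M0 p0 tau0 u0 fE gE.
have second := maximum_second_order.
have first_ := maximum_first_order (g x0).
have x0B := paraboloid_gt0_ball eta0; have rho_gt0 := rho0.
have xx' : enorm (x0 - x1) < 3 / 2 * rho by lra.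
have x0O : Omega x0 by apply: inO; exact: self_in.
have k0 := mass_ge0 kw; have E0 := energy_ge0 xx'.
set A := enorm (g x0) in A0 sA EA tau2 src *; set P := A `^ (q - 1) in sA tau2 *.
have P0 : 0 < P by rewrite powR_gt0.
have AP q' : A * A `^ q' = A `^ (q' + 1).
  by rewrite powRD ?powRr1 ?(ltW A0) 1?mulrC// (gt_eqF A0) implybT.
have Aq : A `^ q = A * P by rewrite AP; congr (_ `^ _); ring.
have A2 : A `^ (q - 2) * A = P by rewrite mulrC AP; congr (_ `^ _); ring.
have MAP : 0 < M * A * P by rewrite !mulr_gt0.
have fx : M * A * P <= f x0.
  by rewrite fE// -/A Aq mulrA lerDr powR_ge0.
have sf : s <= f x0 by lra.
have W := gincr_energy_ge n0 x0B fs sf.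
pose N := eps ^+ 2 * c1; have N0 : 0 < N by rewrite mulr_gt0// exprn_gt0.
have n0R : 0 < n%:R :> R by rewrite ltr0n.
have re0 : 0 < rho * eta x0 by rewrite mulr_gt0.
pose Y := (rho * eta x0)^-1.
apply: (@absorption R n%:R M q m%:R (C * mass k / c1) A P Y (energy x0 / N)
  (gincr_energy x0 / N) (source x0 / N) tau) => //.
- by rewrite divr_ge0 ?mulr_ge0// ltW.
- by rewrite invr_gt0.
- by rewrite divr_ge0 ?(ltW N0).
- have : c1 * (gincr_energy x0 - source x0) / (c1 * N) <=
      energy x0 * (C / (rho * eta x0) ^+ 2) * mass k / (c1 * N).
    by rewrite ler_wpM2r// invr_ge0 mulr_ge0// ltW.
  move: (gincr_energy x0) (source x0) (energy x0) (eta x0) re0 @Y => w S E y re0 Y.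
  have y0 : y != 0 by apply: contraTneq re0 => ->; rewrite mulr0 ltxx.
  rewrite (_ : c1 * _ / _ = w / N - S / N); last by field; rewrite !gt_eqF.
  rewrite (_ : E * _ * _ / _ = E / N * (C * mass k / c1 * Y ^+ 2))//.
  by rewrite /Y; field; rewrite y0 !gt_eqF.
(* [enorm (x0 - x1) <= rho] cancels one power of [rho] in the first-order coefficient, leaving
   [m * Y]. *)
- have F : wint k (fun h => incr h x0 * dotrV (gincr h x0) (g x0)) <=
      energy x0 * m%:R * Y * A.
    have dle : dotrV (x0 - x1) (g x0) <= rho * A.
      by rewrite (le_trans (dotrV_le _ _))// ler_wpM2r ?(ltW A0).
    have c0 : 0 <= 2 * m%:R / (rho ^+ 2 * eta x0).
      by rewrite divr_ge0 ?mulr_ge0// ltW// mulr_gt0 ?exprn_gt0.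
    have := le_trans first_ (ler_wpM2l E0 (ler_wpM2l c0 dle)).
    rewrite (_ : energy x0 * _ = 2 * (energy x0 * m%:R * Y * A)).
      by rewrite ler_pM2l.
    by rewrite /Y; field; rewrite !gt_eqF.
  have N' : 0 <= M * q * A `^ (q - 2) by rewrite !mulr_ge0 ?powR_ge0// ltW.
  have := le_trans src (lerD (ler_wpM2l N' F) (lexx _)).
  move: F => _; rewrite -(ler_pM2r (_ : 0 < N^-1)) ?invr_gt0//.
  move=> /le_trans; apply; rewrite -A2.
  by rewrite le_eqVlt; apply/orP; left; apply/eqP; ring.
- have : c1 * eps ^+ 2 * (f x0 - s) ^+ 2 / n%:R / N <= gincr_energy x0 / N.
    by rewrite ler_wpM2r// invr_ge0 ltW.
  apply: le_trans.
  rewrite (_ : _ / N = (f x0 - s) ^+ 2 / n%:R); last first.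
    by rewrite /N; field; rewrite !gt_eqF.
  rewrite ler_wpM2r ?invr_ge0 ?(ltW n0R)// ler_pXn2r ?nnegrE//; last 2 first.
  + by rewrite divr_ge0// ltW.
  + lra.
  lra.
- by rewrite ler_pdivrMr.
Qed.

End maximum_point.
End fixed_scale.

(** Raise the left side to the power [r = (q - 1) / 2]: since [y <= 1] and [m r >= 1],
    [y ^ (m r) <= y], and this single factor cancels the [y^-1] of the hypothesis. Hence the
    condition [m (q - 1) >= 2]. *)
Lemma barrier_exponent (A y X r : R) (m : nat) : 0 < r -> 0 <= A -> 0 < y -> y <= 1 ->
  0 < X -> 1 <= m%:R * r -> A `^ (2 * r) <= X * y^-1 ->
  A ^+ 2 * y ^+ m <= X `^ r^-1.
Proof.
move=> r0 A0 y0 y1 X0 mr AX.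
have Z0 : 0 <= A ^+ 2 * y ^+ m by rewrite mulr_ge0 ?sqr_ge0// exprn_ge0// ltW.
have -> : A ^+ 2 * y ^+ m = ((A ^+ 2 * y ^+ m) `^ r) `^ r^-1.
  by rewrite -powRrM mulfV ?gt_eqF// powRr1.
apply: ge0_ler_powR; rewrite ?nnegrE ?powR_ge0 ?invr_ge0 ?(ltW r0) ?(ltW X0)//.
rewrite powRM ?sqr_ge0 ?exprn_ge0 ?(ltW y0)//.
rewrite -(powR_mulrn 2 A0) -(powR_mulrn m (ltW y0)) -!powRrM.
apply: (@le_trans _ _ (A `^ (2 * r) * y)).
  rewrite ler_wpM2l ?powR_ge0//; apply: (@le_trans _ _ (y `^ 1)).
    by rewrite ger_powR// y0.
  by rewrite powRr1// ltW.
by rewrite -ler_pdivlMr.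
Qed.

(** If the squared gradient at the centre exceeded the asserted bound [T], the maximum of
    [energy eps * eta ^+ m] would exceed [N * T], with [N = eps ^+ 2 * c1]. The gradient at the
    maximum point is then large enough for [maximum_gradient_bound], and [barrier_exponent] brings
    the maximum back to at most [N * T]. *)
Lemma interior_gradient_bound (m : nat) (C M q p : R) : (0 < n)%N ->
  0 < M -> 1 < q -> p <= 0 -> 0 <= C -> 1 <= m%:R * ((q - 1) / 2) ->
  (forall z, Omega z -> 0 < u z) ->
  (forall z, Omega z -> f z = u z `^ p + M * enorm (g z) `^ q) ->
  (forall x0 d Z0 Z, 0 < paraboloid x1 rho x0 ->
    enorm d <= rho * paraboloid x1 rho x0 / 6 -> 0 <= Z0 ->
    0 < paraboloid x1 rho (x0 + d) /\
    (Z * paraboloid x1 rho (x0 + d) ^+ m <= Z0 * paraboloid x1 rho x0 ^+ m ->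
     Z - Z0 <= Z0 * (2 * m%:R / (rho ^+ 2 * paraboloid x1 rho x0) * dotrV (x0 - x1) d
       + C / (rho * paraboloid x1 rho x0) ^+ 2 * enorm d ^+ 2))) ->
  enorm (g x1) ^+ 2 <= 2 * ((64 * n%:R * q * m%:R / M + 1
     + 64 * n%:R * (C * mass k / c1) / M ^+ 2) / rho) `^ (2 / (q - 1)).
Proof.
move=> n0 M0 q1 p0 C0 mq u0 fE barrier.
set X := _ + 1 + _; have k0 := mass_ge0 kw; have n0R : 0 < n%:R :> R by rewrite ltr0n.
have q0 : 0 < q by lra.
have X0 : 0 < X.
  rewrite ltr_pwDl//; last by rewrite divr_ge0 ?sqr_ge0// !mulr_ge0 ?invr_ge0// ltW.
  by rewrite ltr_wpDl// divr_ge0 ?(ltW M0)// !mulr_ge0// ltW.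
rewrite leNgt; apply/negP; set T := 2 * _ => TA.
have T0 : 0 < T by rewrite mulr_gt0// powR_gt0// divr_gt0.
have x1K : ecball x1 (2 * rho) x1.
  by rewrite /ecball/= subrr enorm0 mulr_ge0// ltW.
pose gam := enorm (g x1) ^+ 2 - T; have gam0 : 0 < gam by rewrite subr_gt0.
(* A lower bound for the gradient at the future maximum point, available before [eps] is chosen. *)
pose A0 := Num.sqrt (T / 2).
have A02 : A0 ^+ 2 = T / 2 by rewrite sqr_sqrtr// divr_ge0// ltW.
have A00 : 0 < A0 by rewrite sqrtr_gt0 divr_gt0.
have A0L : A0 <= L.
  rewrite -(@ler_pXn2r _ 2)// ?nnegrE ?(ltW A00) ?(ltW L0)// A02.
  have : enorm (g x1) ^+ 2 <= L ^+ 2.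
    by rewrite ler_pXn2r ?nnegrE ?enorm_ge0 ?(ltW L0)// gL.
  lra.
pose P0 := A0 `^ (q - 1); have P00 : 0 < P0 by rewrite powR_gt0.
(* The two smallness conditions of [absorption], with the a priori bound [P0] in place of [P]. *)
pose tau := Num.min M^-1 (M * P0 ^+ 2 / (16 * n%:R)).
have tau0 : 0 < tau by rewrite lt_min invr_gt0 M0 divr_gt0 ?mulr_gt0 ?exprn_gt0.
have tau1 : M * tau <= 1.
  by rewrite mulrC -ler_pdivlMr// mul1r ge_min lexx.
have tau2 : M * tau <= M ^+ 2 * P0 ^+ 2 / (16 * n%:R).
  rewrite (_ : M ^+ 2 * P0 ^+ 2 / (16 * n%:R) = M * (M * P0 ^+ 2 / (16 * n%:R))).
    by rewrite ler_pM2l// ge_min lexx orbT.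
  by field; rewrite gt_eqF.
have [s1 s10 expand] := enorm_powR_expand q1 A00 A0L tau0.
(* Error allowed between the normalised energy and the squared gradient: below the gap [gam] at the
   centre, and at most [T / 2] at the maximum. *)
pose del := Num.min gam T / 2; have del0 : 0 < del by rewrite divr_gt0// lt_min gam0.
(* For [s <= 1], [s * K] dominates the error of [energy_close] after division by [N]. *)
pose K := (2 * L + 1) * (mass k / c1).
have K0 : 0 <= K by rewrite mulr_ge0 ?divr_ge0 ?addr_ge0 ?mulr_ge0 ?(ltW L0) ?(ltW c10).
have K1 : 0 < K + 1 by rewrite ltr_wpDl.
pose s := Num.min (Num.min s1 (M * A0 * P0 / 2)) (Num.min 1 (del / (K + 1))).
have MAP0 : 0 < M * A0 * P0 by rewrite mulr_gt0// mulr_gt0.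
have MAP2 : 0 < M * A0 * P0 / 2 by exact: divr_gt0.
have delK : 0 < del / (K + 1) by exact: divr_gt0.
have s0 : 0 < s by rewrite !lt_min s10 ltr01 MAP2 delK.
have ss1 : s <= s1 by rewrite !ge_min lexx.
have sMAP : s <= M * A0 * P0 / 2 by rewrite !ge_min lexx orbT.
have sle1 : s <= 1 by rewrite !ge_min lexx !orbT.
have sdel : s * K <= del.
  apply: (@le_trans _ _ (del / (K + 1) * K)).
    by rewrite ler_wpM2r// !ge_min lexx !orbT.
  by apply: div_succ_le => //; exact: ltW.
have [d d0 mod_d] := modulus s0.
pose eps := Num.min (rho / 2) (d / 2).
have eps0 : 0 < eps by rewrite lt_min !divr_gt0.
have eps_rho : eps <= rho / 2 by rewrite ge_min lexx.
have epsd : eps < d.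
  by apply: (@le_lt_trans _ _ (d / 2)); [rewrite ge_min lexx orbT|lra].
pose N := eps ^+ 2 * c1; have N0 : 0 < N by rewrite mulr_gt0// exprn_gt0.
have hd h : enorm h <= 1 -> enorm (eps *: h) < d.
  by move=> h1; rewrite enormZ gtr0_norm// (le_lt_trans _ epsd)// ler_piMr// ltW.
have diffE x h : x + eps *: h - x = eps *: h by rewrite addrC addKr.
have close x : enorm (x - x1) < 3 / 2 * rho ->
    N * (enorm (g x) ^+ 2 - del) <= energy eps x <= N * (enorm (g x) ^+ 2 + del).
  move=> xx; have xK := self_in xx.
  have Hs h : enorm h <= 1 -> `|incr eps h x - eps * dotrV (g x) h| <= s * eps.
    move=> h1; have := mod_d x (x + eps *: h) xK; rewrite diffE => /(_ (hd h h1)).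
    move=> [_ + _ _]; rewrite dotrVZr => /le_trans; apply.
    by rewrite enormZ gtr0_norm// ler_wpM2l ?(ltW s0)// ler_piMr// ltW.
  have := energy_close eps0 eps_rho xx (ltW s0) Hs; rewrite -sqr_enorm.
  have : eps ^+ 2 * (s * (2 * L + s)) * mass k <= N * del.
    apply: (@le_trans _ _ (N * (s * K))); last by rewrite ler_wpM2l ?(ltW N0).
    rewrite (_ : N * (s * K) = eps ^+ 2 * (s * (2 * L + 1)) * mass k); last first.
      by rewrite /N /K; field; rewrite gt_eqF.
    rewrite ler_wpM2r// ler_wpM2l ?sqr_ge0// ler_wpM2l ?(ltW s0)// lerD2l//.
  move=> h1 h2; have := le_trans h2 h1.
  by rewrite ler_norml /N; move: (energy _ _) (enorm _ ^+ 2) => E a /andP[]; lra.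
have in_close x : enorm (x - x1) <= rho -> enorm (x - x1) < 3 / 2 * rho.
  by have := rho0; lra.
pose eta := paraboloid x1 rho.
have B0 : ecball x1 rho !=set0 by exists x1; rewrite /ecball/= subrr enorm0 ltW.
have cEeta : {within ecball x1 rho, continuous (fun x => energy eps x * eta x ^+ m)}.
  apply: continuous_in_subspaceT => x /set_mem /in_close xx.
  exact: (contM (energy_continuous eps0 eps_rho xx)
    (contX (k := m) (@continuous_paraboloid R n x1 rho x))).
have [x0 /set_mem x0B max0] := EVT_max_rV B0 (@ecball_compact R n x1 rho) cEeta.
have maximal x : enorm (x - x1) <= rho ->
    energy eps x * eta x ^+ m <= energy eps x0 * eta x0 ^+ m.
  by move=> xB; apply: max0; exact/mem_set.
have x0x := in_close _ x0B; have x0K := self_in x0x.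
have m0 : (0 < m)%N by case: (m) mq => //; rewrite mul0r; lra.
have eta1 : eta x1 = 1 by rewrite /eta /paraboloid subrr dotrV0l mulr0 subr0.
have eta01 : 0 <= eta x0 <= 1.
  rewrite /eta /paraboloid -sqr_enorm -exprMn.
  have e0 : 0 <= rho^-1 * enorm (x0 - x1) by rewrite mulr_ge0 ?enorm_ge0// invr_ge0 ltW.
  have e1 : rho^-1 * enorm (x0 - x1) <= 1 by rewrite mulrC ler_pdivrMr// mul1r.
  by rewrite subr_ge0 expr_le1// e1 lerBlDr lerDl sqr_ge0.
have x1B : enorm (x1 - x1) <= rho by rewrite subrr enorm0 ltW.
have /andP[E1 _] := close x1 (in_close x1 x1B).
have /andP[E0a E0b] := close x0 x0x.
have delg : del <= gam / 2 by rewrite /del ler_pM2r// ge_min lexx.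
have delT : del <= T / 2 by rewrite /del ler_pM2r// ge_min lexx orbT.
have ET : N * T < energy eps x0 * eta x0 ^+ m.
  apply: lt_le_trans (maximal _ x1B); rewrite eta1 expr1n mulr1.
  by apply: lt_le_trans E1; rewrite ltr_pM2l// /gam in delg gam0 *; lra.
case/andP: eta01 => eta0 eta_le1.
(* A zero of the cutoff would make the maximum zero, against [ET]: the maximum is interior. *)
have eta_gt0 : 0 < eta x0.
  rewrite lt_neqAle eta0 andbT eq_sym; apply: contraTneq ET => ->.
  by rewrite expr0n gtn_eqF// mulr0 -leNgt mulr_ge0// ltW.
have Ege0 := energy_ge0 eps0 eps_rho x0x.
have etam1 : eta x0 ^+ m <= 1 by rewrite exprn_ile1.
have EN : N * T < energy eps x0 by apply: lt_le_trans ET _; rewrite ler_piMr.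
set A := enorm (g x0) in E0a E0b.
have A_ge0 : 0 <= A by exact: enorm_ge0.
have TA2 : T / 2 < A ^+ 2.
  have := lt_le_trans EN E0b; rewrite ltr_pM2l//; lra.
have A0A : A0 <= A.
  by rewrite -(@ler_pXn2r _ 2)// ?nnegrE ?(ltW A00)// A02 ltW.
have A_gt0 : 0 < A by exact: lt_le_trans A0A.
have AL : A <= L by exact: gL.
have P0P : P0 <= A `^ (q - 1).
  by rewrite /P0 ge0_ler_powR// ?nnegrE ?(ltW A00)// subr_ge0 ltW.
have PX := @maximum_gradient_bound eps eps0 eps_rho m C x0 C0 eta_gt0
  (fun d Z0 Z => @barrier x0 d Z0 Z eta_gt0) maximal M q p tau s n0 M0 (ltW q0) p0
  (ltW tau0) u0 fE A_gt0.
(* [del <= T / 2 < A ^+ 2], so passing from energy to squared gradient costs at most a factor 2, the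
   origin of the 2 in the bound. *)
have EA : energy eps x0 <= 2 * A ^+ 2 * N.
  by rewrite (le_trans E0b)// mulrC ler_pM2r//; lra.
have := PX _ _ _ EA tau1 _; rewrite -/A -/X -/eta => {}PX.
have {PX} : A `^ (q - 1) <= X * (rho * eta x0)^-1.
  apply: PX.
  - move=> h h1; apply: (expand n (g x0) (g (x0 + eps *: h))) => //.
    have := mod_d x0 (x0 + eps *: h) x0K; rewrite diffE => /(_ (hd h h1))[_ _ + _].
    by move=> /le_trans; apply.
  - move=> b xb; have [] // := mod_d x0 b x0K _.
    by rewrite (le_lt_trans xb).
  - rewrite (le_trans sMAP)// ler_pM2r// -!mulrA ler_pM2l//.
    by rewrite ler_pM ?(ltW A00) ?(ltW P00).
  - rewrite (le_trans tau2)// ler_pM2r ?invr_gt0 ?mulr_gt0// ler_pM2l ?exprn_gt0//.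
    by rewrite ler_pXn2r ?nnegrE ?powR_ge0// ltW.
rewrite invfM mulrA => PX.
have Xr : 0 < X / rho by exact: divr_gt0.
have r0 : 0 < (q - 1) / 2 by rewrite divr_gt0// subr_gt0.
have PX' : A `^ (2 * ((q - 1) / 2)) <= X / rho * (eta x0)^-1.
  by rewrite mulrC divfK.
have := barrier_exponent r0 A_ge0 eta_gt0 eta_le1 Xr mq PX'.
rewrite invf_div => AX.
have : N * T < N * (2 * (A ^+ 2 * eta x0 ^+ m)).
  apply: lt_le_trans ET _.
  rewrite (_ : N * (2 * (A ^+ 2 * eta x0 ^+ m)) = 2 * A ^+ 2 * N * eta x0 ^+ m); last by ring.
  by rewrite ler_wpM2r ?exprn_ge0.
rewrite ltr_pM2l// /T ltr_pM2l// => TA'.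
by have := lt_le_trans TA' AX; rewrite ltxx.
Qed.

End bernstein.

(** * The gradient bound *)

Lemma slope_upper_bound (R : realType) n (p M q : R) (Omega : set 'rV[R]_n)
    (u : 'rV[R]_n -> R) a r w :
  1 < q -> positive_solution p M q Omega u -> 0 < r -> ecball a r `<=` Omega ->
  (forall b, ecball a r b -> `|rhs p M q u b - rhs p M q u a| <= w) ->
  wint bump_slope (fun y => dotrV (grad u (a + r *: y)) y) <=
  - r * (mass (@ball_bump R n) * (rhs p M q u a - w)).
Proof.
move=> q1 pu r0 aO fw; have Kw := @bump_weight R n.
rewrite (weak_kernel_identity q1 pu r0 aO) !mulNr lerN2 ler_wpM2l ?(ltW r0)//.
rewrite mulrC -(wint_cst Kw (rhs p M q u a - w)).
have inb y : enorm y <= 1 -> ecball a r (a + r *: y).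
  by move=> y1; exact: in_ecball (ltW r0) (lexx r) y1.
apply: (le_wint Kw (@cball_cst _ _ _)) => [|y /inb/fw].
  by apply: cball_affine => y /inb/aO Oy; exact: (continuous_rhs q1 pu Oy).
by rewrite ler_norml => /andP[]; move: (rhs _ _ _ _ _) (rhs _ _ _ _ a) => s t; lra.
Qed.

(** The order of quantifiers is the point: [X] is fixed before [p], [Omega], [u] and the ball. The
    prefactor 2 comes from bounding [2 B ^+ 2] by [(2 B) ^+ 2]. *)
Lemma local_gradient_bound (R : realType) n (M q : R) : (0 < n)%N -> 0 < M -> 1 < q ->
  exists2 X : R, 0 < X & forall (p : R) (Omega : set 'rV[R]_n) (u : 'rV[R]_n -> R),
  p <= 0 -> open Omega -> positive_solution p M q Omega u ->
  forall x (rho : R), 0 < rho -> ecball x (2 * rho) `<=` Omega ->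
  enorm (grad u x) <= 2 * (X / rho) `^ (1 / (q - 1)).
Proof.
move=> n0 M0 q1; have r0 : 0 < q - 1 by rewrite subr_gt0.
pose m := (Num.truncn (2 / (q - 1))).+1.
have mq : 1 <= m%:R * ((q - 1) / 2).
  have : 2 / (q - 1) < m%:R by exact: truncnS_gt.
  by rewrite ltr_pdivrMr// mulrA ler_pdivlMr// mul1r => /ltW.
have [C C0 HC] := @barrier_taylor R m.
have c10 := @mass_bump_gt0 R n.
pose X := 64 * n%:R * q * m%:R / M + 1 +
  64 * n%:R * (C * mass (@bump_slope R n) / mass (@ball_bump R n)) / M ^+ 2.
have k0 := mass_ge0 (@bump_slope_weight R n).
have X0 : 0 < X.
  rewrite ltr_pwDl//; last by rewrite divr_ge0 ?sqr_ge0// !mulr_ge0 ?invr_ge0// ltW.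
  by rewrite ltr_wpDl// divr_ge0 ?(ltW M0)// !mulr_ge0//; lra.
exists X => // p Omega u p0 oO pu x rho rho0 xO.
have [u0 [Cu _ _]] := pu.
have cK := @ecball_compact R n x (2 * rho).
have cu z : Omega z -> {for z, continuous u} by move=> Oz; exact: (continuous_solution pu Oz).
have cf z : Omega z -> {for z, continuous (rhs p M q u)} by move=> Oz; exact: (continuous_rhs q1 pu Oz).
have cg z : Omega z -> {for z, continuous (grad u)} by move=> Oz; exact: (continuous_grad pu Oz).
have [L L0 ugL] := compact_bound cu cg cK xO.
have H := interior_gradient_bound bump_slope_weight c10 (@wint_slope_dot R n)
  (@wint_slope_dot_sq R n) (@wint_slope_norm R n) cu cf cg
  (fun a r w => @kernel_average R n p M q Omega u q1 oO pu a r w)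
  (fun a r w => @slope_upper_bound R n p M q Omega u a r w q1 pu)
  rho0 xO L0 (fun a Ka => (ugL a Ka).1) (fun a Ka => (ugL a Ka).2)
  (fun s s0 => compact_modulus oO Cu cf cK xO s0)
  n0 M0 q1 p0 C0 mq u0 (fun z _ => erefl)
  (fun x0 d Z0 Z => HC n x x0 d rho Z0 Z rho0).
have Xr : 0 < X / rho by exact: divr_gt0.
have P0 := powR_ge0 (X / rho) (1 / (q - 1)).
rewrite -(@ler_pXn2r _ 2)// ?nnegrE ?enorm_ge0 ?mulr_ge0// (le_trans H)//.
have -> : (X / rho) `^ (2 / (q - 1)) = ((X / rho) `^ (1 / (q - 1))) ^+ 2.
  rewrite -(powR_mulrn 2 P0) -powRrM; congr (_ `^ _); ring.
by rewrite exprMn ler_wpM2r ?sqr_ge0//; lra.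
Qed.

(** The segment from [x] to [y] is connected and misses the frontier, so [Omega] is both open and
    closed in it. An empty frontier is included, its distance being [+oo]. *)
Lemma segment_in_domain (R : realType) n (Omega : set 'rV[R]_n) x r :
  open Omega -> Omega x -> (r%:E < dist_rV x (frontier Omega))%E ->
  ecball x r `<=` Omega.
Proof.
move=> oO Ox rD y yx.
pose path (t : R) := x + t *: (y - x); pose A := path @` `[0, 1]%classic.
have cpath : continuous path.
  move=> t; apply: (@continuousD _ _ _ (fun=> x) (fun t : R => t *: (y - x))).
    exact: cst_continuous.
  exact: scalel_continuous.
have cA : connected A.
  apply: connected_continuous_connected; first exact: segment_connected.
  exact: continuous_subspaceT.
have AxE : A x by exists 0; rewrite /path/= ?in_itv/= ?lexx ?ler01// scale0r addr0.
have Ay : A y by exists 1; rewrite /path/= ?in_itv/= ?lexx ?ler01// scale1r subrKC.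
have nofront z : A z -> closure Omega z -> Omega z.
  move=> [t]; rewrite /= in_itv/= => /andP[t0 t1] <- clz.
  apply: contrapT => zO.
  have : (dist_rV x (frontier Omega) <= r%:E)%E.
    apply: (@le_trans _ _ (enorm (x - path t))%:E).
      apply: ereal_inf_lbound; exists (path t) => //; split=> //.
      by move=> /interior_subset.
    have E : path t - x = t *: (y - x) by rewrite /path addrC addKr.
    by rewrite lee_fin enormB E enormZ ger0_norm// (le_trans _ yx)// ler_piMl// enorm_ge0.
  by rewrite leNgt rD.
have : A `&` Omega = A.
  apply: cA.
  - by exists x.
  - by exists Omega.
  - exists (closure Omega); first exact: closed_closure.
    apply/seteqP; split=> z [Az Oz]; split=> //; first exact: subset_closure.
    exact: nofront.
by move=> /seteqP[_ /(_ y Ay)[]].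
Qed.

(** Letting [rho] grow would do; the contradiction takes the one radius [X / B] for which the right
    side equals [A / 2]. *)
Lemma powR_decay_le0 (R : realType) (A X s : R) : 0 < X -> 0 < s ->
  (forall rho, 0 < rho -> A <= 2 * (X / rho) `^ s) -> A <= 0.
Proof.
move=> X0 s0 H; rewrite leNgt; apply/negP => A0; pose B := (A / 4) `^ s^-1.
have A4 : 0 < A / 4 by exact: divr_gt0.
have B0 : 0 < B by exact: powR_gt0.
have := H (X / B) (divr_gt0 X0 B0).
rewrite invf_div mulrCA divff ?gt_eqF// mulr1 /B -powRrM mulVf ?gt_eqF//.
by rewrite powRr1 ?(ltW A4)//; lra.
Qed.

Lemma dist_rV_ge0 (R : realType) n (x : 'rV[R]_n) A : (0 <= dist_rV x A)%E.
Proof. by apply: le_ereal_inf_tmp => _ [y _ <-]; rewrite lee_fin enorm_ge0. Qed.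

(* Without gradient the flux term of the equation vanishes, while its right-hand side
   stays above u^p > 0. *)
Lemma grad_neq0 (R : realType) n (p M q : R) (u : 'rV[R]_n -> R) :
  0 < M -> 1 < q -> positive_solution p M q setT u -> ~ forall x, grad u x = 0.
Proof.
move=> M0 q1 pu g0; pose f := rhs p M q u; have c10 := @mass_bump_gt0 R n.
have f0 : 0 < f 0.
  by rewrite /f -[rhs _ _ _ _ _]/(_ + _) ltr_pwDl ?powR_gt0 ?pu.1// mulr_ge0 ?powR_ge0 ?ltW.
have f2 : 0 < f 0 / 2 by exact: divr_gt0.
have /continuous_enormP/(_ _ f2)[d d0 df] := continuous_rhs q1 pu (I : setT 0).
have d2 : 0 < d / 2 by exact: divr_gt0.
have := @slope_upper_bound R n p M q setT u 0 (d / 2) (f 0 / 2) q1 pu d2 (fun _ _ => I).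
have -> : wint bump_slope (fun y => dotrV (grad u (0 + (d / 2) *: y)) y) = 0.
  rewrite -[RHS](mul0r (mass (@bump_slope R n))) -(wint_cst (@bump_slope_weight R n) 0).
  by apply: (eq_wint bump_slope_weight) => y _; rewrite g0 dotrV0l.
have H b : ecball 0 (d / 2) b -> `|f b - f 0| <= f 0 / 2.
  rewrite /ecball/= => bd; apply/ltW/df; rewrite enormB.
  by apply: (le_lt_trans _ (_ : d / 2 < d)); [rewrite 1?enormB | lra].
move=> /(_ H); rewrite mulNr oppr_ge0 leNgt => /negP; apply.
by rewrite mulr_gt0// mulr_gt0// subr_gt0 -/(f 0); lra.
Qed.

(** At infinite distance every radius is allowed, so [A] vanishes; at distance zero the right side
    is [+oo]. *)
Lemma gradient_rate (R : realType) (A X s : R) (D : \bar R) : 0 <= A -> 0 < X -> 0 < s ->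
  (0 <= D)%E ->
  (forall rho, 0 < rho -> ((2 * rho)%:E < D)%E -> A <= 2 * (X / rho) `^ s) ->
  (A%:E <= (2 * (4 * X) `^ s)%:E * negpow D s)%E.
Proof.
move=> A0 X0 s0; have X4 : 0 < 4 * X by rewrite mulr_gt0.
have C0 : 0 < 2 * (4 * X) `^ s by rewrite mulr_gt0// powR_gt0.
rewrite /negpow; case: D => [d||]//; last first.
  move=> _ H; rewrite poweRyr ?gt_eqF// invey mule0 lee_fin.
  by apply: (powR_decay_le0 X0 s0) => rho rho0; exact: H (ltry _).
rewrite lee_fin le_eqVlt => /predU1P[<- _|d0 H].
  by rewrite poweR_EFin powR0 ?gt_eqF// inve0 gt0_muley ?lte_fin// leey.
rewrite poweR_EFin inver gt_eqF ?powR_gt0// -EFinM lee_fin.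
(* The radius [d / 4] respects the strict inequality and accounts for the [4 * X] in the
   constant. *)
have dd : 2 * (d / 4) < d by lra.
apply: le_trans (H _ (divr_gt0 d0 (ltr0Sn _ 3)) _) _; first by rewrite lte_fin.
have -> : X / (d / 4) = 4 * X * d^-1 by field; rewrite gt_eqF.
rewrite (powRM _ (ltW X4)) ?invr_ge0 ?(ltW d0)// -mulrA.
by rewrite -(powR_inv1 (ltW d0)) -powRrM mulN1r powRN.
Qed.

Theorem theorem1p4 (R : realType) (N : nat) (M q : R)
    (hN : (2 <= N)%N) (hM : 0 < M) (hq : (N%:R + 1) / (N%:R - 1) <= q) :
  (exists C : R, 0 < C /\
    forall (p : R), p <= 0 ->
    forall (Omega : set 'rV[R]_N) (u : 'rV[R]_N -> R),
      domain Omega -> positive_solution p M q Omega u ->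
      forall x, Omega x ->
        ((enorm (grad u x))%:E <=
           C%:E * negpow (dist_rV x (frontier Omega)) (1 / (q - 1)))%E) /\
  (forall p : R, p <= 0 ->
    ~ exists u : 'rV[R]_N -> R, positive_solution p M q [set: 'rV[R]_N] u).
Proof.
have n0 : (0 < N)%N by exact: leq_trans hN.
have q1 : 1 < q.
  apply: lt_le_trans hq; rewrite ltr_pdivlMr ?subr_gt0 ?ltr1n//; lra.
have s0 : 0 < 1 / (q - 1) by rewrite divr_gt0 ?subr_gt0.
have [X X0 bound] := @local_gradient_bound R N M q n0 hM q1; split.
  exists (2 * (4 * X) `^ (1 / (q - 1))); split=> [|p p0 Omega u [oO _ _] pu x Ox].
    by rewrite mulr_gt0// powR_gt0// mulr_gt0.
  apply: gradient_rate => //; [exact: enorm_ge0|exact: dist_rV_ge0|].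
  move=> rho rho0 /(segment_in_domain oO Ox) xO.
  exact: (bound p Omega u p0 oO pu x rho rho0 xO).
(* In the whole space every radius is admissible, so the gradient vanishes identically, which
   [grad_neq0] forbids. *)
move=> p p0 [u pu]; apply: (grad_neq0 hM q1 pu) => x.
apply/enorm_eq0/eqP; rewrite eq_le enorm_ge0 andbT.
apply: (powR_decay_le0 X0 s0) => rho rho0.
exact: (bound p setT u p0 openT pu x rho rho0).
Qed.
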